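(* Every variation of graded-polarized mixed Hodge structure $\mathcal V\to S$ supports a natural Higgs bundle structure $(\mathcal V,\bar\partial+\theta)$, namely the one given by the components $\bar\partial$ and $\theta$ of the Gauss--Manin connection described in the context. Moreover, this Higgs bundle structure is a fixed point of the $\mathbb C^*$ action $$(\mathcal V,\bar\partial+\theta)\mapsto(\mathcal V,\bar\partial+\lambda\theta),\qquad\lambda\in\mathbb C^*,$$ i.e. $(\mathcal V,\bar\partial+\lambda\theta)\cong(\mathcal V,\bar\partial+\theta)$ as Higgs bundles for every $\lambda\in\mathbb C^*$.
   Context: A variation of graded-polarized mixed Hodge structure $\mathcal V\to S$ over a complex manifold $S$ is a $\mathbb Q$-local system $\mathcal V_{\mathbb Q}$ of finite rank on $S$ with: (1) a rational (flat) increasing weight filtration $\mathcal W_k$ of $\mathcal V_{\mathbb C}=\mathcal V_{\mathbb Q}\otimes\mathbb C$; (2) a decreasing Hodge filtration $\mathcal F^p$ of $\mathcal V_{\mathbb C}\otimes\mathcal O_S$ by holomorphic subbundles; (3) rational non-degenerate (flat) bilinear forms $\mathcal S_k$ on $Gr^{\mathcal W}_k(\mathcal V_{\mathbb Q})$ of parity $(-1)^k$; such that (a) $\nabla\mathcal F^p\subseteq\Omega^1_S\otimes\mathcal F^{p-1}$ for the Gauss--Manin (flat) connection $\nabla$, and (b) each $(Gr^{\mathcal W}_k(\mathcal V_{\mathbb Q}),\mathcal F Gr^{\mathcal W}_k,\mathcal S_k)$ is a variation of pure, polarized Hodge structure of weight $k$. Deligne bigrading: a mixed Hodge structure $(F,W)$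 on $V=V_{\mathbb Q}\otimes\mathbb C$ determines a unique decomposition $V=\bigoplus_{p,q}I^{p,q}_{(F,W)}$ with $F^p=\bigoplus_{r\ge p,s}I^{r,s}$, $W_k=\bigoplus_{r+s\le k}I^{r,s}$ and $\overline{I^{p,q}}=I^{q,p}\bmod\bigoplus_{r<q,\,s<p}I^{r,s}$. Set $\mathcal U^p_s=\bigoplus_qI^{p,q}_{(\mathcal F_s,\mathcal W_s)}$, $C^\infty$ subbundles with $\mathcal V=\bigoplus_p\mathcal U^p$. They satisfy $\nabla:\mathcal E^0(\mathcal U^p)\to\mathcal E^{0,1}(\mathcal U^{p+1})\oplus\mathcal E^{0,1}(\mathcal U^p)\oplus\mathcal E^{1,0}(\mathcal U^p)\oplus\mathcal E^{1,0}(\mathcal U^{p-1})$, where $\mathcal E^{a,b}(\cdot)$ denotes smooth bundle-valued $(a,b)$-forms. Accordingly write $\nabla=\tau+\bar\partial+\partial+\theta$ with $\tau:\mathcal U^p\to\mathcal E^{0,1}\otimes\mathcal U^{p+1}$ and $\theta:\mathcal U^p\to\mathcal E^{1,0}\otimes\mathcal U^{p-1}$ tensorial, and $\bar\partial,\partial$ the components of types $(0,1)$ and $(1,0)$ preserving the decomposition. A Higgs bundle $(E,\bar\partial+\theta)$ is a holomorphic vector bundle $(E,\bar\partial)$ (with $\bar\partial$ the operator defining the integrable complex structure) together with an endomorphism-valued $(1,0)$-form $\theta$ such that $\bar\partial\theta=0$ and $\theta\wedge\theta=0$. *)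

(* Defs.v *)
From HB Require Import structures.
From mathcomp Require Import all_boot all_order all_algebra.
From mathcomp Require Import all_classical all_reals all_analysis.
From mathcomp Require Import complex.
Set Implicit Arguments.
Unset Strict Implicit.
Unset Printing Implicit Defensive.
Import Order.TTheory GRing.Theory Num.Theory numFieldNormedType.Exports.
Local Open Scope classical_set_scope.
Local Open Scope ring_scope.
Local Open Scope complex_scope.

(* rat and R[i] as fieldTypes, without residual coercions *)
Local Notation ratF := (ltac:(let t := eval unfold reverse_coercion in
  (rat : fieldType) in exact t)) (only parsing).
Local Notation complexF R := (ltac:(let t := eval unfold reverse_coercion in
  (R[i] : fieldType) in exact t)) (only parsing).

(* The space C^n is represented by 'rV[R]_(n + n): the j-th complex coordinate
   is z_j = x_j + i y_j, where x_j and y_j are the entries lshift n j and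
   rshift n j. *)
Section Calculus.
Context {R : realType}.

(* f is of class C^k on the open set A: all iterated partial derivatives of
   order at most k exist and are continuous at the points of A *)
Fixpoint classC (k d : nat) (A : set 'rV[R]_d) (f : 'rV[R]_d -> R) : Prop :=
  (forall x, A x -> {for x, continuous f}) /\
  if k is k'.+1 then
    forall j : 'I_d, (forall x, A x -> derivable f x (delta_mx 0 j)) /\
                     classC k' A (fun x => 'D_(delta_mx 0 j) f x)
  else True.

Definition smooth_on d (A : set 'rV[R]_d) (f : 'rV[R]_d -> R[i]) : Prop :=
  forall k, classC k A (fun x => complex.Re (f x)) /\
            classC k A (fun x => complex.Im (f x)).

Definition pderC d (j : 'I_d) (f : 'rV[R]_d -> R[i]) (x : 'rV[R]_d) : R[i] :=
  'D_(delta_mx 0 j) (fun y => complex.Re (f y)) x +i*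
  'D_(delta_mx 0 j) (fun y => complex.Im (f y)) x.

Definition zcoord n (j : 'I_n) (x : 'rV[R]_(n + n)) : R[i] :=
  x 0 (lshift n j) +i* x 0 (rshift n j).

Definition dz n (j : 'I_n) (f : 'rV[R]_(n + n) -> R[i]) (x : 'rV[R]_(n + n)) :=
  2^-1 * (pderC (lshift n j) f x - 'i * pderC (rshift n j) f x).

Definition dzbar n (j : 'I_n) (f : 'rV[R]_(n + n) -> R[i])
    (x : 'rV[R]_(n + n)) :=
  2^-1 * (pderC (lshift n j) f x + 'i * pderC (rshift n j) f x).

Definition holomorphic_on n (A : set 'rV[R]_(n + n))
    (f : 'rV[R]_(n + n) -> R[i]) : Prop :=
  smooth_on A f /\ forall x, A x -> forall j, dzbar j f x = 0.

End Calculus.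

(* chart i is a homeomorphism of the open set cdom i onto an open subset of
   C^n, with inverse chart_inv i. *)
Record complex_manifold (R : realType) (n : nat) := ComplexManifold {
  cm_top :> topologicalType;
  cm_hausdorff : hausdorff_space cm_top;
  cm_second_countable : @second_countable cm_top;
  chart_idx : Type;
  chart_at : cm_top -> chart_idx;
  cdom : chart_idx -> set cm_top;
  chart : chart_idx -> cm_top -> 'rV[R]_(n + n);
  chart_inv : chart_idx -> 'rV[R]_(n + n) -> cm_top;
  cdom_chart_at : forall s, cdom (chart_at s) s;
  open_cdom : forall i, open (cdom i);
  open_chart : forall i, open (chart i @` cdom i);
  chartK : forall i s, cdom i s -> chart_inv i (chart i s) = s;
  chart_cont : forall i s, cdom i s -> {for s, continuous (chart i)};
  chart_inv_cont : forall i s, cdom i s ->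
    {for chart i s, continuous (chart_inv i)};
  chart_holo : forall i i' (j : 'I_n),
    holomorphic_on (chart i @` (cdom i `&` cdom i'))
                   (fun x => zcoord j (chart i' (chart_inv i x)))
}.

Section Functions.
Context {R : realType} {n : nat} {S : complex_manifold R n}.

Definition smooth_fun (A : set S) (f : S -> R[i]) : Prop :=
  forall i : chart_idx S,
    smooth_on (chart i @` (A `&` cdom i)) (fun x => f (chart_inv i x)).

(* the derivatives of f at s along the coordinates z_j and \bar z_j of the
   chart i *)
Definition mdz (i : chart_idx S) (j : 'I_n) (f : S -> R[i]) (s : S) : R[i] :=
  dz j (fun x => f (chart_inv i x)) (chart i s).

Definition mdzbar (i : chart_idx S) (j : 'I_n) (f : S -> R[i]) (s : S) :
    R[i] :=
  dzbar j (fun x => f (chart_inv i x)) (chart i s).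

End Functions.

(* A family of K-vector spaces (K^(brk s))_s over S with local trivialisations:
   over fdom a, the rows of frame a s are a basis of the fibre at s, and v has
   the coordinates v *m coframe a s in it.  The fibres are compared through
   these frames only: the standard bases of the K^(brk s) for different s are
   unrelated, and brk may vary between the components of S. *)
Record framed_bundle (K : fieldType) (R : realType) (n : nat)
    (S : complex_manifold R n) := FramedBundle {
  brk : S -> nat;
  fr_idx : Type;
  fr_at : S -> fr_idx;
  fdom : fr_idx -> set S;
  frk : fr_idx -> nat;
  frame : forall (a : fr_idx) (s : S), 'M[K]_(frk a, brk s);
  coframe : forall (a : fr_idx) (s : S), 'M[K]_(brk s, frk a);
  fdom_fr_at : forall s, fdom (fr_at s) s;
  open_fdom : forall a, open (fdom a);
  frameK : forall a s, fdom a s -> frame a s *m coframe a s = 1%:M;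
  coframeK : forall a s, fdom a s -> coframe a s *m frame a s = 1%:M
}.

Definition section (K : fieldType) (R : realType) (n : nat)
    (S : complex_manifold R n) (E : framed_bundle K S) :=
  forall s : S, 'rV[K]_(brk E s).

Definition transition (K : fieldType) (R : realType) (n : nat)
    (S : complex_manifold R n) (E : framed_bundle K S) (a b : fr_idx E)
    (s : S) : 'M[K]_(frk a, frk b) :=
  frame a s *m coframe b s.

Record local_system (R : realType) (n : nat) (S : complex_manifold R n) :=
  LocalSystem {
  ls_bundle :> framed_bundle ratF S;
  ls_flat : forall (a b : fr_idx ls_bundle) (s : S), fdom a s -> fdom b s ->
    \forall t \near s, transition a b t = transition a b s
}.

Section Complexification.
Context {R : realType} {n : nat} {S : complex_manifold R n}.
Variable E : framed_bundle ratF S.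

Lemma complexify_frameK (a : fr_idx E) s : fdom a s ->
  map_mx (@ratr (complexF R)) (frame a s) *m map_mx (@ratr (complexF R)) (coframe a s) = 1%:M.
Proof. by move=> as_; rewrite -map_mxM frameK// map_mx1. Qed.

Lemma complexify_coframeK (a : fr_idx E) s : fdom a s ->
  map_mx (@ratr (complexF R)) (coframe a s) *m map_mx (@ratr (complexF R)) (frame a s) = 1%:M.
Proof. by move=> as_; rewrite -map_mxM coframeK// map_mx1. Qed.

Definition complexify : framed_bundle (complexF R) S :=
  @FramedBundle (complexF R) R n S (brk E) (fr_idx E) (@fr_at _ _ _ _ E)
    (@fdom _ _ _ _ E) (@frk _ _ _ _ E)
    (fun a s => map_mx (@ratr (complexF R)) (frame a s)) (fun a s => map_mx (@ratr (complexF R)) (coframe a s))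
    (@fdom_fr_at _ _ _ _ E) (@open_fdom _ _ _ _ E)
    complexify_frameK complexify_coframeK.

End Complexification.

(* C-infinity complex vector bundles, vector-valued 1-forms and Higgs bundles.
   Forms are given by their components in every chart: a form of type (1,0) is
   sum_j w i j dz_j, and one of type (0,1) is sum_j w i j d\bar z_j, over the
   domain of the chart i, with the components in two charts related by the
   chain rule.  An operator from sections to 1-forms sends a section to the
   components of its image; sections are total functions, but operators are only
   constrained on sections that are smooth on an open set. *)
Section Higgs.
Context {R : realType} {n : nat} {S : complex_manifold R n}.

Definition smooth_bundle (E : framed_bundle (complexF R) S) : Prop :=
  forall (a b : fr_idx E) k l,
    smooth_fun (fdom a `&` fdom b) (fun s => transition a b s k l).

Definition smooth_section (E : framed_bundle (complexF R) S) (A : set S)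
    (sigma : section E) : Prop :=
  forall (a : fr_idx E) (k : 'I_(frk a)),
    smooth_fun (A `&` fdom a) (fun s => (sigma s *m coframe a s) 0 k).

Definition smooth_hom (E E' : framed_bundle (complexF R) S) (A : set S)
    (g : forall s : S, 'M[R[i]]_(brk E s, brk E' s)) : Prop :=
  forall (a : fr_idx E) (b : fr_idx E') k l,
    smooth_fun (A `&` (fdom a `&` fdom b))
               (fun s => (frame a s *m g s *m coframe b s) k l).

Definition form_operator (E : framed_bundle (complexF R) S) :=
  forall (i : chart_idx S) (j : 'I_n), section E -> section E.

(* E^0(E) -> E^{0,1}(E) as a morphism of sheaves, with the Leibniz rule *)
Record dolbeault_operator (E : framed_bundle (complexF R) S) (D : form_operator E) :
    Prop := DolbeaultOperator {
  dop_local : forall (A : set S) (sigma tau : section E), open A ->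
    (forall s, A s -> sigma s = tau s) ->
    forall i j s, A s -> cdom i s -> D i j sigma s = D i j tau s;
  dop_smooth : forall (A : set S) (sigma : section E), open A ->
    smooth_section A sigma ->
    forall i j, smooth_section (A `&` cdom i) (D i j sigma);
  dop_add : forall (A : set S) (sigma tau : section E), open A ->
    smooth_section A sigma -> smooth_section A tau ->
    forall i j s, A s -> cdom i s ->
      D i j (fun t => sigma t + tau t) s = D i j sigma s + D i j tau s;
  dop_leibniz : forall (A : set S) (f : S -> R[i]) (sigma : section E),
    open A -> smooth_fun A f -> smooth_section A sigma ->
    forall i j s, A s -> cdom i s ->
      D i j (fun t => f t *: sigma t) s =
      mdzbar i j f s *: sigma s + f s *: D i j sigma s;
  dop_chart : forall (A : set S) (sigma : section E), open A ->
    smooth_section A sigma ->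
    forall i i' j s, A s -> cdom i s -> cdom i' s ->
      D i j sigma s =
      \sum_(k < n) mdzbar i j (fun t => conjc (zcoord k (chart i' t))) s
                   *: D i' k sigma s
}.

(* D is the operator of a holomorphic structure: there are local frames
   of D-holomorphic sections *)
Definition integrable (E : framed_bundle (complexF R) S) (D : form_operator E) : Prop :=
  forall s0 : S, exists (A : set S) (r : nat)
    (g : forall s : S, 'M[R[i]]_(r, brk E s)),
    [/\ open A, A s0,
        forall s, A s -> row_free (g s) /\ row_full (g s),
        forall k, smooth_section A (fun s => row k (g s) : 'rV_(brk E s)) &
        forall k i j s, A s -> cdom i s ->
          D i j (fun t => row k (g t) : 'rV_(brk E t)) s = 0].

(* theta is multiplication by a smooth End(E)-valued form of type (1,0);
   endomorphisms act on row vectors from the right *)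
Definition end_form10 (E : framed_bundle (complexF R) S) (theta : form_operator E) :
    Prop :=
  exists Theta : forall (i : chart_idx S) (j : 'I_n) (s : S),
      'M[R[i]]_(brk E s),
  [/\ forall i j, @smooth_hom E E (cdom i) (Theta i j),
      forall i i' j s, cdom i s -> cdom i' s ->
        Theta i j s =
        \sum_(k < n) mdz i j (fun t => zcoord k (chart i' t)) s *: Theta i' k s &
      forall (A : set S) (sigma : section E), open A ->
        smooth_section A sigma ->
        forall i j s, A s -> cdom i s ->
          theta i j sigma s = sigma s *m Theta i j s].

(* hb_hol and hb_comm are the vanishing of the coefficients of
   d\bar z_j /\ dz_k in D(theta) and of dz_j /\ dz_k in theta /\ theta *)
Record higgs_bundle (E : framed_bundle (complexF R) S) (D theta : form_operator E) :
    Prop := HiggsBundle {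
  hb_smooth : smooth_bundle E;
  hb_dolbeault : dolbeault_operator D;
  hb_integrable : integrable D;
  hb_form : end_form10 theta;
  hb_hol : forall (A : set S) (sigma : section E), open A ->
    smooth_section A sigma ->
    forall i j k s, A s -> cdom i s ->
      D i j (theta i k sigma) s - theta i k (D i j sigma) s = 0;
  hb_comm : forall (A : set S) (sigma : section E), open A ->
    smooth_section A sigma ->
    forall i j k s, A s -> cdom i s ->
      theta i j (theta i k sigma) s - theta i k (theta i j sigma) s = 0
}.

Definition scale_operator (E : framed_bundle (complexF R) S) (lambda : R[i])
    (theta : form_operator E) : form_operator E :=
  fun i j sigma s => lambda *: theta i j sigma s.

Definition higgs_iso (E E' : framed_bundle (complexF R) S)
    (D theta : form_operator E) (D' theta' : form_operator E') : Prop :=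
  exists g : forall s : S, 'M[R[i]]_(brk E s, brk E' s),
  [/\ smooth_hom setT g,
      forall s, row_free (g s) /\ row_full (g s) &
      forall (A : set S) (sigma : section E), open A ->
        smooth_section A sigma ->
        forall i j s, A s -> cdom i s ->
          D' i j (fun t => sigma t *m g t) s = D i j sigma s *m g s /\
          theta' i j (fun t => sigma t *m g t) s = theta i j sigma s *m g s].

End Higgs.

(* Linear algebra of one fibre V = C^m with V_Q = Q^m.  Subspaces are row
   spaces.  Subspaces of Gr^W_k = W_k / W_(k-1) are replaced by their preimages
   in W_k, and bilinear forms on Gr^W_k by forms on W_k with W_(k-1) in the
   radical. *)
Section Hodge.
Context {R : realType} {m : nat}.
Implicit Types (W : int -> 'M[rat]_m) (F : int -> 'M[R[i]]_m).

Definition cpx_mx p q (A : 'M[rat]_(p, q)) : 'M[R[i]]_(p, q) :=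
  map_mx (@ratr (complexF R)) A.

Definition conj_mx p q (A : 'M[R[i]]_(p, q)) : 'M[R[i]]_(p, q) :=
  map_mx (@conjc R) A.

Definition increasing_filtration W : Prop :=
  [/\ forall k l, k <= l -> (W k <= W l)%MS,
      exists k, W k = 0 & exists k, (W k :=: 1%:M)%MS].

Definition decreasing_filtration F : Prop :=
  [/\ forall p q, p <= q -> (F q <= F p)%MS,
      exists p, F p = 0 & exists p, (F p :=: 1%:M)%MS].

Definition grF W F (p k : int) : 'M[R[i]]_m :=
  (F p :&: cpx_mx (W k) + cpx_mx (W (k - 1)%R))%MS.

(* Gr_k = F^p Gr_k (+) conj (F^(k+1-p) Gr_k) for every p *)
Definition pure_on_gr W F (k : int) : Prop :=
  forall p : int,
    (grF W F p k + conj_mx (grF W F (k + 1 - p)%R k) :=: cpx_mx (W k))%MS /\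
    (grF W F p k :&: conj_mx (grF W F (k + 1 - p)%R k)
       :=: cpx_mx (W (k - 1)%R))%MS.

Definition bil (K : fieldType) (Q : 'M[K]_m) (u v : 'rV[K]_m) : K :=
  (u *m Q *m v^T) 0 0.

(* Q is a non-degenerate rational form of parity (-1)^k on Gr_k *)
Definition rational_form_on_gr W (k : int) (Q : 'M[rat]_m) : Prop :=
  [/\ forall u v, (u <= W (k - 1)%R)%MS -> (v <= W k)%MS -> bil Q u v = 0,
      forall u v, (u <= W k)%MS -> (v <= W k)%MS ->
        bil Q u v = (-1) ^+ `|k|%N * bil Q v u &
      forall u, (u <= W k)%MS -> (forall v, (v <= W k)%MS -> bil Q u v = 0) ->
        (u <= W (k - 1)%R)%MS].

(* Q polarizes Gr_k: the Hodge-Riemann bilinear relations, the second one being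
   i^(p-q) Q(v, \bar v) > 0 for non-zero v in H^(p,q) *)
Definition polarizes W F (k : int) (Q : 'M[rat]_m) : Prop :=
  (forall p u v, (u <= grF W F p k)%MS -> (v <= grF W F (k + 1 - p)%R k)%MS ->
     bil (cpx_mx Q) u v = 0) /\
  (forall (p q : int) v, p + q = k ->
     (v <= grF W F p k)%MS -> (v <= conj_mx (grF W F q k))%MS ->
     ~~ (v <= cpx_mx (W (k - 1)%R))%MS ->
     0 < 'i ^ (p - q) * bil (cpx_mx Q) v (conj_mx v)).

(* Sums over infinite index sets are sums over the finitely many non-zero
   terms; directness says that the ranks add up to dim V, as in mxdirect. *)
Record deligne_bigrading W F (I : int -> int -> 'M[R[i]]_m) : Prop :=
  DeligneBigrading {
  db_finite : finite_set [set pq : int * int | I pq.1 pq.2 != 0];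
  db_full : (\big[addsmx/0]_(pq \in [set: int * int]) I pq.1 pq.2
               :=: 1%:M)%MS;
  db_direct :
    (\big[addn/0%N]_(pq \in [set: int * int]) \rank (I pq.1 pq.2))%N = m;
  db_F : forall p, (F p :=:
    \big[addsmx/0]_(rs \in [set rs : int * int | (p <= rs.1)%R]) I rs.1 rs.2)%MS;
  db_W : forall k, (cpx_mx (W k) :=:
    \big[addsmx/0]_(rs \in [set rs : int * int | (rs.1 + rs.2 <= k)%R])
      I rs.1 rs.2)%MS;
  db_conj : forall p q : int,
    let L := \big[addsmx/0]_(rs \in [set rs : int * int |
                                      (rs.1 < q)%R && (rs.2 < p)%R])
      I rs.1 rs.2 in
    (conj_mx (I p q) + L :=: I q p + L)%MS
}.

Definition deligne W F : int -> int -> 'M[R[i]]_m :=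
  xget (fun _ _ => 0) [set I | deligne_bigrading W F I].

Definition deligne_U W F (p : int) : 'M[R[i]]_m :=
  \big[addsmx/0]_(q \in [set: int]) deligne W F p q.

(* the projection of V onto U^p along the sum of the U^r with r != p *)
Definition deligne_proj W F (p : int) : 'M[R[i]]_m :=
  proj_mx (deligne_U W F p)
          (\big[addsmx/0]_(r \in [set r : int | r != p]) deligne_U W F r).

End Hodge.

Section GaussManin.
Context {R : realType} {n : nat} {S : complex_manifold R n}.
Variable L : local_system S.

(* the components of the flat connection along z_j and \bar z_j: differentiate
   the coordinates in a flat frame *)
Definition nabla10 : form_operator (complexify L) := fun i j sigma s =>
  (\row_k mdz i j (fun t => (sigma t *m coframe (fr_at (complexify L) s) t) 0 k)
            s) *m frame (fr_at (complexify L) s) s.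

Definition nabla01 : form_operator (complexify L) := fun i j sigma s =>
  (\row_k mdzbar i j
            (fun t => (sigma t *m coframe (fr_at (complexify L) s) t) 0 k)
            s) *m frame (fr_at (complexify L) s) s.

Definition holo_section (A : set S) (sigma : section (complexify L)) : Prop :=
  smooth_section A sigma /\
  forall i j s, A s -> cdom i s -> nabla01 i j sigma s = 0.

Definition subspaces := forall s : S, 'M[R[i]]_(brk (complexify L) s).

Definition holo_subbundle (G : subspaces) : Prop :=
  forall s0 : S, exists (A : set S) (r : nat)
    (g : forall s : S, 'M[R[i]]_(r, brk (complexify L) s)),
    [/\ open A, A s0,
        forall k, holo_section A (fun s => row k (g s)) &
        forall s, A s -> row_free (g s) /\ (g s :=: G s)%MS].

(* nabla maps the holomorphic sections of G to Omega^1 (x) G' *)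
Definition nabla_maps (G G' : subspaces) : Prop :=
  forall (A : set S) (sigma : section (complexify L)), open A ->
    holo_section A sigma -> (forall s, A s -> (sigma s <= G s)%MS) ->
    forall i j s, A s -> cdom i s -> (nabla10 i j sigma s <= G' s)%MS.

Definition flat_subspaces (W : forall s : S, 'M[rat]_(brk L s)) : Prop :=
  forall (a : fr_idx L) (s : S), fdom a s ->
    \forall t \near s, (W t *m coframe a t :=: W s *m coframe a s)%MS.

(* flatness of the restriction of the form Q to the flat subspaces W *)
Definition flat_form (W Q : forall s : S, 'M[rat]_(brk L s)) : Prop :=
  forall (a : fr_idx L) (s : S) (x y : 'rV[rat]_(frk a)), fdom a s ->
    (x *m frame a s <= W s)%MS -> (y *m frame a s <= W s)%MS ->
    \forall t \near s, bil (Q t) (x *m frame a t) (y *m frame a t) =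
                       bil (Q s) (x *m frame a s) (y *m frame a s).

End GaussManin.

Arguments nabla10 {R n S} L i j sigma s.
Arguments nabla01 {R n S} L i j sigma s.
Arguments holo_subbundle {R n S} L G.
Arguments nabla_maps {R n S} L G G'.

(* Variations of graded-polarized mixed Hodge structure.  The fields gr_* state
   that Gr^W_k with the induced filtration and vQ k is a variation of pure
   polarized Hodge structure of weight k; holomorphic subbundles of Gr^W_k
   correspond to holomorphic subbundles of W_k containing W_(k-1). *)
Record vmhs (R : realType) (n : nat) (S : complex_manifold R n) := VMHS {
  vL :> local_system S;
  vW : int -> forall s : S, 'M[rat]_(brk vL s);
  vF : int -> subspaces vL;
  vQ : int -> forall s : S, 'M[rat]_(brk vL s);
  W_filtration : forall s, increasing_filtration (fun k => vW k s);
  W_flat : forall k, flat_subspaces (vW k);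
  F_filtration : forall s, decreasing_filtration (fun p => vF p s);
  F_holo : forall p, holo_subbundle vL (vF p);
  F_griffiths : forall p, nabla_maps vL (vF p) (vF (p - 1));
  gr_F_holo : forall p k, holo_subbundle vL
    (fun s => grF (fun l => vW l s) (fun r => vF r s) p k);
  gr_griffiths : forall p k, nabla_maps vL
    (fun s => grF (fun l => vW l s) (fun r => vF r s) p k)
    (fun s => grF (fun l => vW l s) (fun r => vF r s) (p - 1) k);
  gr_pure : forall k s, pure_on_gr (fun l => vW l s) (fun r => vF r s) k;
  gr_form : forall k s, rational_form_on_gr (fun l => vW l s) k (vQ k s);
  gr_form_flat : forall k, flat_form (vW k) (vQ k);
  gr_polarized : forall k s,
    polarizes (fun l => vW l s) (fun r => vF r s) k (vQ k s)
}.

Section Components.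
Context {R : realType} {n : nat} {S : complex_manifold R n}.
Variable V : vmhs S.

Definition Uproj (p : int) (s : S) : 'M[R[i]]_(brk (complexify V) s) :=
  deligne_proj (fun k => vW V k s) (fun r => vF V r s) p.

(* the component of D that maps U^p to U^(p+d)-valued forms, for all p *)
Definition component (d : int) (D : form_operator (complexify V)) :
    form_operator (complexify V) :=
  fun i j sigma s =>
    \sum_(p \in [set: int])
      D i j (fun t => sigma t *m Uproj p t) s *m Uproj (p + d) s.

Definition gm_tau := component 1 (nabla01 V).
Definition gm_dbar := component 0 (nabla01 V).
Definition gm_partial := component 0 (nabla10 V).
Definition gm_theta := component (- 1) (nabla10 V).

End Components.

Arguments gm_tau {R n S} V i j sigma s.
Arguments gm_dbar {R n S} V i j sigma s.
Arguments gm_partial {R n S} V i j sigma s.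
Arguments gm_theta {R n S} V i j sigma s.

(* Main.v *)
Require Import Defs.
From mathcomp Require Import all_boot all_order all_algebra.
From mathcomp Require Import all_classical all_reals all_analysis.
From mathcomp Require Import complex finmap ring lra zify.
Import Order.TTheory GRing.Theory Num.Theory numFieldNormedType.Exports.
Local Open Scope classical_set_scope.
Local Open Scope ring_scope.
Local Open Scope complex_scope.
Set Implicit Arguments.
Unset Strict Implicit.
Unset Printing Implicit Defensive.

(** Write [U^p] for the sum over [q] of the [I^{p,q}].  The proof describes the
    [U^p] by two filtrations that are each well behaved under differentiation.
    One is [F], where [F^p] is the sum of the [U^r] with [r >= p].  The other is
    the opposite filtration [G], where [G_p] is the sum of the [U^r] with
    [r <= p]; it can be written without the bigrading, as the sum over [l] of
    the intersections of [W_l] with the conjugate of [F^(l-p)] (definition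
    [oppF]).  By Griffiths transversality, the derivatives of sections of [F^p]
    lie in [F^p] along the antiholomorphic coordinates and in [F^(p-1)] along the
    holomorphic ones.  The connection is real and [W] is flat, so the derivatives
    of sections of [G_p] lie in [G_(p+1)] and in [G_p] respectively
    ([nabla_oppF]).  As [U^p] is the intersection of [F^p] and [G_p], the
    derivatives of its sections lie in [U^p + U^(p+1)] and [U^p + U^(p-1)]
    ([nabla_Uproj]).

    The Higgs equations follow by comparing components.  In a flat frame the
    connection is the differentiation of coordinates, so its components along
    different coordinates commute ([nabla_sym]).  The part of this commutation
    that maps [U^(q+1)] to [U^q], for one coordinate of each kind, says that the
    Higgs field is holomorphic; the part that maps [U^(q+2)] to [U^q], for two
    holomorphic coordinates, says that its components commute.  That the Higgs
    field is linear over functions and that the other component satisfies the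
    Leibniz rule is [gm_compM]: differentiating a coefficient does not move a
    section out of [U^p].

    Holomorphic frames for the new complex structure come from those of [F].  If
    [f] is a holomorphic section of [F^p], its projection to [U^p] differs from
    [f] by a section of [F^(p+1)], so the derivative of the projection along
    antiholomorphic coordinates has no component in [U^p]
    ([gm_dbar_Uproj_holo]).  In other words [U^p] is [F^p / F^(p+1)] as a
    holomorphic bundle.

    For the scalar action, multiplication by [lambda ^ p] on [U^p] commutes with
    the component of degree 0 and conjugates the Higgs field, of degree [-1], to
    [lambda] times itself ([gm_comp_grading]).

    All of this presupposes that the projections to the [U^p] are smooth
    ([Uproj_smooth]).  They are determined by local frames of [F] and [G].  To
    obtain those of [G], vectors in the intersection of [F^p] and [W_k] have to
    be extended to smooth sections ([FW_extend]); this is possible because the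
    ranks of these intersections are locally constant, which follows from the
    graded pieces by induction on the weight ([near_rank_FW]).  On one fibre, the
    existence of the bigrading and the identification of its partial sums with
    [F] and [G] rest on the decomposition [F_oppF_full], [F_oppF_cap] of [W_k]
    into its intersections with [F^p] and [G_(p-1)]. *)

(** * Finitely supported sums of subspaces *)

Section FiniteSums.

Lemma finite_support_sub (T : choiceType) (V : Type) (idx : V) (D : set T)
    (f : T -> V) i : i \in finite_support idx D f -> D i.
Proof.
case: finite_supportP => //= X XD _ _ iX; exact: XD.
Qed.

Lemma fs_lub (K : fieldType) m (T : choiceType) (f : T -> 'M[K]_m) (D : set T)
    p (X : 'M[K]_(p, m)) :
  (forall i, D i -> (f i <= X)%MS) ->
  (\big[addsmx/0]_(i \in D) f i <= X)%MS.
Proof.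
move=> fX; rewrite big_seq_cond.
apply: (big_ind (fun Y => (Y <= X)%MS)) => [|Y Z YX ZX|i].
- exact: sub0mx.
- by rewrite addsmx_sub YX.
- by rewrite andbT => iS; exact: fX (finite_support_sub iS).
Qed.

Lemma fs_ub (K : fieldType) m (T : choiceType) (f : T -> 'M[K]_m) (D : set T) i :
  finite_set [set j | f j != 0] -> D i ->
  (f i <= \big[addsmx/0]_(i \in D) f i)%MS.
Proof.
move=> fin Di; have [->|fi0] := eqVneq (f i) 0; first exact: sub0mx.
have iS : i \in finite_support 0 D f.
  have fin' : finite_set (D `&` f @^-1` [set~ 0]).
    by apply: sub_finite_set fin => j [_ /= /eqP].
  by rewrite (in_finite_support fin'); apply: mem_set; split => //=; exact/eqP.
rewrite (big_rem _ iS)/=; exact: addsmxSl.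
Qed.

Lemma fsum_seq (V : Type) (idx : V) (op : Monoid.com_law idx) (T : choiceType)
    (e : seq T) (f : T -> V) : uniq e -> (forall i, i \notin e -> f i = idx) ->
  \big[op/idx]_(i \in [set: T]) f i = \big[op/idx]_(i <- e) f i.
Proof.
move=> ue ef; rewrite (fsbigTE (seq_fset tt e)) => [|i]; last first.
  by rewrite seq_fsetE; exact: ef.
by apply: perm_big; apply: uniq_perm => // i; rewrite seq_fsetE.
Qed.

Lemma rank_seq_le (K : fieldType) m (T : Type) (e : seq T) (f : T -> 'M[K]_m)
    (P : pred T) :
  (\rank (\big[addsmx/0%R]_(i <- e | P i) f i) <= \sum_(i <- e | P i) \rank (f i))%N.
Proof.
elim: e => [|i e IH]; first by rewrite !big_nil mxrank0.
rewrite !big_cons; case: (P i) => //.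
by apply: leq_trans (mxrank_adds_leqif _ _) _; rewrite leq_add2l.
Qed.

Lemma seq_ub (K : fieldType) m (T : eqType) (e : seq T) (f : T -> 'M[K]_m)
    (P : pred T) i : i \in e -> P i ->
  (f i <= \big[addsmx/0]_(i <- e | P i) f i)%MS.
Proof.
move=> ie Pi; rewrite (big_rem _ ie)/= Pi; exact: addsmxSl.
Qed.

Lemma seq_lub (K : fieldType) m (T : eqType) (e : seq T) (f : T -> 'M[K]_m)
    (P : pred T) p (X : 'M[K]_(p, m)) :
  (forall i, i \in e -> P i -> (f i <= X)%MS) ->
  (\big[addsmx/0]_(i <- e | P i) f i <= X)%MS.
Proof.
move=> fX; rewrite big_seq_cond.
apply: (big_ind (fun Y => (Y <= X)%MS)) => [|Y Z YX ZX|i /andP[]].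
- exact: sub0mx.
- by rewrite addsmx_sub YX.
- exact: fX.
Qed.

Section Direct.
Variables (K : fieldType) (m : nat) (T : eqType) (e : seq T) (f : T -> 'M[K]_m).
Hypothesis dir : (\sum_(i <- e) \rank (f i) <= \rank (\big[addsmx/0%R]_(i <- e) f i))%N.

(** A subfamily of a direct family is direct, since otherwise the ranks of the two
    complementary subfamilies would not add up. *)
Lemma direct_rank (P : pred T) :
  \rank (\big[addsmx/0]_(i <- e | P i) f i) = (\sum_(i <- e | P i) \rank (f i))%N.
Proof.
apply/eqP; rewrite eqn_leq rank_seq_le/=.
have le1 : (\rank (\big[addsmx/0%R]_(i <- e) f i) <=
    \rank (\big[addsmx/0%R]_(i <- e | P i) f i) +
    \rank (\big[addsmx/0%R]_(i <- e | ~~ P i) f i))%N.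
  apply: leq_trans (mxrank_adds_leqif _ _).
  apply/mxrankS/seq_lub => i ie _; have [Pi|Pi] := boolP (P i).
    by apply: submx_trans (addsmxSl _ _); exact: seq_ub.
  by apply: submx_trans (addsmxSr _ _); exact: (seq_ub f (P := fun i => ~~ P i)).
have le2 := rank_seq_le e f (fun i => ~~ P i).
move: (leq_trans dir le1); rewrite (bigID P)/= => le3.
rewrite -(leq_add2r (\sum_(i <- e | ~~ P i) \rank (f i))).
by apply: leq_trans le3 _; rewrite leq_add2l.
Qed.

(** The rank formula for a sum and an intersection: by [direct_rank] the ranks of
    both sides are sums over the same indices. *)
Lemma direct_cap (P Q : pred T) :
  (\big[addsmx/0]_(i <- e | P i) f i :&: \big[addsmx/0]_(i <- e | Q i) f i
     <= \big[addsmx/0]_(i <- e | P i && Q i) f i)%MS.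
Proof.
set A := (X in (X :&: _)%MS); set B := (X in (_ :&: X)%MS); set D := (X in (_ <= X)%MS).
have DAB : (D <= A :&: B)%MS.
  by rewrite sub_capmx; apply/andP; split; apply: seq_lub => i ie /andP[Pi Qi];
     exact: seq_ub.
have AB : (\rank (A + B)%MS = \sum_(i <- e | P i || Q i) \rank (f i))%N.
  rewrite -direct_rank; apply/eqmx_rank; apply/andP; split.
    by rewrite addsmx_sub; apply/andP; split; apply: seq_lub => i ie Pi;
      apply: (seq_ub f (P := fun i => P i || Q i)) => //; rewrite Pi ?orbT.
  apply: seq_lub => i ie /orP[Pi|Qi].
    by apply: submx_trans (addsmxSl _ _); exact: seq_ub.
  by apply: submx_trans (addsmxSr _ _); exact: seq_ub.
have rD : (\rank D = \sum_(i <- e | P i && Q i) \rank (f i))%N by exact: direct_rank.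
have rAB : (\sum_(i <- e | P i || Q i) \rank (f i) +
    \sum_(i <- e | P i && Q i) \rank (f i) = \rank A + \rank B)%N.
  rewrite !direct_rank !(big_mkcond _ (fun i => \rank (f i))) -!big_split/=.
  by apply: eq_bigr => i _; case: (P i); case: (Q i); rewrite ?addn0.
have := mxrank_sum_cap A B; rewrite AB -rAB -rD => /addnI rE.
by have := mxrank_leqif_sup DAB; rewrite rE => -[_ <-].
Qed.

End Direct.

End FiniteSums.

(** * Subspaces and conjugation *)

Section ConjugateMatrices.
Context {R : realType}.
Local Notation C := R[i].

Lemma conj_mxK p q : involutive (@conj_mx R p q).
Proof. by move=> M; apply/matrixP => k l; rewrite !mxE conjcK. Qed.

Lemma conj_mx_sub p q m (A : 'M[C]_(p, m)) (B : 'M[C]_(q, m)) :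
  (conj_mx A <= conj_mx B)%MS = (A <= B)%MS.
Proof. exact: map_submx. Qed.

Lemma conj_mx_cap p q m (A : 'M[C]_(p, m)) (B : 'M[C]_(q, m)) :
  (conj_mx (A :&: B)%MS :=: conj_mx A :&: conj_mx B)%MS.
Proof. exact: map_capmx. Qed.

Lemma conj_mx_adds p q m (A : 'M[C]_(p, m)) (B : 'M[C]_(q, m)) :
  (conj_mx (A + B)%MS :=: conj_mx A + conj_mx B)%MS.
Proof. exact: map_addsmx. Qed.

Lemma conj_mx_subl p q m (A : 'M[C]_(p, m)) (B : 'M[C]_(q, m)) :
  (conj_mx A <= B)%MS = (A <= conj_mx B)%MS.
Proof. by rewrite -conj_mx_sub conj_mxK. Qed.

Lemma conj_ratr p q (M : 'M[rat]_(p, q)) :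
  conj_mx (map_mx (@ratr C) M) = map_mx (@ratr C) M.
Proof.
by apply/matrixP => k l; rewrite !mxE; exact: (fmorph_rat (@conjc R)).
Qed.

Lemma conj_mxM p q r (M : 'M[C]_(p, q)) (N : 'M[C]_(q, r)) :
  conj_mx (M *m N) = conj_mx M *m conj_mx N.
Proof. exact: map_mxM. Qed.

Lemma conj_mxB p q (A B : 'M[C]_(p, q)) : conj_mx (A - B) = conj_mx A - conj_mx B.
Proof. exact: map_mxB. Qed.

Lemma adds_elim (K : fieldType) p q m (v : 'rV[K]_m) (A : 'M[K]_(p, m))
    (B : 'M[K]_(q, m)) : (v <= A + B)%MS ->
  exists a b, [/\ (a <= A)%MS, (b <= B)%MS & v = a + b].
Proof.
case/sub_addsmxP => -[a b] ->; exists (a *m A), (b *m B).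
by split; rewrite ?submxMl.
Qed.

Lemma sub_addl (K : fieldType) p q r m (v : 'M[K]_(r, m)) (A : 'M[K]_(p, m))
    (B : 'M[K]_(q, m)) : (v <= A)%MS -> (v <= A + B)%MS.
Proof. by move=> vA; apply: submx_trans vA (addsmxSl _ _). Qed.

Lemma sub_addr (K : fieldType) p q r m (v : 'M[K]_(r, m)) (A : 'M[K]_(p, m))
    (B : 'M[K]_(q, m)) : (v <= B)%MS -> (v <= A + B)%MS.
Proof. by move=> vB; apply: submx_trans vB (addsmxSr _ _). Qed.

Lemma sub_sub (K : fieldType) p r m (u v : 'M[K]_(r, m)) (A : 'M[K]_(p, m)) :
  (u <= A)%MS -> (v <= A)%MS -> (u - v <= A)%MS.
Proof. by move=> uA vA; apply: addmx_sub; rewrite ?eqmx_opp. Qed.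

Lemma cap0_elim (K : fieldType) p q m (A : 'M[K]_(p, m)) (B : 'M[K]_(q, m)) :
  (forall v : 'rV[K]_m, (v <= A)%MS -> (v <= B)%MS -> v = 0) ->
  (A :&: B)%MS = 0.
Proof.
move=> AB0; apply/eqP/rowV0P => v; rewrite sub_capmx => /andP[vA vB].
exact: AB0.
Qed.

End ConjugateMatrices.

Lemma int_up_ind (k0 : int) (P : int -> Prop) :
  (forall k, k <= k0 -> P k) -> (forall k, P (k - 1) -> P k) -> forall k, P k.
Proof.
move=> P0 PS k; have [kk0|/ltW k0k] := leP k k0; first exact: P0.
have -> : k = k0 + `|k - k0|%N%:Z by lia.
elim: `|k - k0|%N => [|j IH]; first by rewrite addr0; exact: P0.
by apply: PS; rewrite -addn1 PoszD addrA addrK.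
Qed.

Lemma int_down_ind (k0 : int) (P : int -> Prop) :
  (forall k, k0 <= k -> P k) -> (forall k, P (k + 1) -> P k) -> forall k, P k.
Proof.
move=> P0 PS k; rewrite -(opprK k).
apply: (@int_up_ind (- k0) (fun k => P (- k))) => [l|l Pl].
  by rewrite lerNr; exact: P0.
by apply: PS; move: Pl; rewrite opprB addrC.
Qed.

Definition int_range (lo hi : int) : seq int :=
  [seq lo + k%:Z | k <- iota 0 `|hi - lo|%N].

Lemma mem_int_range lo hi k : lo <= hi -> (k \in int_range lo hi) = (lo <= k < hi).
Proof.
move=> lohi; apply/mapP/idP => [[j]|/andP[lok khi]].
  by rewrite mem_iota add0n => /andP[_ jh] ->; lia.
by exists `|k - lo|%N; [rewrite mem_iota|]; lia.
Qed.

Lemma int_range_uniq lo hi : uniq (int_range lo hi).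
Proof. by rewrite map_inj_uniq ?iota_uniq// => j k /addrI[]. Qed.

(** * The filtration opposite to the Hodge filtration of one fibre *)

Section MixedHodgeStructure.
Context {R : realType} {m : nat}.
Local Notation C := R[i].
Variables (W : int -> 'M[rat]_m) (F : int -> 'M[C]_m).
Hypotheses (Wf : increasing_filtration W) (Ff : decreasing_filtration F).
Hypothesis pure : forall k, pure_on_gr W F k.

Implicit Types (p q k l : int) (v : 'rV[C]_m).

Definition cW k : 'M[C]_m := cpx_mx (W k).
Definition FW p k : 'M[C]_m := (F p :&: cW k)%MS.
Definition cFW p k : 'M[C]_m := (conj_mx (F p) :&: cW k)%MS.

(** [oppF p K], for [W K] the whole space, is the sum of the [U^r] with
    [r <= p]. It is the increasing filtration opposite to [F], written without the
    bigrading; [k] truncates it by the weight. *)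
Definition oppF p k : 'M[C]_m :=
  \big[addsmx/0]_(l \in [set l | l <= k]) cFW (l - p) l.

Lemma cW_le k l : k <= l -> (cW k <= cW l)%MS.
Proof. by move=> kl; have [Wm _ _] := Wf; rewrite /cW map_submx Wm. Qed.

Lemma F_le p q : p <= q -> (F q <= F p)%MS.
Proof. by have [Fm _ _] := Ff; exact: Fm. Qed.

Lemma W_low : exists k0, forall k, k <= k0 -> cW k = 0.
Proof.
have [Wm [k0 Wk0] _] := Wf; exists k0 => k kk0.
by apply/eqP; rewrite -submx0 (submx_trans (cW_le kk0))// /cW Wk0 /cpx_mx map_mx0.
Qed.

Lemma W_high : exists k1, forall k, k1 <= k -> (1%:M <= cW k)%MS.
Proof.
have [Wm _ [k1 Wk1]] := Wf; exists k1 => k kk1.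
apply: submx_trans (cW_le kk1); rewrite /cW -(map_mx1 (@ratr C)) /cpx_mx map_submx.
by rewrite Wk1.
Qed.

Lemma F_high : exists p1, forall p, p1 <= p -> F p = 0.
Proof.
have [Fm [p1 Fp1] _] := Ff; exists p1 => p pp1.
by apply/eqP; rewrite -submx0 -Fp1 F_le.
Qed.

Lemma F_low : exists p0, forall p, p <= p0 -> (1%:M <= F p)%MS.
Proof.
have [Fm _ [p0 Fp0]] := Ff; exists p0 => p pp0.
by apply: submx_trans (F_le pp0); rewrite Fp0.
Qed.

Lemma conj_cW k : conj_mx (cW k) = cW k.
Proof. exact: conj_ratr. Qed.

Lemma conj_FW p k : (conj_mx (FW p k) :=: cFW p k)%MS.
Proof. by apply: eqmx_trans (conj_mx_cap _ _) _; rewrite conj_cW. Qed.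

Lemma conj_cFW p k : (conj_mx (cFW p k) :=: FW p k)%MS.
Proof. by apply: eqmx_trans (conj_mx_cap _ _) _; rewrite conj_cW conj_mxK. Qed.

Lemma cFW_le p q k l : q <= p -> k <= l -> (cFW p k <= cFW q l)%MS.
Proof.
by move=> qp kl; apply: capmxS; [rewrite conj_mx_sub F_le|exact: cW_le].
Qed.

Lemma FW_le p q k l : q <= p -> k <= l -> (FW p k <= FW q l)%MS.
Proof. by move=> qp kl; apply: capmxS; [exact: F_le|exact: cW_le]. Qed.

(** Purity of the graded piece in terms of vectors: [W k] is the sum of [F^p] and
    the conjugate of [F^(k+1-p)], up to lower weight. *)
Lemma pure_gen p k v : (v <= cW k)%MS -> exists a b w,
  [/\ (a <= FW p k)%MS, (b <= cFW (k + 1 - p) k)%MS, (w <= cW (k - 1))%MS &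
      v = a + b + w].
Proof.
move=> vW; have [full _] := pure k p.
have : (v <= grF W F p k + conj_mx (grF W F (k + 1 - p) k))%MS by rewrite full.
case/adds_elim => x [y [xF yF ->]].
have [a [w [aF wW ->]]] := adds_elim xF.
have : (y <= conj_mx (FW (k + 1 - p) k) + conj_mx (cW (k - 1)))%MS.
  by rewrite -conj_mx_adds.
case/adds_elim => b [w' [bF w'W ->]].
exists a, b, (w + w'); split; [exact: aF| | |].
- by rewrite -conj_FW.
- by apply: addmx_sub => //; rewrite -conj_cW.
- by rewrite addrACA addrA.
Qed.

Lemma pure_cap p k v : (v <= FW p k + cW (k - 1))%MS ->
  (v <= cFW (k + 1 - p) k + cW (k - 1))%MS -> (v <= cW (k - 1))%MS.
Proof.
move=> vF vcF; have [_ cap] := pure k p.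
rewrite /cW -cap sub_capmx; apply/andP; split; first exact: vF.
rewrite -conj_mx_subl; move: vcF; rewrite -conj_mx_sub.
by rewrite conj_mx_adds (adds_eqmx (conj_cFW _ _) (eqmx_refl _)) conj_cW.
Qed.

Lemma oppF_finite p k : finite_set [set l | l <= k /\ cFW (l - p) l != 0].
Proof.
have [k0 W0] := W_low.
apply: (@sub_finite_set _ _ [set` int_range k0 (Num.max k0 (k + 1))]).
  move=> l [lk l0] /=; rewrite mem_int_range ?le_max ?lexx//.
  have : k0 < l.
    rewrite ltNge; apply: contra l0 => /W0 Wl.
    by rewrite /cFW Wl capmx0.
  by lia.
exact: finite_seq.
Qed.

Lemma oppF_ub p k l : l <= k -> (cFW (l - p) l <= oppF p k)%MS.
Proof.
move=> lk; have [->|l0] := eqVneq (cFW (l - p) l) 0; first exact: sub0mx.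
have iS : l \in finite_support 0 [set l | l <= k] (fun l => cFW (l - p) l).
  rewrite in_finite_support; first by apply: mem_set; split => //=; exact/eqP.
  by apply: sub_finite_set (oppF_finite p k) => j [jk /= /eqP].
rewrite /oppF (big_rem _ iS)/=; exact: addsmxSl.
Qed.

Lemma oppF_lub p k r (X : 'M[C]_(r, m)) :
  (forall l, l <= k -> (cFW (l - p) l <= X)%MS) -> (oppF p k <= X)%MS.
Proof. exact: fs_lub. Qed.

Lemma oppF_cW p k : (oppF p k <= cW k)%MS.
Proof.
by apply: oppF_lub => l lk; apply: submx_trans (capmxSr _ _) (cW_le lk).
Qed.

Lemma oppF_le p q k l : p <= q -> k <= l -> (oppF p k <= oppF q l)%MS.
Proof.
move=> pq kl; apply: oppF_lub => j jk.
apply: submx_trans (oppF_ub q (le_trans jk kl)); apply: cFW_le => //.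
by rewrite lerD2l lerN2.
Qed.

Lemma oppF_rec p k : (oppF p k :=: cFW (k - p) k + oppF p (k - 1))%MS.
Proof.
apply/eqmxP; rewrite addsmx_sub oppF_ub//= oppF_le//; last by lia.
rewrite andbT; apply: oppF_lub => l lk.
have [->|lk'] := eqVneq l k; first exact: addsmxSl.
by apply: sub_addr; apply: oppF_ub; lia.
Qed.

Lemma oppF_gen p l k : (forall j, k <= j -> (1%:M <= cW j)%MS) ->
  (cFW (l - p) l <= oppF p k)%MS.
Proof.
move=> Wk; have [lk|kl] := leP l k; first exact: oppF_ub.
apply: submx_trans (oppF_ub p (lexx k)).
apply: submx_trans (_ : (cFW (k - p) l <= _)%MS).
  by apply: cFW_le => //; lia.
by apply: capmxS => //; apply: submx_trans (submx1 _) (Wk _ _).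
Qed.

(** Modulo [W (k - 1)], the right-hand side is [F^p] plus the conjugate of
    [F^(k+1-p)]; the terms of lower weight correct this congruence to an
    equality. *)
Lemma F_oppF_full p k : (cW k <= FW p k + oppF (p - 1) k)%MS.
Proof.
have [k0 W0] := W_low; elim/(@int_up_ind k0): k => [k kk0|k IH].
  by rewrite W0// sub0mx.
apply/rV_subP => v /(pure_gen p)[a [b [w [aF bF wW ->]]]].
apply: addmx_sub; first apply: addmx_sub.
- exact: sub_addl.
- apply: sub_addr; rewrite oppF_rec; apply: sub_addl.
  by rewrite opprB addrA addrAC in bF *.
- apply: submx_trans wW (submx_trans IH _); apply: addsmxS.
    by apply: FW_le => //; lia.
  by apply: oppF_le => //; lia.
Qed.

Lemma cFW_W a k l v : (v <= cFW a k)%MS -> (v <= cW l)%MS -> (v <= cFW a l)%MS.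
Proof. by rewrite !sub_capmx => /andP[-> _] ->. Qed.

(** By induction on the weight: modulo [W (k - 1)] such a vector lies in [F^p] and
    in the conjugate of [F^(k+1-p)], so purity lowers its weight. *)
Lemma F_oppF_cap p k v : (v <= F p)%MS -> (v <= oppF (p - 1) k)%MS -> v = 0.
Proof.
have [k0 W0] := W_low; elim/(@int_up_ind k0): k => [k kk0|k IH] vF vG.
  by apply/eqP; rewrite -submx0 -(W0 k kk0) (submx_trans vG)// oppF_cW.
apply: IH => //; move: (vG); rewrite oppF_rec => /adds_elim[g [h [gF hG E]]].
have vW : (v <= cW k)%MS by apply: submx_trans vG (oppF_cW _ _).
have hW : (h <= cW (k - 1))%MS by apply: submx_trans hG (oppF_cW _ _).
have vW1 : (v <= cW (k - 1))%MS.
  apply: (@pure_cap p); first by apply: sub_addl; rewrite sub_capmx vF.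
  rewrite E; apply: addmx_sub; last exact: sub_addr.
  by apply: sub_addl; rewrite opprB addrA addrAC in gF *.
rewrite E; apply: addmx_sub => //.
apply: submx_trans (oppF_ub _ (lexx _)).
have -> : k - 1 - (p - 1) = k - (p - 1) - 1 by lia.
have gW : (g <= cW (k - 1))%MS by rewrite (_ : g = v - h) ?sub_sub// E addrK.
apply: submx_trans (cFW_W gF gW) _; apply: cFW_le => //; lia.
Qed.

Section Bigrading.

(** Deligne's formula for [I^{p,q}], the sum over the conjugates of lower weight
    being absorbed in [oppF]. *)
Definition deligneI p q : 'M[C]_m :=
  (F p :&: (cFW q (p + q) + oppF (p - 1) (p + q - 2)))%MS.

(** The summand [oppF (p - 1) (p + q - 2)] in [deligneI] enters through this
    lowering of the weight: the other summand loses a weight together with the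
    whole vector. *)
Lemma oppF_weight b k v : (v <= cFW (k - b) k + oppF (b - 1) (k - 2))%MS ->
  (v <= cW (k - 1))%MS -> (v <= oppF (b - 1) (k - 1))%MS.
Proof.
case/adds_elim => g [h [gF hG ->]] vW.
have hW : (h <= cW (k - 1))%MS.
  by apply: submx_trans hG (submx_trans (oppF_cW _ _) _); apply: cW_le; lia.
have gW : (g <= cW (k - 1))%MS by rewrite -(addrK h g) sub_sub.
apply: addmx_sub; last by apply: submx_trans hG (oppF_le _ _); lia.
apply: submx_trans (cFW_W gF gW) _; apply: submx_trans (oppF_ub _ (lexx _)).
by apply: cFW_le => //; lia.
Qed.

Lemma deligneI_F p q : (deligneI p q <= F p)%MS.
Proof. exact: capmxSl. Qed.

Lemma deligneI_cFW p q :
  (deligneI p q <= cFW (p + q - p) (p + q) + oppF (p - 1) (p + q - 2))%MS.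
Proof. by rewrite addrAC subrr add0r; exact: capmxSr. Qed.

Lemma deligneI_cW p q : (deligneI p q <= cW (p + q))%MS.
Proof.
apply: submx_trans (deligneI_cFW p q) _; rewrite addsmx_sub capmxSr/=.
by apply: submx_trans (oppF_cW _ _) (cW_le _); lia.
Qed.

Lemma deligneI_oppF p q : (deligneI p q <= oppF p (p + q))%MS.
Proof.
apply: submx_trans (deligneI_cFW p q) _; rewrite addsmx_sub oppF_ub//=.
by apply: oppF_le; lia.
Qed.

(** The vector lies in [F^p] and, by [oppF_weight], in [oppF (p - 1)], which
    meet in zero. *)
Lemma deligneI_W0 p q v : (v <= deligneI p q)%MS -> (v <= cW (p + q - 1))%MS -> v = 0.
Proof.
move=> vI vW; apply: (@F_oppF_cap p (p + q - 1)).
  by apply: submx_trans vI (deligneI_F _ _).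
by apply: oppF_weight => //; apply: submx_trans vI (deligneI_cFW _ _).
Qed.

(** The two representatives of a class of type (p, q), in [F^p] and in the
    conjugate of [F^q], differ by a vector of lower weight; [F_oppF_full] splits
    the difference between them. *)
Lemma deligneI_lift p q v : (v <= FW p (p + q) + cW (p + q - 1))%MS ->
  (v <= cFW q (p + q) + cW (p + q - 1))%MS ->
  exists x w, [/\ (x <= deligneI p q)%MS, (w <= cW (p + q - 1))%MS & v = x + w].
Proof.
set k := p + q.
move=> /adds_elim[f [w1 [fF w1W E1]]] /adds_elim[g [w2 [gF w2W E2]]].
have : (f - g <= cW (k - 1))%MS.
  have -> : f - g = w2 - w1.
    by apply/eqP; rewrite subr_eq addrAC -subr_eq opprK -E1 E2 addrC.
  exact: sub_sub.
move=> /submx_trans/(_ (F_oppF_full p (k - 1)))/adds_elim[a [b [aF bG Eab]]].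
move: bG; rewrite oppF_rec => /adds_elim[b1 [b2 [b1F b2G Eb]]].
exists (f - a), (a + w1); split.
- rewrite sub_capmx; apply/andP; split.
    apply: sub_sub; first by apply: submx_trans fF (capmxSl _ _).
    by apply: submx_trans aF (capmxSl _ _).
  have -> : f - a = (g + b1) + b2.
    by apply/eqP; rewrite subr_eq -(addrA g) -Eb -addrA (addrC b) -Eab addrC subrK.
  apply: addmx_sub; first apply: sub_addl.
    apply: (addmx_sub gF); apply: submx_trans b1F (cFW_le _ _); rewrite /k; lia.
  apply: sub_addr; apply: submx_trans b2G (oppF_le _ _); rewrite /k; lia.
- apply: addmx_sub => //.
  by apply: submx_trans aF (capmxSr _ _).
- by rewrite addrA subrK.
Qed.

(** The recursion through which the [deligneI] exhaust [F^p] and [W k]: by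
    [deligneI_lift], [deligneI p (k - p)] represents what [FW p k] has beyond the
    next step of either filtration. *)
Lemma FW_rec p k : (FW p k :=: deligneI p (k - p) + (FW (p + 1) k + FW p (k - 1)))%MS.
Proof.
have kE : p + (k - p) = k by rewrite addrC subrK.
apply/eqmxP/andP; split; last first.
  rewrite !addsmx_sub sub_capmx deligneI_F/=.
  have := deligneI_cW p (k - p); rewrite kE => ->/=.
  by rewrite !FW_le//; lia.
apply/rV_subP => v vF.
have := vF; rewrite {1}/FW sub_capmx => /andP[vF' vW].
have [a [b [w [aF bF wW E]]]] := pure_gen (p + 1) vW.
have aFp : (a <= FW p k)%MS by apply: submx_trans aF (FW_le _ _); lia.
have E' : v - a = b + w by rewrite E -(addrA a) [a + _]addrC addrK.
have [||x [w' [xI w'W E2]]] := @deligneI_lift p (k - p) (v - a).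
- by rewrite kE; apply: sub_addl; exact: sub_sub.
- rewrite kE E'; apply: addmx_sub; last exact: sub_addr.
  apply: sub_addl; rewrite (_ : k - p = k + 1 - (p + 1))//; lia.
rewrite -(subrK a v) E2 -addrA; apply: addmx_sub; first exact: sub_addl.
apply: sub_addr; rewrite addrC; apply: addmx_sub; first exact: sub_addl.
apply: sub_addr; rewrite sub_capmx; rewrite kE in w'W; rewrite w'W andbT.
have -> : w' = (v - a) - x by rewrite E2 [x + _]addrC addrK.
apply: sub_sub; last by apply: submx_trans xI (deligneI_F _ _).
by apply: sub_sub => //; apply: submx_trans aFp (capmxSl _ _).
Qed.

Lemma FW_rec_cap p k : (deligneI p (k - p) :&: (FW (p + 1) k + FW p (k - 1)))%MS = 0.
Proof.
have kE : p + (k - p) = k by rewrite addrC subrK.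
apply: cap0_elim => v vI vFW; apply: (deligneI_W0 vI); rewrite kE.
apply: (@pure_cap (p + 1)).
  apply: submx_trans vFW _; apply: addsmxS => //; exact: capmxSr.
have := submx_trans vI (deligneI_cFW _ _); rewrite kE => /submx_trans; apply.
apply: addsmxS; first by apply: cFW_le => //; lia.
by apply: submx_trans (oppF_cW _ _) (cW_le _); lia.
Qed.

End Bigrading.

End MixedHodgeStructure.

(** * Existence of the bigrading *)

Lemma sum_int_range (f : int -> int) lo hi : lo <= hi ->
  \sum_(k <- int_range lo hi) (f (k + 1) - f k) = f hi - f lo.
Proof.
move=> lohi; rewrite /int_range big_map.
transitivity (\sum_(0 <= j < `|hi - lo|%N) (f (lo + j.+1%:Z) - f (lo + j%:Z))).
  rewrite /index_iota subn0; apply: eq_bigr => j _.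
  by rewrite -addrA -PoszD addn1.
rewrite (telescope_sumr (fun j : nat => f (lo + j%:Z)))// addr0.
by congr (f _ - _); lia.
Qed.

Section DeligneExistence.
Context {R : realType} {m : nat}.
Local Notation C := R[i].
Variables (W : int -> 'M[rat]_m) (F : int -> 'M[C]_m).
Hypotheses (Wf : increasing_filtration W) (Ff : decreasing_filtration F).
Hypothesis pure : forall k, pure_on_gr W F k.

Implicit Types (p q k l : int) (v : 'rV[C]_m).

Local Notation cW := (@cW R m W).
Local Notation FW := (@FW R m W F).
Local Notation cFW := (@cFW R m W F).
Local Notation oppF := (@oppF R m W F).
Local Notation I := (@deligneI R m W F).

(** Both filtrations are exhausted between finite bounds, so the bigrading is
    supported in a finite box. *)
Lemma hodge_box : exists p0 p1 k0 k1, [/\ p0 <= p1, k0 <= k1 &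
  [/\ forall p, p <= p0 -> (1%:M <= F p)%MS, forall p, p1 <= p -> F p = 0,
      forall k, k <= k0 -> cW k = 0 & forall k, k1 <= k -> (1%:M <= cW k)%MS]].
Proof.
have [p0 F0] := F_low Ff; have [p1 F1] := F_high Ff.
have [k0 W0] := W_low (R := R) Wf; have [k1 W1] := W_high (R := R) Wf.
exists p0, (Num.max p0 p1), k0, (Num.max k0 k1); rewrite !le_max !lexx/=; split => //.
by split => // l; rewrite ge_max => /andP[_]; [exact: F1|exact: W1].
Qed.

Section Box.
Variables p0 p1 k0 k1 : int.
Hypotheses (p01 : p0 <= p1) (k01 : k0 <= k1).
Hypotheses (F0 : forall p, p <= p0 -> (1%:M <= F p)%MS).
Hypotheses (F1 : forall p, p1 <= p -> F p = 0).
Hypotheses (W0 : forall k, k <= k0 -> cW k = 0).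
Hypotheses (W1 : forall k, k1 <= k -> (1%:M <= cW k)%MS).

Let box : seq (int * int) :=
  [seq (p, k - p) | p <- int_range p0 p1, k <- int_range (k0 + 1) (k1 + 1)].

Let mem_box p q : ((p, q) \in box) = (p0 <= p < p1) && (k0 < p + q <= k1).
Proof.
apply/allpairsP/idP => [[[p' k']] /= []|/andP[pP kP]].
  by rewrite !mem_int_range ?lerD2r// => pP kP [-> ->]; lia.
by exists (p, p + q); rewrite /= !mem_int_range ?lerD2r//; split; [|lia|congr (_, _); lia].
Qed.

Let box_uniq : uniq box.
Proof.
apply: allpairs_uniq; try exact: int_range_uniq.
by move=> [p k] [p' k'] _ _ /= [-> /addIr->].
Qed.

Let I_box p q : (p, q) \notin box -> I p q = 0.
Proof.
rewrite mem_box => out; apply/eqP; apply/rowV0P => v vI.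
have vF := submx_trans vI (deligneI_F _ _ _ _).
have vW := submx_trans vI (deligneI_cW F Wf _ _).
have [/F1 Fp|pp1] := leP p1 p; first by apply/eqP; rewrite -submx0 -Fp.
have [/W0 Wk|kk0] := leP (p + q) k0; first by apply/eqP; rewrite -submx0 -Wk.
have [pp0|p0p] := ltP p p0.
  apply: (@F_oppF_cap _ _ _ _ Wf Ff pure (p + 1) (p + q)).
    by apply: submx_trans (submx1 _) (F0 _); lia.
  by rewrite addrK; exact: submx_trans vI (deligneI_oppF Wf Ff _ _).
have kk1 : k1 <= p + q - 1 by lia.
apply: (deligneI_W0 Wf Ff pure vI).
exact: submx_trans (submx1 _) (W1 kk1).
Qed.

Let I_finite : finite_set [set pq : int * int | I pq.1 pq.2 != 0].
Proof.
apply: (@sub_finite_set _ _ [set` box]); last exact: finite_seq.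
by move=> [p q] /=; apply: contraR => /I_box->.
Qed.

Let IS (D : set (int * int)) : 'M[C]_m :=
  \big[addsmx/0]_(x \in D) I x.1 x.2.

Let IS_ub (D : set (int * int)) p q : D (p, q) -> (I p q <= IS D)%MS.
Proof. exact: (@fs_ub _ _ _ (fun x => I x.1 x.2) D (p, q) I_finite). Qed.

Let IS_lub (D : set (int * int)) r (X : 'M[C]_(r, m)) :
  (forall p q, D (p, q) -> (I p q <= X)%MS) -> (IS D <= X)%MS.
Proof. by move=> DX; apply: fs_lub => -[p q]; exact: DX. Qed.

Let IS_le (D D' : set (int * int)) : D `<=` D' -> (IS D <= IS D')%MS.
Proof. by move=> DD; apply: IS_lub => p q /DD; exact: IS_ub. Qed.

Let FW_IS p k : (FW p k <= IS [set x | ((p <= x.1) && (x.1 + x.2 <= k))%R])%MS.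
Proof.
elim/(@int_up_ind k0): k p => [k /W0 Wk p|k IHk p].
  by rewrite /FW Wk capmx0 sub0mx.
elim/(@int_down_ind p1): p => [p /F1 Fp|p IHp].
  by rewrite /FW Fp cap0mx sub0mx.
rewrite (FW_rec Wf Ff pure p k) !addsmx_sub; apply/and3P; split.
- by apply: IS_ub => /=; lia.
- by apply: submx_trans IHp (IS_le _) => -[r s] /=; lia.
- by apply: submx_trans (IHk p) (IS_le _) => -[r s] /=; lia.
Qed.

Let FW_F p k : k1 <= k -> (F p <= FW p k)%MS.
Proof.
by move=> /W1 Wk; rewrite sub_capmx submx_refl (submx_trans (submx1 _) Wk).
Qed.

Let IS_F p : (F p :=: IS [set x | (p <= x.1)%R])%MS.
Proof.
apply/eqmxP/andP; split.
  apply: submx_trans (FW_F _ (lexx k1)) (submx_trans (FW_IS _ _) (IS_le _)).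
  by move=> [r s] /= /andP[].
apply: IS_lub => r s /= pr.
exact: submx_trans (deligneI_F _ _ _ _) (F_le Ff pr).
Qed.

Let IS_W k : (cW k :=: IS [set x | (x.1 + x.2 <= k)%R])%MS.
Proof.
apply/eqmxP/andP; split.
  apply: submx_trans (_ : (cW k <= FW p0 k)%MS) _.
    by rewrite sub_capmx submx_refl (submx_trans (submx1 _) (F0 _)).
  by apply: submx_trans (FW_IS _ _) (IS_le _) => -[r s] /= /andP[].
apply: IS_lub => r s /= rs.
exact: submx_trans (deligneI_cW F Wf _ _) (cW_le Wf rs).
Qed.

(** With [FW_rec], the rank of [I p (k - p)] is a mixed second difference of the
    ranks of the [FW]. *)
Let FW_rank p k : (\rank (FW p k) + \rank (FW (p + 1) (k - 1)) =
  \rank (I p (k - p)) + \rank (FW (p + 1) k) + \rank (FW p (k - 1)))%N.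
Proof.
have cap1 := mxrank_sum_cap (I p (k - p)) (FW (p + 1) k + FW p (k - 1))%MS.
have cap2 := mxrank_sum_cap (FW (p + 1) k) (FW p (k - 1)).
rewrite (FW_rec_cap Wf Ff pure p k) mxrank0 addn0 in cap1.
have <- : \rank (FW (p + 1) k :&: FW p (k - 1))%MS = \rank (FW (p + 1) (k - 1)).
  apply: eqmx_rank; apply/andP; split.
    rewrite sub_capmx; apply/andP; split.
      by apply: submx_trans (capmxSl _ _) (capmxSl _ _).
    by apply: submx_trans (capmxSr _ _) (capmxSr _ _).
  by rewrite sub_capmx; apply/andP; split; apply: (FW_le Wf Ff); lia.
by rewrite (FW_rec Wf Ff pure p k) cap1 -addnA cap2 addnA.
Qed.

(** A double telescoping sum. *)
Let I_rank : (\sum_(x <- box) \rank (I x.1 x.2) = m)%N.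
Proof.
pose r p k : int := (\rank (FW p k))%:Z.
pose h p k : int := r p k - r (p + 1) k.
have rI p k : (\rank (I p (k - p)))%:Z = h p k - h p (k - 1).
  by have := FW_rank p k; rewrite /h /r; lia.
have rW0 p : r p k0 = 0 by rewrite /r /FW (W0 (lexx _)) capmx0 mxrank0.
have rF1 k : r p1 k = 0 by rewrite /r /FW (F1 (lexx _)) cap0mx mxrank0.
have rfull : r p0 k1 = m%:Z.
  rewrite /r; congr Posz; apply/eqP; rewrite -[_ == _]/(row_full _) -sub1mx.
  by rewrite sub_capmx F0// W1.
suff : (\sum_(x <- box) \rank (I x.1 x.2))%N%:Z = m%:Z by case.
rewrite (big_morph Posz PoszD (erefl _)) big_allpairs_dep/=.
transitivity (\sum_(p <- int_range p0 p1) (- r (p + 1) k1 - - r p k1)).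
  apply: eq_bigr => p _.
  transitivity (\sum_(k <- int_range (k0 + 1) (k1 + 1))
      (h p (k + 1 - 1) - h p (k - 1))).
    by apply: eq_bigr => k _; rewrite addrK.
  rewrite (sum_int_range (fun k => h p (k - 1))) ?lerD2r// !addrK /h.
  by have := rW0 p; have := rW0 (p + 1); lia.
by rewrite (sum_int_range (fun p => - r p k1) p01) rF1 rfull oppr0 add0r opprK.
Qed.

Let IS_full : (1%:M <= IS setT)%MS.
Proof.
apply: submx_trans (W1 (lexx k1)) _; rewrite (IS_W k1).
by apply: IS_le.
Qed.

Let IS_box (P : pred (int * int)) :
  (IS [set x | P x] :=: \big[addsmx/0]_(x <- box | P x) I x.1 x.2)%MS.
Proof.
apply/eqmxP/andP; split.
  apply: IS_lub => p q /= Ppq; have [pqb|/I_box->] := boolP ((p, q) \in box).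
    exact: (seq_ub (fun x : int * int => I x.1 x.2) pqb Ppq).
  exact: sub0mx.
by apply: seq_lub => -[p q] _ Ppq; exact: IS_ub.
Qed.

Let IS_cap (P Q : pred (int * int)) v :
  (v <= IS [set x | P x])%MS -> (v <= IS [set x | Q x])%MS ->
  (v <= IS [set x | P x && Q x])%MS.
Proof.
rewrite (IS_box P) (IS_box Q) (IS_box (fun x => P x && Q x)) => vP vQ.
have dir : (\sum_(x <- box) \rank (I x.1 x.2) <=
    \rank (\big[addsmx/0%R]_(x <- box) I x.1 x.2))%N.
  rewrite I_rank -[leqLHS](@mxrank1 C); apply: mxrankS.
  apply: submx_trans IS_full _.
  have -> : setT = [set x : int * int | xpredT x] by apply/seteqP.
  by rewrite (IS_box xpredT).
by apply: submx_trans (direct_cap dir P Q); rewrite sub_capmx vP.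
Qed.

(** Split a vector of [oppF] along the sums of the [I r s] with [r >= q] and with
    [r < q]; both the vector and its second part are in the opposite filtration,
    so the first part is zero. *)
Let oppF_IS q k : (oppF (q - 1) k <= IS [set x | (x.1 < q)%R])%MS.
Proof.
apply/rV_subP => v vG.
have : (v <= F q + IS [set x | (x.1 < q)%R])%MS.
  apply: submx_trans (submx1 _) (submx_trans IS_full _).
  apply: IS_lub => r s _; have [qr|rq] := leP q r.
    by apply: sub_addl; exact: submx_trans (deligneI_F _ _ _ _) (F_le Ff qr).
  by apply: sub_addr; exact: IS_ub.
case/adds_elim => f [u [fF uI E]].
suff f0 : f = 0 by rewrite E f0 add0r.
apply: (@F_oppF_cap _ _ _ _ Wf Ff pure q (Num.max k k1)) => //.
have -> : f = v - u by rewrite E addrK.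
apply: sub_sub.
  by apply: submx_trans vG (oppF_le Wf Ff _ _); rewrite ?le_max ?lexx.
apply: submx_trans uI _; apply: IS_lub => r s /= rq.
have [rs|rs] := leP (r + s) (Num.max k k1).
  by apply: submx_trans (deligneI_oppF Wf Ff r s) (oppF_le Wf Ff _ rs); lia.
have [|/I_box->] := boolP ((r, s) \in box); last exact: sub0mx.
by rewrite mem_box => /andP[_ /andP[_ rsk]]; move: rs; rewrite gt_max; lia.
Qed.

Let conj_oppF_IS p k : (conj_mx (oppF (p - 1) k) <= IS [set x | (x.2 < p)%R])%MS.
Proof.
rewrite conj_mx_subl; apply: oppF_lub => l lk.
rewrite -conj_mx_subl conj_cFW; apply: submx_trans (FW_IS _ _) (IS_le _).
by move=> [r s] /=; lia.
Qed.

(** The difference [y] of a vector of the conjugate of [I p q] and its component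
    in [I q p] lies in the sum of the [I r s] with [r < q], because this sum is
    the opposite filtration, and by conjugation in the sum of those with
    [s < p]. *)
Let I_conj p q :
  (conj_mx (I p q) <= I q p + IS [set x | ((x.1 < q) && (x.2 < p))%R])%MS.
Proof.
rewrite conj_mx_subl; apply/rV_subP => u uI; rewrite -conj_mx_subl.
set v := conj_mx u; pose k := p + q.
have uG := submx_trans uI (deligneI_cFW W F p q).
have vF : (v <= cFW p k)%MS.
  rewrite -conj_FW conj_mx_sub sub_capmx (submx_trans uI (deligneI_F _ _ _ _)).
  exact: submx_trans uI (deligneI_cW F Wf _ _).
have vG : (v <= FW q k + conj_mx (oppF (p - 1) (k - 2)))%MS.
  rewrite /v conj_mx_subl; apply: submx_trans uG _.
  rewrite -conj_mx_subl conj_mx_adds; apply: addsmxS => //.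
  by rewrite conj_cFW (_ : p + q - p = q) // addrC addKr.
have oW b : (oppF b (k - 2) <= cW (k - 1))%MS.
  by apply: submx_trans (oppF_cW _ Wf _ _) (cW_le Wf _); lia.
have kE : q + p = k by rewrite addrC.
have [||x [y [xI yW E]]] := @deligneI_lift _ _ _ _ Wf Ff pure q p v.
- rewrite kE; apply: submx_trans vG (addsmxS (submx_refl _) _).
  by rewrite conj_mx_subl conj_cW.
- by rewrite kE; apply: sub_addl.
rewrite kE in yW; have yE : y = v - x by rewrite E [x + _]addrC addrK.
rewrite E; apply: addmx_sub; first exact: sub_addl.
apply: sub_addr; apply: IS_cap.
  apply: submx_trans (oppF_IS q (k - 1)); apply: (oppF_weight Wf Ff) => //.
  have kq : k - q = p by rewrite /k addrK.
  rewrite kq yE; apply: sub_sub; first exact: sub_addl.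
  have := submx_trans xI (deligneI_cFW W F q p).
  by rewrite kE kq.
apply: submx_trans (conj_oppF_IS p (k - 1)); rewrite -conj_mx_subl.
have kp : k - p = q by rewrite /k addrC addKr.
apply: (oppF_weight Wf Ff); last by rewrite conj_mx_subl conj_cW.
rewrite kp yE conj_mxB; apply: sub_sub.
  by rewrite /v conj_mxK; move: uG; rewrite -/k kp.
apply: sub_addl; rewrite conj_mx_subl conj_cFW sub_capmx.
rewrite (submx_trans xI (deligneI_F _ _ _ _)).
by have := submx_trans xI (deligneI_cW F Wf _ _); rewrite kE.
Qed.

Lemma deligneI_bigrading_box : deligne_bigrading W F I.
Proof.
split.
- exact: I_finite.
- apply/eqmxP; rewrite submx1/=; exact: IS_full.
- rewrite (@fsum_seq _ _ _ _ box)//; last first.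
    by move=> -[p q] /I_box /= ->; exact: mxrank0.
- exact: IS_F.
- exact: IS_W.
- move=> p q /=; apply/eqmxP/andP; split; rewrite addsmx_sub addsmxSr andbT.
    exact: I_conj.
  rewrite -[X in (X <= _)%MS]conj_mxK conj_mx_subl.
  apply: submx_trans (I_conj q p) _; rewrite -conj_mx_subl conj_mx_adds.
  apply: addsmxS => //; rewrite conj_mx_subl; apply: IS_lub => r s /= rs.
  rewrite -conj_mx_subl; apply: submx_trans (I_conj r s) _.
  rewrite addsmx_sub IS_ub/=; last by rewrite andbC.
  by apply: IS_le => -[a b] /=; lia.
Qed.

End Box.

(** The sum of the [deligneI] is full by [FW_rec], and direct because their ranks
    add up to the dimension. *)
Theorem deligneI_bigrading : deligne_bigrading W F I.
Proof.
have [p0 [p1 [k0 [k1 [p01 k01 [F0 F1 W0 W1]]]]]] := hodge_box.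
exact: (@deligneI_bigrading_box p0 p1 k0 k1).
Qed.

End DeligneExistence.

(** * The projections to the graded pieces *)

Section DeligneProjections.
Context {R : realType} {m : nat}.
Local Notation C := R[i].
Variables (W : int -> 'M[rat]_m) (F : int -> 'M[C]_m).
Hypotheses (Wf : increasing_filtration W) (Ff : decreasing_filtration F).
Hypothesis pure : forall k, pure_on_gr W F k.

Implicit Types (p q r k l : int).

Local Notation cW := (@cW R m W).
Local Notation cFW := (@cFW R m W F).
Local Notation oppF := (@oppF R m W F).
Local Notation I := (deligne W F).
Local Notation U := (deligne_U W F).
Local Notation P := (deligne_proj W F).

Lemma deligne_bigradingP : deligne_bigrading W F I.
Proof.
apply: (@xgetPex _ _ [set J | deligne_bigrading W F J]).
by exists (deligneI W F); exact: deligneI_bigrading.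
Qed.

Let bg := deligne_bigradingP.

Lemma deligne_ub (D : set (int * int)) p q : D (p, q) ->
  (I p q <= \big[addsmx/0]_(x \in D) I x.1 x.2)%MS.
Proof. exact: (@fs_ub _ _ _ (fun x => I x.1 x.2) D (p, q) (db_finite bg)). Qed.

Lemma deligne_I_F p q : (I p q <= F p)%MS.
Proof. by rewrite (db_F bg); apply: deligne_ub => /=. Qed.

Lemma deligne_I_W p q : (I p q <= cW (p + q))%MS.
Proof. by rewrite /cW (db_W bg); apply: deligne_ub => /=. Qed.

Lemma deligne_U_ub p q : (I p q <= U p)%MS.
Proof.
apply: (@fs_ub _ _ _ (fun q => I p q) setT q) => //.
have := db_finite bg.
move=> /(finite_image (fun x : int * int => x.2)); apply: sub_finite_set.
by move=> r /= Ir; exists (p, r).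
Qed.

Lemma deligne_U_finite : finite_set [set p | U p != 0].
Proof.
have := db_finite bg.
move=> /(finite_image (fun x : int * int => x.1)); apply: sub_finite_set.
move=> p /= /negP Up; apply: contrapT => nI; apply: Up; rewrite -submx0.
apply: fs_lub => q _; rewrite submx0; apply/eqP; apply: contrapT => Ipq.
by apply: nI; exists (p, q) => //=; apply/eqP.
Qed.

Local Notation Uc p := (\big[addsmx/0]_(r \in [set r | r != p]) U r)%MS.

Lemma deligne_Uc_ub p r : r != p -> (U r <= Uc p)%MS.
Proof. exact: (@fs_ub _ _ _ U [set r | r != p] r deligne_U_finite). Qed.

Lemma deligne_U_F p : (U p <= F p)%MS.
Proof. by apply: fs_lub => q _; exact: deligne_I_F. Qed.

Section Top.
Variable k1 : int.
Hypothesis W1 : forall k, k1 <= k -> (1%:M <= cW k)%MS.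

(** By the third property of the bigrading, [I p q] is contained in the
    conjugate of [I q p] plus summands of lower weight. *)
Lemma deligne_I_oppF p q : (I p q <= oppF p k1)%MS.
Proof.
have [k0 W0] := W_low (R := R) Wf.
suff : forall k r s : int, r + s <= k -> (I r s <= oppF r k1)%MS by apply; exact: lexx.
elim/(@int_up_ind k0) => [k kk0 r s rsk|k IH r s rsk].
  have := deligne_I_W r s; rewrite W0 ?(le_trans rsk)// submx0 => /eqP->.
  exact: sub0mx.
have IL : (I r s <= conj_mx (I s r) + \big[addsmx/0]_(rs \in [set rs : int * int |
    (rs.1 < r)%R && (rs.2 < s)%R]) I rs.1 rs.2)%MS.
  by have /= -> := db_conj bg s r; exact: addsmxSl.
apply: submx_trans IL _; rewrite addsmx_sub; apply/andP; split.
  apply: submx_trans (oppF_gen Wf Ff r (r + s) W1).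
  have -> : r + s - r = s by lia.
  rewrite sub_capmx conj_mx_sub deligne_I_F conj_mx_subl conj_cW (addrC r).
  exact: deligne_I_W.
apply: fs_lub => -[a b] /= /andP[ar bs].
apply: submx_trans (IH a b _) (oppF_le Wf Ff _ (lexx _)); lia.
Qed.

Lemma deligne_U_oppF p : (U p <= oppF p k1)%MS.
Proof. by apply: fs_lub => q _; exact: deligne_I_oppF. Qed.

Lemma deligne_F_oppF_cap p (v : 'rV[C]_m) :
  (v <= F (p + 1))%MS -> (v <= oppF p k1)%MS -> v = 0.
Proof.
by move=> vF vG; apply: (F_oppF_cap Wf Ff pure vF); rewrite addrK; exact: vG.
Qed.

Lemma deligne_U_full (J : 'M[C]_m) : (forall p, (U p <= J)%MS) -> (1%:M <= J)%MS.
Proof.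
move=> UJ; rewrite -(db_full bg); apply: fs_lub => -[p q] _.
exact: submx_trans (deligne_U_ub p q) (UJ p).
Qed.

Lemma deligne_F_Uc p r : r < p -> (F p <= Uc r)%MS.
Proof.
move=> rp; rewrite (db_F bg); apply: fs_lub => -[a b] /= pa.
by apply: submx_trans (deligne_U_ub a b) (deligne_Uc_ub _); lia.
Qed.

(** The part of such a vector in [F (p + 1)] is zero, so the vector is in the sum
    of the [U r] with [r <= p]. *)
Lemma deligne_oppF_Uc p r : p < r -> (oppF p k1 <= Uc r)%MS.
Proof.
move=> pr; apply/rV_subP => v vG.
pose J := \big[addsmx/0]_(a \in [set a | a <= p]) U a.
have J_ub a : a <= p -> (U a <= J)%MS.
  exact: (@fs_ub _ _ _ U [set a | a <= p] a deligne_U_finite).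
have : (v <= F (p + 1) + J)%MS.
  apply: submx_trans (submx1 _) (deligne_U_full _) => a.
  have [ap|pa] := leP a p; first by apply: sub_addr; exact: J_ub.
  apply: sub_addl; apply: submx_trans (deligne_U_F a) (F_le Ff _); lia.
case/adds_elim => f [u [fF uJ E]].
have uG : (u <= oppF p k1)%MS.
  apply: submx_trans uJ _; apply: fs_lub => a /= ap.
  by apply: submx_trans (deligne_U_oppF a) (oppF_le Wf Ff ap (lexx _)).
have f0 : f = 0.
  by apply: (deligne_F_oppF_cap fF); rewrite -(addrK u f) -E; exact: sub_sub.
rewrite E f0 add0r; apply: submx_trans uJ _; apply: fs_lub => a /= ap.
by apply: deligne_Uc_ub; lia.
Qed.

(** The complementary sum is contained in [F (p + 1) + oppF (p - 1) k1]; both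
    parts of a vector of [U p] vanish, as [U p] is in [F p] and in [oppF p k1]. *)
Lemma deligne_U_cap p : (U p :&: Uc p)%MS = 0.
Proof.
apply: cap0_elim => v vU.
have vF := submx_trans vU (deligne_U_F p).
have vG := submx_trans vU (deligne_U_oppF p).
have UcS : (Uc p <= F (p + 1) + oppF (p - 1) k1)%MS.
  apply: fs_lub => r /= rp; have [rlp|plr] := leP r p.
    apply: sub_addr; apply: submx_trans (deligne_U_oppF r) (oppF_le Wf Ff _ (lexx _)); lia.
  apply: sub_addl; apply: submx_trans (deligne_U_F r) (F_le Ff _); lia.
move=> /submx_trans/(_ UcS)/adds_elim[a [b [aF bG E]]].
have b0 : b = 0.
  apply: (@deligne_F_oppF_cap (p - 1)) => //; rewrite subrK.
  have -> : b = v - a by rewrite E [a + _]addrC addrK.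
  apply: sub_sub => //; apply: submx_trans aF (F_le Ff _); lia.
by apply: (deligne_F_oppF_cap _ vG); rewrite E b0 addr0.
Qed.

Lemma deligne_proj_F p n (M : 'M[C]_(n, m)) : (M *m P p <= F p)%MS.
Proof. exact: submx_trans (proj_mx_sub _ _ _) (deligne_U_F p). Qed.

Lemma deligne_proj_oppF p n (M : 'M[C]_(n, m)) : (M *m P p <= oppF p k1)%MS.
Proof. exact: submx_trans (proj_mx_sub _ _ _) (deligne_U_oppF p). Qed.

Lemma deligne_proj_F0 p r n (M : 'M[C]_(n, m)) : (M <= F p)%MS -> r < p ->
  M *m P r = 0.
Proof.
move=> MF rp; apply: proj_mx_0; first exact: deligne_U_cap.
exact: submx_trans MF (deligne_F_Uc rp).
Qed.

Lemma deligne_proj_oppF0 p r n (M : 'M[C]_(n, m)) : (M <= oppF p k1)%MS ->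
  p < r -> M *m P r = 0.
Proof.
move=> MF rp; apply: proj_mx_0; first exact: deligne_U_cap.
exact: submx_trans MF (deligne_oppF_Uc rp).
Qed.

Section Range.
Variables p0 p1 : int.
Hypotheses (p01 : p0 <= p1).
Hypotheses (F0 : (1%:M <= F p0)%MS).
Hypotheses (F1 : F p1 = 0).

Lemma deligne_U_range p : p \notin int_range p0 p1 -> U p = 0.
Proof.
rewrite mem_int_range// negb_and -ltNge -leNgt => /orP[pp0|p1p]; last first.
  apply/eqP; rewrite -submx0 -F1; apply: submx_trans (deligne_U_F p) (F_le Ff p1p).
apply/eqP/rowV0P => v vU.
apply: (@deligne_F_oppF_cap p); last exact: submx_trans vU (deligne_U_oppF p).
apply: submx_trans (submx1 _) (submx_trans F0 (F_le Ff _)); lia.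
Qed.

Lemma deligne_proj_range p : p \notin int_range p0 p1 -> P p = 0.
Proof.
move=> /deligne_U_range U0; apply/eqP; rewrite -submx0 -U0 -[P p]mul1mx.
exact: proj_mx_sub.
Qed.

Lemma deligne_proj_sum : \sum_(p <- int_range p0 p1) P p = 1%:M.
Proof.
apply/eqP; rewrite -subr_eq0 -(mul1mx (_ - _)) -sub_kermx.
apply: deligne_U_full => p; rewrite sub_kermx mulmxBr mulmx1 subr_eq0.
rewrite mulmx_sumr; apply/eqP.
have PU r : r != p -> U p *m P r = 0.
  by move=> rp; apply: proj_mx_0; [exact: deligne_U_cap|apply: deligne_Uc_ub; rewrite eq_sym].
have PP : U p *m P p = U p by apply: proj_mx_id; [exact: deligne_U_cap|exact: submx_refl].
have [pr|/deligne_U_range Up0] := boolP (p \in int_range p0 p1).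
  by rewrite (bigD1_seq p) ?int_range_uniq//= PP big1 ?addr0.
by rewrite Up0 big1 // => r _; rewrite mul0mx.
Qed.

End Range.

End Top.

End DeligneProjections.

(** * Functions of class C^k *)

Section RealCalculus.
Context {R : realType}.
Implicit Types d : nat.

Local Notation e_ j := (delta_mx 0 j).

Lemma classC_cont k d (A : set 'rV[R]_d) f x :
  classC k A f -> A x -> {for x, continuous f}.
Proof. by case: k => [|k] [fc _]; exact: fc. Qed.

Lemma classC_derivable k d (A : set 'rV[R]_d) f x j :
  classC k.+1 A f -> A x -> derivable f x (e_ j).
Proof. by move=> [_ /(_ j)[fd _]]; exact: fd. Qed.

Lemma classC_derive k d (A : set 'rV[R]_d) f j :
  classC k.+1 A f -> classC k A (fun x => 'D_(e_ j) f x).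
Proof. by move=> [_ /(_ j)[]]. Qed.

Arguments classC_derivable {k d A f x} j.
Arguments classC_derive {k d A f} j.

Lemma classC_pred k d (A : set 'rV[R]_d) f : classC k.+1 A f -> classC k A f.
Proof.
elim: k f => [|k IH] f; first by case.
move=> [fc fD]; split => // j; split; first by case: (fD j).
by apply: IH; case: (fD j).
Qed.

Lemma classC_sub k d (A B : set 'rV[R]_d) f :
  B `<=` A -> classC k A f -> classC k B f.
Proof.
move=> BA; elim: k f => [|k IH] f [fc fD]; split => //.
- by move=> x /BA; exact: fc.
- by move=> x /BA; exact: fc.
- move=> j; have [fd fDk] := fD j; split; last exact: IH.
  by move=> x /BA; exact: fd.
Qed.

Lemma classC_ext k d (A : set 'rV[R]_d) f g : open A ->
  (forall x, A x -> f x = g x) -> classC k A f -> classC k A g.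
Proof.
move=> oA; elim: k f g => [|k IH] f g fg fk.
  split => // x Ax.
  have fgx : \forall y \near x, f y = g y.
    by apply: filterS (open_nbhs_nbhs (conj oA Ax)) => y; exact: fg.
  rewrite /prop_for /continuous_at -(fg _ Ax).
  have /(_ x Ax) fx := fk.1.
  by apply: cvg_trans fx; exact: near_eq_cvg fgx.
have nfg x : A x -> \forall y \near x, f y = g y.
  by move=> Ax; apply: filterS (open_nbhs_nbhs (conj oA Ax)) => y; exact: fg.
split => [x Ax|j].
  rewrite /prop_for /continuous_at -(fg _ Ax).
  apply: cvg_trans (classC_cont fk Ax); exact: near_eq_cvg (nfg _ Ax).
split => [x Ax|].
  exact: near_eq_derivable (nfg _ Ax) (classC_derivable j fk Ax).
apply: IH (classC_derive j fk) => x Ax; exact/near_eq_derive/nfg.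
Qed.

Lemma classC_local k d (A : set 'rV[R]_d) f :
  (forall x, A x -> exists B, B x /\ classC k B f) -> classC k A f.
Proof.
elim: k f => [|k IH] f fl; split => //.
- by move=> x /fl[B [Bx]] [fc _]; exact: fc.
- by move=> x /fl[B [Bx]] [fc _]; exact: fc.
- move=> j; split=> [x /fl[B [Bx]] fB|]; first exact: classC_derivable fB Bx.
  by apply: IH => x /fl[B [Bx]] fB; exists B; split => //; exact: classC_derive j fB.
Qed.

Lemma classC_cst k d (A : set 'rV[R]_d) (c : R) : classC k A (fun=> c).
Proof.
elim: k c => [|k IH] c; split => //; try by move=> x _; exact: cst_continuous.
move=> j; split => [x _|]; first exact: derivable_cst.
suff -> : (fun x : 'rV[R]_d => 'D_(e_ j) (fun=> c) x) = (fun=> 0) by exact: IH.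
by apply/funext => x; exact: derive_cst.
Qed.

Lemma classCD k d (A : set 'rV[R]_d) f g : open A ->
  classC k A f -> classC k A g -> classC k A (fun x => f x + g x).
Proof.
move=> oA; elim: k f g => [|k IH] f g fk gk; split => //.
- move=> x Ax; exact: continuousD (classC_cont fk Ax) (classC_cont gk Ax).
- move=> x Ax; exact: continuousD (classC_cont fk Ax) (classC_cont gk Ax).
move=> j; split=> [x Ax|].
  exact: derivableD (classC_derivable j fk Ax) (classC_derivable j gk Ax).
apply: classC_ext (IH _ _ (classC_derive j fk) (classC_derive j gk)) => //.
move=> x Ax /=.
by rewrite -(deriveD (classC_derivable j fk Ax) (classC_derivable j gk Ax)).
Qed.

Lemma classCM k d (A : set 'rV[R]_d) f g : open A ->
  classC k A f -> classC k A g -> classC k A (fun x => f x * g x).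
Proof.
move=> oA; elim: k f g => [|k IH] f g fk gk; split => //.
- move=> x Ax; exact: continuousM (classC_cont fk Ax) (classC_cont gk Ax).
- move=> x Ax; exact: continuousM (classC_cont fk Ax) (classC_cont gk Ax).
move=> j; split=> [x Ax|].
  exact: derivableM (classC_derivable j fk Ax) (classC_derivable j gk Ax).
have fgD : classC k A (fun x => f x * 'D_(e_ j) g x + g x * 'D_(e_ j) f x).
  apply: classCD => //; apply: IH.
  - exact: classC_pred.
  - exact: classC_derive j gk.
  - exact: classC_pred.
  - exact: classC_derive j fk.
apply: classC_ext fgD => // x Ax /=.
exact: esym (deriveM (classC_derivable j fk Ax) (classC_derivable j gk Ax)).
Qed.

Lemma classCN k d (A : set 'rV[R]_d) f : open A ->
  classC k A f -> classC k A (fun x => - f x).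
Proof.
move=> oA fk; apply: classC_ext (classCM oA (classC_cst k A (-1)) fk) => //.
by move=> x _; rewrite mulN1r.
Qed.

Lemma classC_sum k d (A : set 'rV[R]_d) (I : Type) (r : seq I)
    (f : I -> 'rV[R]_d -> R) : open A ->
  (forall i, classC k A (f i)) -> classC k A (fun x => \sum_(i <- r) f i x).
Proof.
move=> oA fk; elim: r => [|i r IH].
  apply: classC_ext (classC_cst k A 0) => // x _; by rewrite big_nil.
by apply: classC_ext (classCD oA (fk i) IH) => // x _; rewrite big_cons.
Qed.

Lemma classCV k d (A : set 'rV[R]_d) f : open A ->
  (forall x, A x -> f x != 0) ->
  classC k A f -> classC k A (fun x => (f x)^-1).
Proof.
move=> oA f0; elim: k => [|k IH] fk; split => //.
- by move=> x Ax; exact: continuousV (f0 _ Ax) (classC_cont fk Ax).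
- by move=> x Ax; exact: continuousV (f0 _ Ax) (classC_cont fk Ax).
move=> j; split=> [x Ax|].
  exact: derivableV (f0 _ Ax) (classC_derivable j fk Ax).
have fVk := IH (classC_pred fk).
have fD : classC k A (fun x => - ((f x)^-1 * (f x)^-1 * 'D_(e_ j) f x)).
  apply: classCN => //; apply: classCM => //; first exact: classCM.
  exact: classC_derive j fk.
apply: classC_ext fD => // x Ax /=.
rewrite (deriveV (f0 _ Ax) (classC_derivable j fk Ax)).
by rewrite expr2 invfM /GRing.scale/= mulNr.
Qed.

(** The increment [a] can have either sign; the interval of the usual form is
    [0, a] or [a, 0]. *)
Lemma MVT_line d (f : 'rV[R]_d -> R) (y v : 'rV[R]_d) (a : R) :
  (forall t : R, `|t| <= `|a| -> derivable f (y + t *: v) v) ->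
  exists2 c, `|c| <= `|a| & f (y + a *: v) - f y = a * 'D_v f (y + c *: v).
Proof.
move=> fd; pose g (t : R) : R := f (y + t *: v).
have gd (t : R) : `|t| <= `|a| -> is_derive t (1 : R) g ('D_v f (y + t *: v)).
  move=> ta; have /fd := ta; rewrite /derivable => fdt.
  have E : (fun h : R => h^-1 *: (g (h *: (1 : R) + t) - g t)) =
           (fun h : R => h^-1 *: (f (h *: v + (y + t *: v)) - f (y + t *: v))).
    apply/funext => h; congr (_ *: (f _ - _)).
    by rewrite [h *: _]mulr1 scalerDl addrCA.
  by split; rewrite /derivable /derive E.
have gc x : `|x| <= `|a| -> {for x, continuous g}.
  by move=> /gd [/derivable1_diffP/differentiable_continuous gx _].
have main b c : b <= c -> `|b| <= `|a| -> `|c| <= `|a| ->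
    exists2 e, `|e| <= `|a| & g c - g b = 'D_v f (y + e *: v) * (c - b).
  move=> bc ba ca.
  have le e : e \in `[b, c]%R -> `|e| <= `|a|.
    rewrite in_itv/= => /andP[be ec].
    rewrite ler_norml; apply/andP; split.
      by apply: le_trans be; move: ba; rewrite ler_norml => /andP[].
    by apply: le_trans ec _; move: ca; rewrite ler_norml => /andP[].
  have [e ebc E] : exists2 e, e \in `[b, c]%R &
      g c - g b = 'D_v f (y + e *: v) * (c - b).
    apply: (@MVT_segment R g (fun t => 'D_v f (y + t *: v))) => //.
      by move=> x xbc; apply/gd/le; apply: subset_itv_oo_cc.
    apply: continuous_in_subspaceT => x /set_mem/= xbc.
    exact/gc/le.
  by exists e => //; exact: le.
have [a0|a0] := leP 0 a.
  have [||e ea E] := main 0 a a0 => //; first by rewrite normr0.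
  exists e => //; rewrite mulrC -[a in _ * a]subr0 -E /g scale0r addr0//.
have [||e ea E] := main a 0 (ltW a0) => //; first by rewrite normr0.
exists e => //; rewrite -opprB -[in X in - (X - _)](addr0 y) -(scale0r v).
by rewrite -/(g 0) -/(g a) E sub0r mulrN opprK mulrC.
Qed.

Lemma mxnorm_coord d (x : 'rV[R]_d) j : `|x 0 j| <= `|x|.
Proof.
rewrite [in leRHS]/Num.Def.normr/= mx_normrE.
exact: (le_bigmax _ (fun ij : 'I_1 * 'I_d => `|x ij.1 ij.2|) (0, j)).
Qed.

Lemma mxnorm_le d (x : 'rV[R]_d) (c : R) : 0 <= c ->
  (forall j, `|x 0 j| <= c) -> `|x| <= c.
Proof.
move=> c0 xc; rewrite [in leLHS]/Num.Def.normr/= mx_normrE.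
by apply: bigmax_le => // -[i j] _; rewrite ord1.
Qed.

(** The increment of [f] is split into steps parallel to the axes, and the mean
    value theorem is applied to each of them. *)
Lemma increment_partials d (f : 'rV[R]_d -> R) (a h : 'rV[R]_d) :
  (forall y j, `|y - a| <= `|h| -> derivable f y (e_ j)) ->
  exists c : 'I_d -> 'rV[R]_d, (forall j, `|c j - a| <= `|h|) /\
    f (a + h) - f a = \sum_j h 0 j * 'D_(e_ j) f (c j).
Proof.
move=> fd; pose p k : 'rV[R]_d := \row_j (if (j < k)%N then h 0 j else 0).
have pS (j : 'I_d) : p j.+1 = p j + h 0 j *: e_ j.
  apply/rowP => l; rewrite !mxE eqxx/= ltnS leq_eqVlt.
  have [->|lj] := eqVneq l j.
    by rewrite eqxx/= ltnn add0r mulr1.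
  by rewrite mulr0 addr0 (negbTE _ : (l == j :> nat) = false).
have pn (j : 'I_d) (t : R) : `|t| <= `|h 0 j| -> `|p j + t *: e_ j| <= `|h|.
  move=> th; apply: mxnorm_le => // l; rewrite !mxE eqxx/=.
  have [->|lj] := eqVneq l j.
    by rewrite ltnn add0r mulr1 (le_trans th)// mxnorm_coord.
  rewrite mulr0 addr0; case: ifP => _; first exact: mxnorm_coord.
  by rewrite normr0.
have step (j : 'I_d) : exists c, `|c - a| <= `|h| /\
    f (a + p j.+1) - f (a + p j) = h 0 j * 'D_(e_ j) f c.
  have [|t th E] := @MVT_line d f (a + p j) (e_ j) (h 0 j).
    move=> t th; apply: fd.
    by rewrite -(addrA a) [a + _]addrC addrK pn.
  exists (a + p j + t *: e_ j); split; last by rewrite -E pS addrA.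
  by rewrite -(addrA a) [a + _]addrC addrK pn.
have [c cP] := choice step.
exists c; split => [j|]; first by case: (cP j).
have -> : \sum_j h 0 j * 'D_(e_ j) f (c j) =
    \sum_(j < d) (f (a + p j.+1) - f (a + p j)).
  by apply: eq_bigr => j _; case: (cP j).
rewrite -(big_mkord xpredT (fun j => f (a + p j.+1) - f (a + p j))).
rewrite telescope_sumr//.
have -> : p d = h by apply/rowP => j; rewrite mxE ltn_ord.
by have -> : p 0%N = 0 by [apply/rowP => j; rewrite !mxE ltn0]; rewrite addr0.
Qed.

(** Differentiability in the form of Caratheodory: with continuous partial
    derivatives, the difference quotients [q] along the axes converge to
    them. *)
Lemma classC1_increment d (A : set 'rV[R]_d) f a : open A -> A a ->
  classC 1 A f ->
  exists q : 'I_d -> 'rV[R]_d -> R,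
    (forall j, q j y @[y --> a] --> 'D_(e_ j) f a) /\
    \forall y \near a, f y - f a = \sum_j (y - a) 0 j * q j y.
Proof.
move=> oA Aa f1.
have /nbhs_ballP[r /= r0 rA] : nbhs a A by exact: open_nbhs_nbhs.
have rA' y : `|y - a| < r -> A y.
  by move=> yr; apply: rA; rewrite -ball_normE/= distrC.
have ex y : exists c : 'I_d -> 'rV[R]_d, (forall j, `|c j - a| <= `|y - a|) /\
    (`|y - a| < r -> f y - f a = \sum_j (y - a) 0 j * 'D_(e_ j) f (c j)).
  have [yr|yr] := ltP `|y - a| r; last first.
    by exists (fun=> a); split => // j; rewrite subrr normr0.
  have [z j zy|c [ca E]] := @increment_partials d f a (y - a).
    by apply: (classC_derivable j f1 _); apply: rA'; exact: le_lt_trans zy yr.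
  by exists c; split => // _; rewrite -E [a + _]addrC subrK.
have [c cP] := choice ex.
exists (fun j y => 'D_(e_ j) f (c y j)); split => [j|].
  have cj : c y j @[y --> a] --> a.
    apply: (proj2 (@cvgrPdist_lt _ _ _ (nbhs a) (nbhs_filter a) _ _)) => e e0.
    apply: filterS (nbhsx_ballx a e e0) => y; rewrite -ball_normE/= => ay.
    by rewrite distrC (le_lt_trans (proj1 (cP y) j))// distrC.
  have Dc : {for a, continuous (fun x => 'D_(e_ j) f x)}.
    exact: classC_cont (classC_derive j f1) Aa.
  exact: (cvg_comp _ _ cj Dc).
apply: filterS (nbhsx_ballx a r r0) => y; rewrite -ball_normE/= distrC.
exact: (proj2 (cP y)).
Qed.

Lemma cvg_sum_filter (T I : Type) (F : set_system T) (FF : Filter F) (r : seq I)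
    (f : I -> T -> R) (l : I -> R) : (forall i, f i t @[t --> F] --> l i) ->
  \sum_(i <- r) f i t @[t --> F] --> \sum_(i <- r) l i.
Proof.
move=> fl; elim: r => [|i r IH].
  rewrite big_nil; under eq_fun do rewrite big_nil; exact: cvg_cst.
rewrite big_cons; under eq_fun do rewrite big_cons; exact: cvgD.
Qed.

(** Caratheodory's form of differentiability makes the difference quotient of the
    composite a sum of products of convergent factors. *)
Lemma derive_comp_partials d d' (A : set 'rV[R]_d) f
    (phi : 'rV[R]_d' -> 'rV[R]_d) x v : open A -> A (phi x) ->
  classC 1 A f -> {for x, continuous phi} ->
  (forall j, derivable (fun y => phi y 0 j) x v) ->
  is_derive x v (fun y => f (phi y))
    (\sum_j 'D_v (fun y => phi y 0 j) x * 'D_(e_ j) f (phi x)).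
Proof.
move=> oA Ax f1 phic phid.
have [q [qc qE]] := classC1_increment oA Ax f1.
have hx : h *: v + x @[h --> 0^'] --> x.
  apply: cvg_trans (_ : h *: v + x @[h --> (0 : R)] --> x).
    by apply: cvg_app; exact: cvg_within.
  rewrite -[X in _ --> X]add0r -(scale0r v).
  apply: cvgD; last exact: cvg_cst.
  by apply: cvgZr_tmp; exact: cvg_id.
have phx : phi (h *: v + x) @[h --> 0^'] --> phi x by exact: (cvg_comp _ _ hx phic).
suff L : h^-1 *: (f (phi (h *: v + x)) - f (phi x)) @[h --> 0^'] -->
    \sum_j 'D_v (fun y => phi y 0 j) x * 'D_(e_ j) f (phi x).
  by split; [exact: cvgP L|exact: cvg_lim L].
have qE' : \forall h \near 0^', f (phi (h *: v + x)) - f (phi x) =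
    \sum_j (phi (h *: v + x) - phi x) 0 j * q j (phi (h *: v + x)).
  exact: phx qE.
suff L : \sum_j (h^-1 *: (phi (h *: v + x) 0 j - phi x 0 j)) *
      q j (phi (h *: v + x)) @[h --> 0^'] -->
    \sum_j 'D_v (fun y => phi y 0 j) x * 'D_(e_ j) f (phi x).
  apply: cvg_trans L; apply: near_eq_cvg; apply: filterS qE' => h ->.
  rewrite [RHS]scaler_sumr; apply: eq_bigr => j _.
  by rewrite !mxE scalerAl.
apply: cvg_sum_filter => j; apply: cvgM; first exact: phid.
exact: (cvg_comp _ _ phx (qc j)).
Qed.

End RealCalculus.
Arguments classC_derivable {R k d A f x} j.
Arguments classC_derive {R k d A f} j.

(** * Second derivatives and composition *)

Section SecondDerivatives.
Context {R : realType}.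
Implicit Types d : nat.

Local Notation e_ j := (delta_mx 0 j).

Lemma derivable_translate d (f : 'rV[R]_d -> R) w y v :
  derivable f (y + w) v ->
  is_derive y v (fun z => f (z + w)) ('D_v f (y + w)).
Proof.
rewrite /derivable => fd.
have E : (fun h : R => h^-1 *: (f (h *: v + y + w) - f (y + w))) =
         (fun h : R => h^-1 *: (f (h *: v + (y + w)) - f (y + w))).
  by apply/funext => h; rewrite addrA.
by split; rewrite /derivable /derive E.
Qed.

(** The mean value theorem applied twice, first to the increments [f (y + s e_j) -
    f y] along [e_i]. *)
Lemma mixed_increment d (A : set 'rV[R]_d) f x i j (s : R) :
  (forall y, `|y - x| <= `|s| + `|s| -> A y) -> classC 2 A f ->
  exists2 y, `|y - x| <= `|s| + `|s| &
    (f (x + s *: e_ i + s *: e_ j) - f (x + s *: e_ i)) -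
    (f (x + s *: e_ j) - f x) = s * s * 'D_(e_ j) (fun y => 'D_(e_ i) f y) y.
Proof.
move=> xA f2; pose g y := f (y + s *: e_ j) - f y.
have en (t : R) k : `|t| <= `|s| -> `|t *: e_ k : 'rV[R]_d| <= `|s|.
  move=> ts; apply: mxnorm_le => // l; rewrite !mxE eqxx/=.
  by case: eqP => _; rewrite ?mulr1// mulr0 normr0.
have A2 (t u : R) : `|t| <= `|s| -> `|u| <= `|s| ->
    `|x + t *: e_ i + u *: e_ j - x| <= `|s| + `|s|.
  move=> ts us; rewrite -(addrA x) [x + _]addrC addrK.
  by rewrite (le_trans (ler_normD _ _))// lerD// en.
have A1 (t : R) : `|t| <= `|s| -> `|x + t *: e_ i - x| <= `|s| + `|s|.
  by move=> ts; have := A2 t 0 ts; rewrite scale0r addr0 normr0; apply.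
have gd (t : R) : `|t| <= `|s| -> is_derive (x + t *: e_ i) (e_ i) g
    ('D_(e_ i) f (x + t *: e_ i + s *: e_ j) - 'D_(e_ i) f (x + t *: e_ i)).
  move=> ts; apply: is_deriveB.
    by apply: derivable_translate; apply: (classC_derivable i f2 _); exact/xA/A2.
  by apply/derivableP; apply: (classC_derivable i f2 _); exact/xA/A1.
have [t ts|c cs E] := @MVT_line R d g x (e_ i) s.
  by case: (gd t ts).
have [t ts|c' cs' E'] :=
    @MVT_line R d (fun y => 'D_(e_ i) f y) (x + c *: e_ i) (e_ j) s.
  by apply: (classC_derivable j (classC_derive i f2) _); exact/xA/A2.
exists (x + c *: e_ i + c' *: e_ j); first exact: A2.
rewrite -[LHS]/(g _ - g _) E (@derive_val _ _ _ _ _ _ _ (gd c cs)) E'.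
by rewrite mulrA.
Qed.

(** Both mixed derivatives are limits of the same second difference quotient,
    computed by [mixed_increment] in the two orders. *)
Lemma derive_sym d (A : set 'rV[R]_d) f x i j : open A -> A x ->
  classC 2 A f ->
  'D_(e_ i) (fun y => 'D_(e_ j) f y) x = 'D_(e_ j) (fun y => 'D_(e_ i) f y) x.
Proof.
move=> oA Ax f2; apply/eqP; rewrite -subr_eq0 -normr_le0; apply/ler_addgt0Pr => e e0.
rewrite add0r.
have near_val k l : \forall y \near x,
    `|'D_(e_ k) (fun y => 'D_(e_ l) f y) x -
      'D_(e_ k) (fun y => 'D_(e_ l) f y) y| < e / 2.
  have Dc := classC_cont (classC_derive k (classC_derive l f2)) Ax.
  apply: (proj1 (@cvgrPdist_lt _ _ _ (nbhs x) (nbhs_filter x) _ _) Dc).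
  by rewrite divr_gt0.
have nA : \forall y \near x, A y by exact: open_nbhs_nbhs.
have nI := @filterI _ (nbhs x) (nbhs_filter x).
have /nbhs_ballP[r /= r0 rB] : nbhs x _ :=
  nI _ _ nA (nI _ _ (near_val i j) (near_val j i)).
pose s := r / 2 / 2.
have s0 : 0 < s by rewrite !divr_gt0.
have ss : `|s| + `|s| < r by rewrite gtr0_norm// /s -splitr ltr_pdivrMr// mulr_natr mulr2n ltrDl.
have rP y : `|y - x| <= `|s| + `|s| -> ball x r y.
  by move=> ys; rewrite -ball_normE/= distrC (le_lt_trans ys).
have xA y : `|y - x| <= `|s| + `|s| -> A y by move=> /rP/rB[].
have [y ys E] := mixed_increment i j xA f2.
have [z zs E'] := mixed_increment j i xA f2.
have [_ [_ jiy]] := rB _ (rP _ ys).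
have [_ [ijz _]] := rB _ (rP _ zs).
have Eyz : 'D_(e_ j) (fun y => 'D_(e_ i) f y) y =
           'D_(e_ i) (fun y => 'D_(e_ j) f y) z.
  apply: (mulfI (_ : s * s != 0)); first by rewrite mulf_neq0// gt_eqF.
  apply: etrans (esym E) _; apply: etrans E'.
  have swap (a b c d' : R) : (a - b) - (c - d') = (a - c) - (b - d').
    by rewrite !opprB addrACA [RHS]addrACA (addrC (- b)).
  by rewrite swap (addrAC x (s *: e_ i)).
suff tri (a b c c' : R) : c' = c -> `|b - c'| < e / 2 -> `|a - c| < e / 2 ->
    `|a - b| <= e by exact: tri Eyz jiy ijz.
move=> -> bc ac; apply: le_trans (ler_distD c _ _) _; rewrite (splitr e).
by apply: lerD; [exact: ltW|rewrite distrC; exact: ltW].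
Qed.

Lemma classC_le k l d (A : set 'rV[R]_d) f :
  (k <= l)%N -> classC l A f -> classC k A f.
Proof.
elim: l => [|l IH]; first by rewrite leqn0 => /eqP->.
rewrite leq_eqVlt => /predU1P[->//|]; rewrite ltnS => kl fl.
exact/IH/classC_pred.
Qed.

Lemma continuous_rV d d' (phi : 'rV[R]_d' -> 'rV[R]_d) x :
  (forall j, {for x, continuous (fun y => phi y 0 j)}) ->
  {for x, continuous phi}.
Proof.
move=> phij.
apply: (proj2 (@cvgrPdist_le _ _ _ (nbhs x) (nbhs_filter x) _ _)) => e e0.
have near_j : \forall y \near x, forall j, `|phi x 0 j - phi y 0 j| <= e.
  apply: (@filter_forall _ _ _ (nbhs x) (nbhs_filter x)) => j.
  exact: (proj1 (@cvgrPdist_le _ _ _ (nbhs x) (nbhs_filter x) _ _) (phij j)).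
apply: filterS near_j => y phiy; apply: mxnorm_le; first exact: ltW.
by move=> j; rewrite !mxE.
Qed.

Lemma classC_comp k d d' (A : set 'rV[R]_d) (B : set 'rV[R]_d') f phi :
  open A -> open B -> (forall x, B x -> A (phi x)) ->
  classC k A f -> (forall j, classC k B (fun x => phi x 0 j)) ->
  classC k B (fun x => f (phi x)).
Proof.
move=> oA oB BA; elim: k f => [|k IH] f fk phik.
  split => // x Bx; apply: continuous_comp.
    by apply: continuous_rV => j; exact: classC_cont (phik j) Bx.
  exact: classC_cont fk (BA _ Bx).
have phic x : B x -> {for x, continuous phi}.
  by move=> Bx; apply: continuous_rV => j; exact: classC_cont (phik j) Bx.
have fD x j : B x -> is_derive x (e_ j) (fun y => f (phi y))
    (\sum_l 'D_(e_ j) (fun y => phi y 0 l) x * 'D_(e_ l) f (phi x)).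
  move=> Bx; apply: derive_comp_partials (BA _ Bx) _ (phic _ Bx) _ => //.
    exact: classC_le fk.
  by move=> l; exact: classC_derivable j (phik l) Bx.
split => [x Bx|j].
  apply: continuous_comp; first exact: phic.
  exact: classC_cont fk (BA _ Bx).
split=> [x Bx|]; first by case: (fD x j Bx).
have Dk : classC k B (fun x => \sum_l
    'D_(e_ j) (fun y => phi y 0 l) x * 'D_(e_ l) f (phi x)).
  apply: classC_sum => // l; apply: classCM => //.
    exact: classC_derive j (phik l).
  by apply: IH (classC_derive l fk) _ => l'; exact: classC_pred.
apply: classC_ext Dk => // x Bx; apply/esym.
by apply: (@derive_val _ _ _ _ _ _ _ (fD x j Bx)).
Qed.

End SecondDerivatives.

(** * Smooth complex-valued functions *)

Section ComplexCalculus.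
Context {R : realType}.
Implicit Types d : nat.

Local Notation e_ j := (delta_mx 0 j).
Local Notation Re := complex.Re.
Local Notation Im := complex.Im.

Lemma smooth_on_ext d (A : set 'rV[R]_d) (f g : 'rV[R]_d -> R[i]) : open A ->
  (forall x, A x -> f x = g x) -> smooth_on A f -> smooth_on A g.
Proof.
move=> oA fg fs k; have [fR fI] := fs k.
by split; [move: fR|move: fI]; apply: classC_ext => // x /fg->.
Qed.

Lemma smooth_on_sub d (A B : set 'rV[R]_d) (f : 'rV[R]_d -> R[i]) :
  B `<=` A -> smooth_on A f -> smooth_on B f.
Proof. by move=> BA fs k; have [] := fs k; split; apply: classC_sub BA _. Qed.

Lemma smooth_on_local d (A : set 'rV[R]_d) (f : 'rV[R]_d -> R[i]) :
  (forall x, A x -> exists B, B x /\ smooth_on B f) -> smooth_on A f.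
Proof.
by move=> fl k; split; apply: classC_local => x /fl[B [Bx fB]];
  exists B; split => //; case: (fB k).
Qed.

Lemma smooth_on_cst d (A : set 'rV[R]_d) (c : R[i]) : smooth_on A (fun=> c).
Proof. by move=> k; split; exact: classC_cst. Qed.

Lemma smooth_onD d (A : set 'rV[R]_d) (f g : 'rV[R]_d -> R[i]) : open A ->
  smooth_on A f -> smooth_on A g -> smooth_on A (fun x => f x + g x).
Proof.
move=> oA fs gs k; have [fR fI] := fs k; have [gR gI] := gs k; split.
  by apply: classC_ext (classCD oA fR gR) => // x _; case: (f x); case: (g x).
by apply: classC_ext (classCD oA fI gI) => // x _; case: (f x); case: (g x).
Qed.

Lemma smooth_onM d (A : set 'rV[R]_d) (f g : 'rV[R]_d -> R[i]) : open A ->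
  smooth_on A f -> smooth_on A g -> smooth_on A (fun x => f x * g x).
Proof.
move=> oA fs gs k; have [fR fI] := fs k; have [gR gI] := gs k; split.
  apply: (@classC_ext _ k d A (fun x => Re (f x) * Re (g x) +
      - (Im (f x) * Im (g x)))) => //.
    by move=> x _; case: (f x) => a b; case: (g x).
  apply: classCD => //; first exact: classCM.
  by apply: classCN => //; exact: classCM.
apply: (@classC_ext _ k d A (fun x => Re (f x) * Im (g x) +
    Im (f x) * Re (g x))) => //.
  by move=> x _; case: (f x) => a b; case: (g x).
by apply: classCD => //; exact: classCM.
Qed.

Lemma smooth_onJ d (A : set 'rV[R]_d) (f : 'rV[R]_d -> R[i]) : open A ->
  smooth_on A f -> smooth_on A (fun x => conjc (f x)).
Proof.
move=> oA fs k; have [fR fI] := fs k; split.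
  by apply: classC_ext fR => // x _; case: (f x).
by apply: classC_ext (classCN oA fI) => // x _; case: (f x).
Qed.

Lemma smooth_onN d (A : set 'rV[R]_d) (f : 'rV[R]_d -> R[i]) : open A ->
  smooth_on A f -> smooth_on A (fun x => - f x).
Proof.
move=> oA fs; apply: smooth_on_ext (smooth_onM oA (smooth_on_cst A (-1)) fs) => //.
by move=> x _; rewrite mulN1r.
Qed.

Lemma smooth_onV d (A : set 'rV[R]_d) (f : 'rV[R]_d -> R[i]) : open A ->
  (forall x, A x -> f x != 0) ->
  smooth_on A f -> smooth_on A (fun x => (f x)^-1).
Proof.
move=> oA f0 fs k; have [fR fI] := fs k.
pose N x := Re (f x) * Re (f x) + Im (f x) * Im (f x).
have N0 x : A x -> N x != 0.
  move=> /f0; rewrite /N; case: (f x) => a b; apply: contra.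
  rewrite -!expr2 paddr_eq0 ?sqr_ge0// !sqrf_eq0 /= => /andP[/eqP-> /eqP->].
  exact: eqxx.
have NV : classC k A (fun x => (N x)^-1).
  by apply: classCV => //; apply: classCD => //; exact: classCM.
split.
  apply: classC_ext (classCM oA fR NV) => // x _; rewrite /N.
  by case: (f x).
apply: classC_ext (classCM oA (classCN oA fI) NV) => // x _; rewrite /N.
by case: (f x) => a b /=; rewrite mulNr.
Qed.

Lemma smooth_on_sum d (A : set 'rV[R]_d) (I : Type) (r : seq I)
    (f : I -> 'rV[R]_d -> R[i]) : open A ->
  (forall i, smooth_on A (f i)) -> smooth_on A (fun x => \sum_(i <- r) f i x).
Proof.
move=> oA fs; elim: r => [|i r IH].
  by apply: smooth_on_ext (smooth_on_cst A 0) => // x _; rewrite big_nil.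
by apply: smooth_on_ext (smooth_onD oA (fs i) IH) => // x _; rewrite big_cons.
Qed.

Lemma smooth_on_pder d (A : set 'rV[R]_d) (f : 'rV[R]_d -> R[i]) j :
  smooth_on A f -> smooth_on A (pderC j f).
Proof.
by move=> fs k; have [fR fI] := fs k.+1; split;
  [exact: classC_derive j fR|exact: classC_derive j fI].
Qed.

Lemma smooth_on_comp d d' (A : set 'rV[R]_d) (B : set 'rV[R]_d')
    (f : 'rV[R]_d -> R[i]) phi :
  open A -> open B -> (forall x, B x -> A (phi x)) -> smooth_on A f ->
  (forall j k, classC k B (fun x => phi x 0 j)) ->
  smooth_on B (fun x => f (phi x)).
Proof.
move=> oA oB BA fs phis k; have [fR fI] := fs k.
have phik j := phis j k.
by split; [exact: classC_comp fR phik|exact: classC_comp fI phik].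
Qed.

Lemma pderC_near d (f g : 'rV[R]_d -> R[i]) j x :
  (\forall y \near x, f y = g y) -> pderC j f x = pderC j g x.
Proof.
move=> fg; rewrite /pderC; congr (_ +i* _); apply: near_eq_derive;
  by apply: filterS fg => y ->.
Qed.

Section AtPoint.
Variables (d : nat) (A : set 'rV[R]_d) (x : 'rV[R]_d).
Hypotheses (oA : open A) (Ax : A x).
Implicit Types f g : 'rV[R]_d -> R[i].

Let dR f j (fs : smooth_on A f) : derivable (fun y => Re (f y)) x (e_ j) :=
  classC_derivable j (fs 1%N).1 Ax.
Let dI f j (fs : smooth_on A f) : derivable (fun y => Im (f y)) x (e_ j) :=
  classC_derivable j (fs 1%N).2 Ax.

Lemma pderC_cst j (c : R[i]) : pderC j (fun=> c) x = 0.
Proof. by rewrite /pderC !derive_cst. Qed.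

Lemma pderCD f g j : smooth_on A f -> smooth_on A g ->
  pderC j (fun y => f y + g y) x = pderC j f x + pderC j g x.
Proof.
move=> fs gs; rewrite /pderC.
have -> : (fun y => Re (f y + g y)) = (fun y => Re (f y)) + (fun y => Re (g y)).
  by apply/funext => y /=; rewrite [RHS]/(_ + _)/=; case: (f y); case: (g y).
have -> : (fun y => Im (f y + g y)) = (fun y => Im (f y)) + (fun y => Im (g y)).
  by apply/funext => y /=; rewrite [RHS]/(_ + _)/=; case: (f y); case: (g y).
rewrite (deriveD (@dR f j fs) (@dR g j gs)) (deriveD (@dI f j fs) (@dI g j gs)).
by [].
Qed.

Lemma pderCM f g j : smooth_on A f -> smooth_on A g ->
  pderC j (fun y => f y * g y) x = pderC j f x * g x + f x * pderC j g x.
Proof.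
move=> fs gs; rewrite /pderC.
have -> : (fun y => Re (f y * g y)) =
    (fun y => Re (f y)) * (fun y => Re (g y)) -
    (fun y => Im (f y)) * (fun y => Im (g y)).
  apply/funext => y.
  transitivity (Re (f y) * Re (g y) - Im (f y) * Im (g y)); last by [].
  by case: (f y) => a b; case: (g y).
have -> : (fun y => Im (f y * g y)) =
    (fun y => Re (f y)) * (fun y => Im (g y)) +
    (fun y => Im (f y)) * (fun y => Re (g y)).
  apply/funext => y.
  transitivity (Re (f y) * Im (g y) + Im (f y) * Re (g y)); last by [].
  by case: (f y) => a b; case: (g y).
have fR : derivable _ x (e_ j) := @dR f j fs.
have fI : derivable _ x (e_ j) := @dI f j fs.
have gR : derivable _ x (e_ j) := @dR g j gs.
have gI : derivable _ x (e_ j) := @dI g j gs.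
have RR : derivable ((fun y => Re (f y)) * (fun y => Re (g y))) x (e_ j) :=
  derivableM fR gR.
have II : derivable ((fun y => Im (f y)) * (fun y => Im (g y))) x (e_ j) :=
  derivableM fI gI.
have RI : derivable ((fun y => Re (f y)) * (fun y => Im (g y))) x (e_ j) :=
  derivableM fR gI.
have IR : derivable ((fun y => Im (f y)) * (fun y => Re (g y))) x (e_ j) :=
  derivableM fI gR.
rewrite (deriveB RR II) (deriveD RI IR).
rewrite (deriveM fR gR) (deriveM fI gI) (deriveM fR gI) (deriveM fI gR).
move: ('D_ _ _ x) ('D_ _ _ x) ('D_ _ _ x) ('D_ _ _ x) => a b a' b'.
case: (f x) (g x) => u v [u' v']; apply/eqP; rewrite eq_complex/=.
by rewrite /GRing.scale/=; apply/andP; split; apply/eqP; ring.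
Qed.

Lemma pderCJ f j : smooth_on A f ->
  pderC j (fun y => conjc (f y)) x = conjc (pderC j f x).
Proof.
move=> fs; rewrite /pderC.
have -> : (fun y => Re (conjc (f y))) = (fun y => Re (f y)).
  by apply/funext => y; case: (f y).
have -> : (fun y => Im (conjc (f y))) = - (fun y => Im (f y)).
  by apply/funext => y; rewrite [RHS]/(- _)/=; case: (f y).
by rewrite (deriveN (@dI f j fs)).
Qed.

Lemma pderC_sym f j l : smooth_on A f ->
  pderC j (pderC l f) x = pderC l (pderC j f) x.
Proof.
move=> fs; have [fR fI] := fs 2%N; rewrite /pderC/=.
by rewrite (derive_sym j l oA Ax fR) (derive_sym j l oA Ax fI).
Qed.

Lemma pderC_comp d' (B : set 'rV[R]_d') (f : 'rV[R]_d' -> R[i]) phi j :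
  open B -> B (phi x) -> smooth_on B f ->
  (forall l k, classC k A (fun y => phi y 0 l)) ->
  pderC j (fun y => f (phi y)) x =
  \sum_l ('D_(e_ j) (fun y => phi y 0 l) x)%:C * pderC l f (phi x).
Proof.
move=> oB Bx fs phis; rewrite /pderC.
have phic : {for x, continuous phi}.
  by apply: continuous_rV => l; exact: classC_cont (phis l 0%N) Ax.
have phid l : derivable (fun y => phi y 0 l) x (e_ j).
  exact: classC_derivable j (phis l 1%N) Ax.
have [fR fI] := fs 1%N.
rewrite (@derive_val _ _ _ _ _ _ _ (derive_comp_partials oB Bx fR phic phid)).
rewrite (@derive_val _ _ _ _ _ _ _ (derive_comp_partials oB Bx fI phic phid)).
apply/eqP; rewrite eq_complex/=; apply/andP; split; apply/eqP.
  rewrite (raddf_sum (@complex.Re R : {additive R[i] -> R})).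
  by apply: eq_bigr => l _ /=; rewrite mul0r subr0.
rewrite (raddf_sum (@complex.Im R : {additive R[i] -> R})).
by apply: eq_bigr => l _ /=; rewrite mul0r addr0.
Qed.

End AtPoint.

End ComplexCalculus.

(** * Wirtinger derivatives *)

Section WirtingerCalculus.
Context {R : realType} {n : nat}.

(** [dz] and [dzbar] treated together: [wder true] is the derivative along
    [z_j], [wder false] the derivative along its conjugate. *)
Definition wder (b : bool) (j : 'I_n) (f : 'rV[R]_(n + n) -> R[i]) x : R[i] :=
  2^-1 * (pderC (lshift n j) f x +
          (if b then - 'i else 'i) * pderC (rshift n j) f x).

Lemma dz_wder j f x : dz j f x = wder true j f x.
Proof. by rewrite /wder mulNr. Qed.

Lemma dzbar_wder j f x : dzbar j f x = wder false j f x.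
Proof. by []. Qed.

Lemma smooth_on_wder (A : set 'rV[R]_(n + n)) b j f : open A ->
  smooth_on A f -> smooth_on A (wder b j f).
Proof.
move=> oA fs; apply: smooth_onM => //; first exact: smooth_on_cst.
apply: smooth_onD => //; first exact: smooth_on_pder.
apply: smooth_onM => //; first exact: smooth_on_cst.
exact: smooth_on_pder.
Qed.

Lemma wder_near b j f g x :
  (\forall y \near x, f y = g y) -> wder b j f x = wder b j g x.
Proof. by move=> fg; rewrite /wder !(pderC_near _ fg). Qed.

Section AtPoint.
Variables (A : set 'rV[R]_(n + n)) (x : 'rV[R]_(n + n)).
Hypotheses (oA : open A) (Ax : A x).

Lemma wder_cst b j (c : R[i]) : wder b j (fun=> c) x = 0.
Proof. by rewrite /wder !pderC_cst mulr0 addr0 mulr0. Qed.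

Lemma wderD b j f g : smooth_on A f -> smooth_on A g ->
  wder b j (fun y => f y + g y) x = wder b j f x + wder b j g x.
Proof.
move=> fs gs; rewrite /wder !(pderCD Ax _ fs gs).
move: (pderC _ _ _) (pderC _ _ _) (pderC _ _ _) (pderC _ _ _) (if b then _ else _).
by move=> p q r s t; ring.
Qed.

Lemma wderM b j f g : smooth_on A f -> smooth_on A g ->
  wder b j (fun y => f y * g y) x = wder b j f x * g x + f x * wder b j g x.
Proof.
move=> fs gs; rewrite /wder !(pderCM Ax _ fs gs).
move: (pderC _ _ _) (pderC _ _ _) (pderC _ _ _) (pderC _ _ _) (if b then _ else _).
by move=> p q r s t; ring.
Qed.

Lemma wderJ b j f : smooth_on A f ->
  wder b j (fun y => conjc (f y)) x = conjc (wder (~~ b) j f x).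
Proof.
move=> fs; rewrite /wder !(pderCJ Ax _ fs) rmorphM rmorphD rmorphM fmorphV rmorph_nat.
congr (_ * (_ + _ * _)).
by case: b; apply/eqP; rewrite eq_complex/= ?oppr0 ?opprK !eqxx.
Qed.

Lemma wder_sym b j b' j' f : smooth_on A f ->
  wder b j (wder b' j' f) x = wder b' j' (wder b j f) x.
Proof.
move=> fs.
have E b1 j1 k : pderC k (wder b1 j1 f) x =
    2^-1 * (pderC k (pderC (lshift n j1) f) x +
            (if b1 then - 'i else 'i) * pderC k (pderC (rshift n j1) f) x).
  have ls := smooth_on_pder (lshift n j1) fs.
  have rs := smooth_on_pder (rshift n j1) fs.
  have crs := smooth_onM oA (smooth_on_cst A (if b1 then - 'i else 'i)) rs.
  rewrite (pderCM Ax _ (smooth_on_cst A _) (smooth_onD oA ls crs)).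
  rewrite pderC_cst mul0r add0r (pderCD Ax _ ls crs).
  by rewrite (pderCM Ax _ (smooth_on_cst A _) rs) pderC_cst mul0r add0r.
rewrite {1}/wder [RHS]/wder (E b' j' (lshift n j)) (E b' j' (rshift n j)).
rewrite (E b j (lshift n j')) (E b j (rshift n j')).
rewrite (pderC_sym oA Ax (lshift n j') (lshift n j) fs).
rewrite (pderC_sym oA Ax (lshift n j') (rshift n j) fs).
rewrite (pderC_sym oA Ax (rshift n j') (lshift n j) fs).
rewrite (pderC_sym oA Ax (rshift n j') (rshift n j) fs).
move: (pderC (lshift n j) _ x) (pderC (lshift n j) _ x).
move: (pderC (rshift n j) _ x) (pderC (rshift n j) _ x).
by move: (if b then _ else _) (if b' then _ else _) => p q r s t u; ring.
Qed.

End AtPoint.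

End WirtingerCalculus.

Section HolomorphicChange.
Context {R : realType} {n : nat}.
Local Notation e_ j := (delta_mx 0 j).

Definition zcoordb (b : bool) (k : 'I_n) (x : 'rV[R]_(n + n)) : R[i] :=
  if b then zcoord k x else conjc (zcoord k x).

Lemma classC_zcoord (A : set 'rV[R]_(n + n)) (phi : 'rV[R]_(n + n) -> 'rV[R]_(n + n)) :
  (forall k, smooth_on A (fun x => zcoord k (phi x))) ->
  forall l m, classC m A (fun x => phi x 0 l).
Proof.
move=> phis l m; case: (splitP l) => k lk.
  by have -> : l = lshift n k by [apply: val_inj]; case: (phis k m).
by have -> : l = rshift n k by [apply: val_inj]; case: (phis k m).
Qed.

(** By the Cauchy-Riemann equations the derivatives of [f] along the other kind
    of coordinate drop out of the chain rule. *)
Lemma wder_comp (A B : set 'rV[R]_(n + n)) (phi : 'rV[R]_(n + n) -> 'rV[R]_(n + n))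
    f b j x :
  open A -> A x -> open B -> B (phi x) -> smooth_on B f ->
  (forall k, holomorphic_on A (fun y => zcoord k (phi y))) ->
  wder b j (fun y => f (phi y)) x =
  \sum_(k < n) wder b j (fun y => zcoordb b k (phi y)) x * wder b k f (phi x).
Proof.
move=> oA Ax oB Bx fs phih.
have phis := classC_zcoord (fun k => (phih k).1).
pose X l : R := 'D_(e_ (lshift n j)) (fun y => phi y 0 l) x.
pose Y l : R := 'D_(e_ (rshift n j)) (fun y => phi y 0 l) x.
pose c : R[i] := if b then - 'i else 'i.
pose u k := (X (lshift n k))%:C + c * (Y (lshift n k))%:C.
have cc : c * c = -1.
  by rewrite /c; case: (b); rewrite ?mulrNN -expr2 sqr_i.
(* the Cauchy-Riemann equations *)
have CR k : X (lshift n k) = Y (rshift n k) /\ X (rshift n k) = - Y (lshift n k).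
  have /eqP : dzbar j (fun y => zcoord k (phi y)) x = 0 by exact: (phih k).2.
  rewrite /dzbar mulf_eq0 invr_eq0 pnatr_eq0/= eq_complex => /andP[/eqP p /eqP q].
  split; apply/eqP.
    by rewrite -subr_eq0; apply/eqP/(etrans _ p); rewrite /= mul0r mul1r sub0r.
  by rewrite -addr_eq0; apply/eqP/(etrans _ q); rewrite /= mul0r mul1r add0r.
have dE k : wder b j (fun y => zcoordb b k (phi y)) x = u k.
  have [p q] := CR k.
  have half : u k = 2^-1 * (u k + u k).
    by rewrite -mulr2n -(mulr_natl (u k)) mulKf// pnatr_eq0.
  have zs := (phih k).1.
  rewrite half /wder /zcoordb /u /c; case: (b).
    rewrite /pderC/= -/(X (lshift n k)) -/(X (rshift n k)).
    rewrite -/(Y (lshift n k)) -/(Y (rshift n k)) p q.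
    by apply/eqP; rewrite eq_complex/=; apply/andP; split; apply/eqP; ring.
  rewrite !(pderCJ Ax _ zs) /pderC/= -/(X (lshift n k)) -/(X (rshift n k)).
  rewrite -/(Y (lshift n k)) -/(Y (rshift n k)) p q.
  by apply/eqP; rewrite eq_complex/=; apply/andP; split; apply/eqP; ring.
have vE k : (X (rshift n k))%:C + c * (Y (rshift n k))%:C = c * u k.
  by rewrite /u; have [-> ->] := CR k; rewrite mulrDr mulrA cc mulN1r addrC rmorphN.
rewrite {1}/wder (pderC_comp Ax _ oB Bx fs phis) (pderC_comp Ax _ oB Bx fs phis).
rewrite mulr_sumr -big_split/= big_split_ord/= -big_split/= mulr_sumr.
apply: eq_bigr => k _; rewrite dE /wder -/c.
have key (xl yl xr yr p q : R[i]) : xr + c * yr = c * (xl + c * yl) ->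
    2^-1 * ((xl * p + c * (yl * p)) + (xr * q + c * (yr * q))) =
    (xl + c * yl) * (2^-1 * (p + c * q)).
  by rewrite !mulrA -!mulrDl => ->; ring.
exact: key (vE k).
Qed.

End HolomorphicChange.

(** * Derivatives on a complex manifold *)

Section ManifoldCalculus.
Context {R : realType} {n : nat} {S : complex_manifold R n}.
Implicit Types (A B : set S) (f g : S -> R[i]) (i : chart_idx S).

Fact der_key : unit. Proof. exact: tt. Qed.
Definition der : bool -> forall i, 'I_n -> (S -> R[i]) -> S -> R[i] :=
  locked_with der_key (fun b i j f s =>
    wder b j (fun x => f (chart_inv i x)) (chart i s)).

Lemma derE b i j f s :
  der b i j f s = wder b j (fun x => f (chart_inv i x)) (chart i s).
Proof. by rewrite /der unlock. Qed.

Lemma mdz_der i j f s : mdz i j f s = der true i j f s.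
Proof. by rewrite derE; exact: dz_wder. Qed.

Lemma mdzbar_der i j f s : mdzbar i j f s = der false i j f s.
Proof. by rewrite derE; exact: dzbar_wder. Qed.

Lemma near_chart_inv i s (P : set S) : cdom i s ->
  (\forall t \near s, P t) -> \forall x \near chart i s, P (chart_inv i x).
Proof.
move=> is_ Ps; have := chart_inv_cont is_; rewrite /prop_for /continuous_at.
by rewrite chartK// => /(_ P); exact.
Qed.

Lemma open_chart_image i A : open A -> open (chart i @` (A `&` cdom i)).
Proof.
move=> oA; rewrite openE => _ [s [As is_] <-].
have nA : \forall x \near chart i s, A (chart_inv i x).
  by apply: near_chart_inv => //; exact: open_nbhs_nbhs.
have nD : nbhs (chart i s) (chart i @` cdom i).
  by apply: open_nbhs_nbhs; split; [exact: open_chart|exists s].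
rewrite /interior; apply: filterS2 nA nD => x Ax [t it xt].
by exists t => //; split => //; rewrite -(chartK it) xt.
Qed.

Arguments open_chart_image i {A} _.

Lemma chart_imageP i A x :
  (chart i @` (A `&` cdom i)) x -> A (chart_inv i x) /\ cdom i (chart_inv i x).
Proof. by move=> [s [As is_] <-]; rewrite chartK. Qed.

Lemma smooth_fun_ext A f g : open A ->
  (forall s, A s -> f s = g s) -> smooth_fun A f -> smooth_fun A g.
Proof.
move=> oA fg fs i; apply: smooth_on_ext (fs i); first exact: open_chart_image.
by move=> x /chart_imageP[/fg].
Qed.

Lemma smooth_fun_sub A B f : B `<=` A -> smooth_fun A f -> smooth_fun B f.
Proof.
move=> BA fs i; apply: smooth_on_sub (fs i).
by move=> _ [s [/BA As is_] <-]; exists s.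
Qed.

Lemma smooth_fun_local A f :
  (forall s, A s -> exists B, [/\ open B, B s & smooth_fun B f]) ->
  smooth_fun A f.
Proof.
move=> fl i; apply: smooth_on_local => _ [s [/fl[B [oB Bs fB]] is_] <-].
exists (chart i @` (B `&` cdom i)); split => //.
by exists s.
Qed.

Lemma smooth_fun_cst A (c : R[i]) : smooth_fun A (fun=> c).
Proof. by move=> i; exact: smooth_on_cst. Qed.

Lemma smooth_funD A f g : open A -> smooth_fun A f -> smooth_fun A g ->
  smooth_fun A (fun s => f s + g s).
Proof. by move=> oA fs gs i; apply: smooth_onD; first exact: open_chart_image. Qed.

Lemma smooth_funM A f g : open A -> smooth_fun A f -> smooth_fun A g ->
  smooth_fun A (fun s => f s * g s).
Proof. by move=> oA fs gs i; apply: smooth_onM; first exact: open_chart_image. Qed.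

Lemma smooth_funN A f : open A -> smooth_fun A f ->
  smooth_fun A (fun s => - f s).
Proof. by move=> oA fs i; apply: smooth_onN; first exact: open_chart_image. Qed.

Lemma smooth_funJ A f : open A -> smooth_fun A f ->
  smooth_fun A (fun s => conjc (f s)).
Proof. by move=> oA fs i; apply: smooth_onJ; first exact: open_chart_image. Qed.

Lemma smooth_funV A f : open A -> (forall s, A s -> f s != 0) ->
  smooth_fun A f -> smooth_fun A (fun s => (f s)^-1).
Proof.
move=> oA f0 fs i; apply: smooth_onV => //; first exact: open_chart_image.
by move=> x /chart_imageP[/f0].
Qed.

Lemma smooth_fun_sum A (I : Type) (r : seq I) (f : I -> S -> R[i]) : open A ->
  (forall k, smooth_fun A (f k)) ->
  smooth_fun A (fun s => \sum_(k <- r) f k s).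
Proof.
by move=> oA fs i; apply: smooth_on_sum;
  [exact: open_chart_image|move=> k; exact: fs].
Qed.

Lemma smooth_fun_prod A (I : Type) (r : seq I) (f : I -> S -> R[i]) : open A ->
  (forall k, smooth_fun A (f k)) ->
  smooth_fun A (fun s => \prod_(k <- r) f k s).
Proof.
move=> oA fs; elim: r => [|k r IH].
  by apply: smooth_fun_ext (smooth_fun_cst A 1) => // s _; rewrite big_nil.
by apply: smooth_fun_ext (smooth_funM oA (fs k) IH) => // s _; rewrite big_cons.
Qed.

(** Changes of charts are holomorphic, hence smooth in both directions. *)
Lemma smooth_fun_chart A i f : open A -> A `<=` cdom i ->
  smooth_on (chart i @` (A `&` cdom i)) (fun x => f (chart_inv i x)) ->
  smooth_fun A f.
Proof.
move=> oA Ai fs i'.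
pose phi x := chart i (chart_inv i' x).
have oA' := open_chart_image i' oA.
apply: (@smooth_on_ext _ _ _ (fun x => f (chart_inv i (phi x)))) => //.
  by move=> x /chart_imageP[/Ai Ax _]; rewrite /phi chartK.
apply: smooth_on_comp fs _ => //; first exact: open_chart_image.
  move=> x /chart_imageP[Ax i'x]; exists (chart_inv i' x) => //.
  by split => //; exact: Ai.
apply: classC_zcoord => k.
apply: smooth_on_sub (chart_holo i' i k).1.
by move=> _ [s [As i's] <-]; exists s => //; split => //; exact: Ai.
Qed.

Lemma der_near b i j f g s : cdom i s ->
  (\forall t \near s, f t = g t) -> der b i j f s = der b i j g s.
Proof. by move=> is_ fg; rewrite !derE; apply: wder_near; exact: near_chart_inv is_ fg. Qed.

Lemma der_cst b i j (c : R[i]) s : der b i j (fun=> c) s = 0.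
Proof. by rewrite derE; exact: wder_cst. Qed.

Lemma smooth_der A b i j f : open A -> smooth_fun A f ->
  smooth_fun (A `&` cdom i) (der b i j f).
Proof.
move=> oA fs; have oAi : open (A `&` cdom i) by apply: openI => //; exact: open_cdom.
apply: (@smooth_fun_chart _ i) => //; rewrite -setIA setIid.
apply: (smooth_on_ext (open_chart_image i oA) _ (smooth_on_wder b j (open_chart_image i oA) (fs i))).
by move=> x [s [As is_] <-]; rewrite derE chartK.
Qed.

Section AtPoint.
Variables (A : set S) (i : chart_idx S) (s : S).
Hypotheses (oA : open A) (As : A s) (is_ : cdom i s).

Let oAi : open (chart i @` (A `&` cdom i)) := open_chart_image i oA.
Let Ai : (chart i @` (A `&` cdom i)) (chart i s).
Proof. by exists s. Qed.

Lemma derD b j f g : smooth_fun A f -> smooth_fun A g ->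
  der b i j (fun t => f t + g t) s = der b i j f s + der b i j g s.
Proof. by move=> fs gs; rewrite !derE; exact: (wderD Ai b j (fs i) (gs i)). Qed.

Lemma derM b j f g : smooth_fun A f -> smooth_fun A g ->
  der b i j (fun t => f t * g t) s = der b i j f s * g s + f s * der b i j g s.
Proof.
by move=> fs gs; rewrite !derE (wderM Ai b j (fs i) (gs i)) chartK.
Qed.

Lemma derJ b j f : smooth_fun A f ->
  der b i j (fun t => conjc (f t)) s = conjc (der (~~ b) i j f s).
Proof. by move=> fs; rewrite !derE; exact: (wderJ Ai b j (fs i)). Qed.

Lemma der_sym b j b' j' f : smooth_fun A f ->
  der b i j (der b' i j' f) s = der b' i j' (der b i j f) s.
Proof.
move=> fs.
have E b1 j1 b2 j2 : der b1 i j1 (der b2 i j2 f) s =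
    wder b1 j1 (wder b2 j2 (fun x => f (chart_inv i x))) (chart i s).
  rewrite derE; apply: wder_near; apply: filterS (open_nbhs_nbhs (conj oAi Ai)).
  by move=> _ [t [_ it] <-]; rewrite derE chartK.
by rewrite !E; exact: (wder_sym oAi Ai b j b' j' (fs i)).
Qed.

Lemma der_chart b j i' f : cdom i' s -> smooth_fun A f ->
  der b i j f s = \sum_(k < n) der b i j (fun t => zcoordb b k (chart i' t)) s *
                               der b i' k f s.
Proof.
move=> i's fs; rewrite derE; under [RHS]eq_bigr do rewrite !derE.
pose A' := A `&` cdom i'.
have oA' : open A' by apply: openI => //; exact: open_cdom.
have o1 := open_chart_image i oA'.
have x1 : (chart i @` (A' `&` cdom i)) (chart i s) by exists s.
pose phi x := chart i' (chart_inv i x).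
rewrite (@wder_near _ _ _ _ _ (fun x => f (chart_inv i' (phi x)))); last first.
  apply: filterS (open_nbhs_nbhs (conj o1 x1)) => _ [t [[At i't] it] <-].
  by rewrite /phi chartK// chartK.
have phis : phi (chart i s) = chart i' s by rewrite /phi chartK.
have oi' := open_chart_image i' oA.
rewrite (@wder_comp R n _ _ phi (fun y => f (chart_inv i' y)) b j _ o1 x1 oi').
- by rewrite phis.
- by rewrite phis; exists s.
- exact: fs.
- move=> k; have [hs h0] := chart_holo i i' k.
  have sub : chart i @` (A' `&` cdom i) `<=` chart i @` (cdom i `&` cdom i').
    by move=> _ [t [[At i't] it] <-]; exists t.
  by split => [|x /sub]; [exact: smooth_on_sub hs|exact: h0].
Qed.

End AtPoint.

End ManifoldCalculus.
Arguments open_chart_image {R n S} i {A} _.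

(** * Matrices of smooth functions *)

Section MatrixCalculus.
Context {R : realType} {n : nat} {S : complex_manifold R n}.
Local Notation C := R[i].
Implicit Types (A B : set S) (i : chart_idx S) (s : S).

Lemma near_smooth_neq0 A (f : S -> C) s : open A -> A s -> smooth_fun A f ->
  f s != 0 -> \forall t \near s, f t != 0.
Proof.
move=> oA As fs fs0; pose i := chart_at s.
have is_ : cdom i s := cdom_chart_at s.
have xA : (chart i @` (A `&` cdom i)) (chart i s) by exists s.
have nD : \forall t \near s, cdom i t.
  by apply: open_nbhs_nbhs; split => //; exact: open_cdom.
have near_ne (h : C -> R) : (classC 0 (chart i @` (A `&` cdom i))
    (fun x => h (f (chart_inv i x)))) -> h (f s) != 0 ->
    \forall t \near s, h (f t) != 0.
  move=> hc h0; have hx := classC_cont hc xA.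
  have := continuous_comp (chart_cont is_) hx; rewrite /prop_for /continuous_at/=.
  move=> /(_ (fun z => z != 0)); rewrite chartK// => near_h.
  have : nbhs (h (f s)) (fun z : R => z != 0).
    by apply: open_nbhs_nbhs; split => //; exact: open_neq.
  move=> /near_h nh; apply: filterS2 nD nh => t it.
  by rewrite /= chartK.
have [Re0|Re0] := eqVneq (complex.Re (f s)) 0; last first.
  have := near_ne (@complex.Re R) (fs i 0%N).1 Re0.
  by apply: filterS => t; apply: contra => /eqP->.
have Im0 : complex.Im (f s) != 0.
  by apply: contra fs0 => Im0; rewrite eq_complex Re0 Im0/= eqxx.
have := near_ne (@complex.Im R) (fs i 0%N).2 Im0.
by apply: filterS => t; apply: contra => /eqP->.
Qed.

Definition smooth_mx p q A (M : S -> 'M[C]_(p, q)) : Prop :=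
  forall k l, smooth_fun A (fun s => M s k l).

Definition dmx p q (b : bool) i j (M : S -> 'M[C]_(p, q)) s : 'M[C]_(p, q) :=
  \matrix_(k, l) der b i j (fun t => M t k l) s.

Lemma dmxE p q b i j (M : S -> 'M[C]_(p, q)) s k l :
  dmx b i j M s k l = der b i j (fun t => M t k l) s.
Proof. by rewrite mxE. Qed.

Lemma smooth_mx_ext p q A (M N : S -> 'M[C]_(p, q)) : open A ->
  (forall s, A s -> M s = N s) -> smooth_mx A M -> smooth_mx A N.
Proof.
by move=> oA MN Ms k l; apply: smooth_fun_ext (Ms k l) => // s /MN->.
Qed.

Lemma smooth_mx_sub p q A B (M : S -> 'M[C]_(p, q)) :
  B `<=` A -> smooth_mx A M -> smooth_mx B M.
Proof. by move=> BA Ms k l; exact: smooth_fun_sub BA (Ms k l). Qed.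

Lemma smooth_mx_local p q A (M : S -> 'M[C]_(p, q)) :
  (forall s, A s -> exists B, [/\ open B, B s & smooth_mx B M]) ->
  smooth_mx A M.
Proof.
move=> Ml k l; apply: smooth_fun_local => s /Ml[B [oB Bs MB]].
by exists B; split.
Qed.

Lemma smooth_mx_cst p q A (M : 'M[C]_(p, q)) : smooth_mx A (fun=> M).
Proof. by move=> k l; exact: smooth_fun_cst. Qed.

Lemma smooth_mxD p q A (M N : S -> 'M[C]_(p, q)) : open A ->
  smooth_mx A M -> smooth_mx A N -> smooth_mx A (fun s => M s + N s).
Proof.
move=> oA Ms Ns k l; apply: smooth_fun_ext (smooth_funD oA (Ms k l) (Ns k l)) => //.
by move=> s _; rewrite mxE.
Qed.

Lemma smooth_mxN p q A (M : S -> 'M[C]_(p, q)) : open A ->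
  smooth_mx A M -> smooth_mx A (fun s => - M s).
Proof.
move=> oA Ms k l; apply: smooth_fun_ext (smooth_funN oA (Ms k l)) => //.
by move=> s _; rewrite mxE.
Qed.

Lemma smooth_mxM p q r A (M : S -> 'M[C]_(p, q)) (N : S -> 'M[C]_(q, r)) :
  open A -> smooth_mx A M -> smooth_mx A N -> smooth_mx A (fun s => M s *m N s).
Proof.
move=> oA Ms Ns k l.
apply: (@smooth_fun_ext _ _ _ _ (fun s => \sum_m M s k m * N s m l)) => //.
  by move=> s _; rewrite mxE.
by apply: smooth_fun_sum => // m; exact: smooth_funM (Ms k m) (Ns m l).
Qed.

Lemma smooth_mxZ p q A (f : S -> C) (M : S -> 'M[C]_(p, q)) : open A ->
  smooth_fun A f -> smooth_mx A M -> smooth_mx A (fun s => f s *: M s).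
Proof.
move=> oA fs Ms k l; apply: smooth_fun_ext (smooth_funM oA fs (Ms k l)) => //.
by move=> s _; rewrite mxE.
Qed.

Lemma smooth_mxJ p q A (M : S -> 'M[C]_(p, q)) : open A ->
  smooth_mx A M -> smooth_mx A (fun s => conj_mx (M s)).
Proof.
move=> oA Ms k l; apply: smooth_fun_ext (smooth_funJ oA (Ms k l)) => //.
by move=> s _; rewrite mxE.
Qed.

Lemma smooth_mx_sum p q A (I : Type) (r : seq I) (M : I -> S -> 'M[C]_(p, q)) :
  open A -> (forall m, smooth_mx A (M m)) ->
  smooth_mx A (fun s => \sum_(m <- r) M m s).
Proof.
move=> oA Ms k l.
apply: (@smooth_fun_ext _ _ _ _ (fun s => \sum_(m <- r) M m s k l)) => //.
  by move=> s _; rewrite summxE.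
by apply: smooth_fun_sum => // m; exact: Ms.
Qed.

Lemma smooth_mx_col p p' q A (M : S -> 'M[C]_(p, q)) (N : S -> 'M[C]_(p', q)) :
  smooth_mx A M -> smooth_mx A N -> smooth_mx A (fun s => col_mx (M s) (N s)).
Proof.
move=> Ms Ns k l; case: (splitP k) => m km.
  have -> : k = lshift p' m by apply: val_inj.
  by under eq_fun do rewrite col_mxEu; exact: Ms.
have -> : k = rshift p m by apply: val_inj.
by under eq_fun do rewrite col_mxEd; exact: Ns.
Qed.

Lemma smooth_det p A (M : S -> 'M[C]_p) : open A -> smooth_mx A M ->
  smooth_fun A (fun s => \det (M s)).
Proof.
move=> oA Ms; rewrite /determinant; apply: smooth_fun_sum => // e.
apply: smooth_funM => //; first exact: smooth_fun_cst.
by apply: smooth_fun_prod => // k; exact: Ms.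
Qed.

Lemma smooth_invmx p A (M : S -> 'M[C]_p) : open A ->
  (forall s, A s -> M s \in unitmx) -> smooth_mx A M ->
  smooth_mx A (fun s => invmx (M s)).
Proof.
move=> oA Mu Ms.
apply: (@smooth_mx_ext _ _ _ (fun s => (\det (M s))^-1 *: \adj (M s))) => //.
  by move=> s As; rewrite /invmx (Mu _ As).
apply: smooth_mxZ => //.
  exact: smooth_funV (smooth_det oA Ms).
move=> k l.
apply: (@smooth_fun_ext _ _ _ _ (fun s => cofactor (M s) l k)) => //.
  by move=> s _; rewrite mxE.
apply: smooth_funM => //; first exact: smooth_fun_cst.
apply: smooth_det => // k' l'.
by apply: smooth_fun_ext (Ms (lift l k') (lift k l')) => // s _; rewrite !mxE.
Qed.

Lemma near_unitmx p A (M : S -> 'M[C]_p) s : open A -> A s -> smooth_mx A M ->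
  M s \in unitmx -> \forall t \near s, M t \in unitmx.
Proof.
move=> oA As Ms; rewrite unitmxE unitfE => us.
have := near_smooth_neq0 oA As (smooth_det oA Ms) us.
by apply: filterS => t; rewrite unitmxE unitfE.
Qed.

Lemma dmx_near p q b i j (M N : S -> 'M[C]_(p, q)) s : cdom i s ->
  (\forall t \near s, M t = N t) -> dmx b i j M s = dmx b i j N s.
Proof.
move=> is_ MN; apply/matrixP => k l; rewrite !mxE.
by apply: der_near => //; apply: filterS MN => t ->.
Qed.

Lemma dmx_cst p q b i j (M : 'M[C]_(p, q)) s : dmx b i j (fun=> M) s = 0.
Proof. by apply/matrixP => k l; rewrite !mxE der_cst. Qed.

Lemma smooth_dmx p q A b i j (M : S -> 'M[C]_(p, q)) : open A ->
  smooth_mx A M -> smooth_mx (A `&` cdom i) (dmx b i j M).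
Proof.
move=> oA Ms k l.
have -> : (fun s => dmx b i j M s k l) = der b i j (fun t => M t k l).
  by apply/funext => s; rewrite mxE.
exact: smooth_der.
Qed.

Section AtPoint.
Variables (A : set S) (i : chart_idx S) (s : S).
Hypotheses (oA : open A) (As : A s) (is_ : cdom i s).

Lemma dmxD p q b j (M N : S -> 'M[C]_(p, q)) : smooth_mx A M -> smooth_mx A N ->
  dmx b i j (fun t => M t + N t) s = dmx b i j M s + dmx b i j N s.
Proof.
move=> Ms Ns; apply/matrixP => k l; rewrite !mxE.
under eq_fun do rewrite mxE.
exact: (derD As is_ b j (Ms k l) (Ns k l)).
Qed.

Lemma der_sum b j (I : Type) (r : seq I) (f : I -> S -> C) :
  (forall m, smooth_fun A (f m)) ->
  der b i j (fun t => \sum_(m <- r) f m t) s = \sum_(m <- r) der b i j (f m) s.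
Proof.
move=> fs; elim: r => [|m r IH].
  by rewrite big_nil; under eq_fun do rewrite big_nil; exact: der_cst.
rewrite big_cons -IH; under eq_fun do rewrite big_cons.
by apply: (derD As is_ b j (fs m)); exact: smooth_fun_sum.
Qed.

Lemma dmxM p q r b j (M : S -> 'M[C]_(p, q)) (N : S -> 'M[C]_(q, r)) :
  smooth_mx A M -> smooth_mx A N ->
  dmx b i j (fun t => M t *m N t) s = dmx b i j M s *m N s + M s *m dmx b i j N s.
Proof.
move=> Ms Ns; apply/matrixP => k l; rewrite !mxE -big_split/=.
under eq_fun do rewrite mxE.
rewrite der_sum => [|m]; last exact: smooth_funM (Ms k m) (Ns m l).
by apply: eq_bigr => m _; rewrite !mxE; exact: (derM As is_ b j (Ms k m) (Ns m l)).
Qed.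

Lemma dmxMr p q r b j (M : S -> 'M[C]_(p, q)) (N : 'M[C]_(q, r)) :
  smooth_mx A M -> dmx b i j (fun t => M t *m N) s = dmx b i j M s *m N.
Proof.
by move=> Ms; rewrite (dmxM _ _ Ms (smooth_mx_cst A N)) dmx_cst mulmx0 addr0.
Qed.

Lemma dmxJ p q b j (M : S -> 'M[C]_(p, q)) : smooth_mx A M ->
  dmx b i j (fun t => conj_mx (M t)) s = conj_mx (dmx (~~ b) i j M s).
Proof.
move=> Ms; apply/matrixP => k l; rewrite !mxE; under eq_fun do rewrite mxE.
exact: (derJ As is_ b j (Ms k l)).
Qed.

Lemma dmx_sym p q b j b' j' (M : S -> 'M[C]_(p, q)) : smooth_mx A M ->
  dmx b i j (dmx b' i j' M) s = dmx b' i j' (dmx b i j M) s.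
Proof.
move=> Ms; apply/matrixP => k l.
have E b1 j1 : (fun t => dmx b1 i j1 M t k l) = der b1 i j1 (fun t => M t k l).
  by apply/funext => t; rewrite dmxE.
have E2 b1 j1 b2 j2 : dmx b1 i j1 (dmx b2 i j2 M) s k l =
    der b1 i j1 (der b2 i j2 (fun t => M t k l)) s.
  apply: (etrans (dmxE b1 i j1 _ s k l)).
  exact: (congr1 (fun h => der b1 i j1 h s) (E b2 j2)).
apply: (etrans (E2 b j b' j')); apply: (etrans _ (esym (E2 b' j' b j))).
exact: (der_sym oA As is_ b j b' j' (Ms k l)).
Qed.

Lemma dmx_chart p q b j i' (M : S -> 'M[C]_(p, q)) : cdom i' s ->
  smooth_mx A M ->
  dmx b i j M s = \sum_(k < n) der b i j (fun t => zcoordb b k (chart i' t)) s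
                               *: dmx b i' k M s.
Proof.
move=> i's Ms; apply/matrixP => k l; rewrite summxE !mxE.
rewrite (der_chart oA As is_ b j i's (Ms k l)).
by apply: eq_bigr => m _; rewrite !mxE.
Qed.

End AtPoint.

End MatrixCalculus.

(** * The flat connection *)

Section FlatConnection.
Context {R : realType} {n : nat} {S : complex_manifold R n}.
Variable L : local_system S.
Local Notation C := R[i].
Local Notation E := (complexify L).
Implicit Types (A B : set S) (i : chart_idx S) (s t : S) (a : fr_idx E).

(** Rows of [g] are sections; working with several of them at once makes
    local frames and the Leibniz rule for change of frame available. *)
Definition sections r := forall s : S, 'M[C]_(r, brk E s).

Definition loc r a (g : sections r) t : 'M[C]_(r, frk a) :=
  g t *m coframe a t.

Definition smooth_sections r A (g : sections r) : Prop :=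
  forall a, smooth_mx (A `&` fdom a) (loc a g).

Lemma smooth_sections1 A (sigma : section E) :
  smooth_section A sigma <-> smooth_sections A (sigma : sections 1).
Proof.
by split => [ss a k l|ss a k]; [rewrite (ord1 k); exact: ss|exact: ss].
Qed.

Lemma near_open s (Q : set S) : (\forall t \near s, Q t) ->
  exists B, [/\ open B, B s & B `<=` Q].
Proof.
move=> Qs; have : nbhs s Q := Qs.
by rewrite nbhsE => -[B [oB Bs] BQ]; exists B; split.
Qed.

Lemma near_fdom a s : fdom a s -> \forall t \near s, fdom a t.
Proof. by move=> as_; apply: open_nbhs_nbhs; split => //; exact: open_fdom. Qed.

Lemma near_transition a (b : fr_idx E) s : fdom a s -> fdom b s ->
  \forall t \near s, frame a t *m coframe b t = frame a s *m coframe b s.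
Proof.
move=> as_ bs; apply: filterS (ls_flat as_ bs) => t E_.
rewrite /= -!map_mxM; congr (map_mx _ _); exact: E_.
Qed.

Lemma loc_change r (g : sections r) a (b : fr_idx E) s t : fdom a t ->
  frame a t *m coframe b t = frame a s *m coframe b s ->
  loc b g t = loc a g t *m (frame a s *m coframe b s).
Proof.
move=> at_ <-; rewrite /loc -mulmxA (mulmxA (coframe a t)).
by rewrite (coframeK at_) mul1mx.
Qed.

Lemma locK r (g : sections r) a t : fdom a t -> loc a g t *m frame a t = g t.
Proof. by move=> at_; rewrite /loc -mulmxA (coframeK at_) mulmx1. Qed.

Lemma smooth_sections_frame r A a (g : sections r) : open A -> A `<=` fdom a ->
  smooth_mx A (loc a g) -> smooth_sections A g.
Proof.
move=> oA Aa gs b; apply: smooth_mx_local => s [As bs].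
have as_ := Aa _ As.
have /near_open[B [oB Bs BP]] := near_transition as_ bs.
exists (B `&` (A `&` fdom b)); split => //.
  by apply: openI => //; apply: openI => //; exact: open_fdom.
apply: (@smooth_mx_ext _ _ _ _ _ _
    (fun t => loc a g t *m (frame a s *m coframe b s))).
- by apply: openI => //; apply: openI => //; exact: open_fdom.
- by move=> t [/BP Bt [/Aa at_ _]]; rewrite (loc_change _ at_ Bt).
- have oB' : open (B `&` (A `&` fdom b)).
    by apply: openI => //; apply: openI => //; exact: open_fdom.
  apply: (smooth_mxM oB') => //; last exact: smooth_mx_cst.
  by apply: smooth_mx_sub gs => t [_ []].
Qed.

Lemma smooth_sections_local r A (g : sections r) :
  (forall s, A s -> exists B, [/\ open B, B s & smooth_sections B g]) ->
  smooth_sections A g.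
Proof.
move=> gl a; apply: smooth_mx_local => s [/gl[B [oB Bs gB]] as_].
exists (B `&` fdom a); split => //; apply: openI => //; exact: open_fdom.
Qed.

Lemma smooth_sections_sub r A B (g : sections r) : B `<=` A ->
  smooth_sections A g -> smooth_sections B g.
Proof. by move=> BA gs a; apply: smooth_mx_sub (gs a); exact: setSI. Qed.

Let openIf A a : open A -> open (A `&` fdom a).
Proof. by move=> oA; apply: openI => //; exact: open_fdom. Qed.

Lemma smooth_sections_ext r A (g h : sections r) : open A ->
  (forall s, A s -> g s = h s) -> smooth_sections A g -> smooth_sections A h.
Proof.
move=> oA gh gs a; apply: smooth_mx_ext (gs a); first exact: openIf.
by move=> s [/gh E_ _]; rewrite /loc E_.
Qed.

Lemma smooth_sectionsD r A (g h : sections r) : open A ->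
  smooth_sections A g -> smooth_sections A h ->
  smooth_sections A (fun s => g s + h s).
Proof.
move=> oA gs hs a.
apply: smooth_mx_ext (smooth_mxD (openIf a oA) (gs a) (hs a)).
  exact: openIf.
by move=> s _; rewrite /loc mulmxDl.
Qed.

Lemma smooth_sectionsM r r' A (Y : S -> 'M[C]_(r', r)) (g : sections r) :
  open A -> smooth_mx A Y -> smooth_sections A g ->
  smooth_sections A (fun s => Y s *m g s).
Proof.
move=> oA Ys gs a.
have Ya : smooth_mx (A `&` fdom a) Y by apply: smooth_mx_sub Ys => t [].
apply: smooth_mx_ext (smooth_mxM (openIf a oA) Ya (gs a)).
  exact: openIf.
by move=> s _; rewrite /loc mulmxA.
Qed.

Lemma smooth_sections0 r A : smooth_sections A (fun s => 0 : 'M[C]_(r, brk E s)).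
Proof.
move=> a; have -> : loc a (fun s => 0 : 'M[C]_(r, brk E s)) = fun=> 0.
  by apply/funext => t; rewrite /loc mul0mx.
exact: smooth_mx_cst.
Qed.

Lemma smooth_sections_sum r A (I : Type) (e : seq I) (g : I -> sections r) :
  open A -> (forall k, smooth_sections A (g k)) ->
  smooth_sections A (fun s => \sum_(k <- e) g k s).
Proof.
move=> oA gs; elim: e => [|k e IH].
  by apply: smooth_sections_ext (@smooth_sections0 r A) => // s _; rewrite big_nil.
apply: smooth_sections_ext (smooth_sectionsD oA (gs k) IH) => // s _.
by rewrite big_cons.
Qed.

Lemma smooth_frame a : smooth_sections (fdom a) (fun t => frame a t : 'M[C]_(frk a, brk E t)).
Proof.
apply: (@smooth_sections_frame _ _ a); [exact: open_fdom|by []|].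
apply: smooth_mx_ext (smooth_mx_cst _ 1%:M); first exact: open_fdom.
by move=> t at_; rewrite /loc (frameK at_).
Qed.

Lemma loc_conj r (g : sections r) a :
  loc a (fun t => conj_mx (g t)) = fun t => conj_mx (loc a g t).
Proof. by apply/funext => t; rewrite /loc conj_mxM /= conj_ratr. Qed.

Lemma smooth_sectionsJ r A (g : sections r) : open A ->
  smooth_sections A g -> smooth_sections A (fun s => conj_mx (g s)).
Proof.
by move=> oA gs a; rewrite loc_conj; apply: smooth_mxJ; first exact: openIf.
Qed.

Fact nabla_key : unit. Proof. exact: tt. Qed.
Definition nabla : forall r, bool -> forall (i : chart_idx S), 'I_n ->
    sections r -> forall s, 'M[C]_(r, brk E s) :=
  locked_with nabla_key (fun r b i j g s =>
    dmx b i j (loc (fr_at E s) g) s *m frame (fr_at E s) s).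

Lemma nablaE r b i j (g : sections r) s :
  nabla b i j g s = dmx b i j (loc (fr_at E s) g) s *m frame (fr_at E s) s.
Proof. by rewrite /nabla unlock. Qed.

Lemma nabla10E i j (sigma : section E) s :
  nabla10 L i j sigma s = nabla true i j (sigma : sections 1) s.
Proof.
have E_ : \row_k mdz i j (fun t => (sigma t *m coframe (fr_at E s) t) 0 k) s =
    dmx true i j (loc (fr_at E s) (sigma : sections 1)) s.
  by apply/rowP => k; rewrite mxE dmxE mdz_der.
rewrite nablaE; exact: (congr1 (fun M => M *m frame (fr_at E s) s) E_).
Qed.

Lemma nabla01E i j (sigma : section E) s :
  nabla01 L i j sigma s = nabla false i j (sigma : sections 1) s.
Proof.
have E_ : \row_k mdzbar i j (fun t => (sigma t *m coframe (fr_at E s) t) 0 k) s =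
    dmx false i j (loc (fr_at E s) (sigma : sections 1)) s.
  by apply/rowP => k; rewrite mxE dmxE mdzbar_der.
rewrite nablaE; exact: (congr1 (fun M => M *m frame (fr_at E s) s) E_).
Qed.

Lemma nabla_near r b i j (g h : sections r) s : cdom i s ->
  (\forall t \near s, g t = h t) -> nabla b i j g s = nabla b i j h s.
Proof.
move=> is_ gh; rewrite !nablaE (dmx_near b j (N := loc (fr_at E s) h) is_)//.
by apply: filterS gh => t E_; rewrite /loc E_.
Qed.

Lemma nabla_row r b i j (g : sections r) k s :
  nabla b i j (fun t => row k (g t) : 'M[C]_(1, brk E t)) s = row k (nabla b i j g s).
Proof.
rewrite !nablaE row_mul.
suff -> : dmx b i j (loc (fr_at E s) (fun t => row k (g t))) s =
    row k (dmx b i j (loc (fr_at E s) g) s) by [].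
apply/rowP => l; rewrite dmxE mxE dmxE.
have -> // : (fun t => loc (fr_at E s) (fun t => row k (g t)) t 0 l) =
    (fun t => loc (fr_at E s) g t k l).
by apply/funext => t; rewrite /loc -row_mul mxE.
Qed.

Section AtPoint.
Variables (A : set S) (i : chart_idx S) (s : S).
Hypotheses (oA : open A) (As : A s) (is_ : cdom i s).

(** Flatness of the transition functions: the connection can be computed in any
    of the frames. *)
Lemma nabla_frame r b j (g : sections r) a : smooth_sections A g -> fdom a s ->
  nabla b i j g s = dmx b i j (loc a g) s *m frame a s.
Proof.
move=> gs as_; pose a' := fr_at E s.
have a's : fdom a' s by exact: fdom_fr_at.
rewrite !nablaE -/a'.
rewrite (@dmx_near _ _ _ _ _ _ _ _ (loc a' g)
    (fun t => loc a g t *m (frame a s *m coframe a' s))) //.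
  rewrite (dmxMr (openIf a oA) (conj As as_) is_ _ _ _ (gs a)).
  by rewrite -!mulmxA (coframeK a's) mulmx1.
apply: filterS2 (near_fdom as_) (near_transition as_ a's) => t at_.
exact: loc_change.
Qed.

Lemma loc_nabla r b j (g : sections r) a : smooth_sections A g -> fdom a s ->
  loc a (nabla b i j g) s = dmx b i j (loc a g) s.
Proof.
move=> gs as_; rewrite /loc (nabla_frame _ _ gs as_) -mulmxA (frameK as_).
by rewrite mulmx1.
Qed.

Let a := fr_at E s.
Let as_ : fdom a s. Proof. exact: fdom_fr_at. Qed.
Let oAa : open (A `&` fdom a) := openIf a oA.
Let Aas : (A `&` fdom a) s := conj As as_.

Lemma nablaD r b j (g h : sections r) :
  smooth_sections A g -> smooth_sections A h ->
  nabla b i j (fun t => g t + h t) s = nabla b i j g s + nabla b i j h s.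
Proof.
move=> gs hs.
have E_ : loc a (fun t => g t + h t) = fun t => loc a g t + loc a h t.
  by apply/funext => t; rewrite /loc mulmxDl.
by rewrite !nablaE E_ (dmxD Aas is_ b j (gs a) (hs a)) mulmxDl.
Qed.

Lemma nablaM r r' b j (Y : S -> 'M[C]_(r', r)) (g : sections r) :
  smooth_mx A Y -> smooth_sections A g ->
  nabla b i j (fun t => Y t *m g t) s =
  dmx b i j Y s *m g s + Y s *m nabla b i j g s.
Proof.
move=> Ys gs; have Ya : smooth_mx (A `&` fdom a) Y by apply: smooth_mx_sub Ys => t [].
have E_ : loc a (fun t => Y t *m g t) = fun t => Y t *m loc a g t.
  by apply/funext => t; rewrite /loc mulmxA.
rewrite !nablaE E_ (dmxM oAa Aas is_ b j Ya (gs a)) mulmxDl.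
by rewrite -[in X in X + _]mulmxA (locK _ as_) mulmxA.
Qed.

Lemma nablaJ r b j (g : sections r) : smooth_sections A g ->
  nabla b i j (fun t => conj_mx (g t)) s = conj_mx (nabla (~~ b) i j g s).
Proof.
move=> gs; rewrite !nablaE loc_conj (dmxJ Aas is_ b j (gs a)).
by rewrite conj_mxM /= conj_ratr.
Qed.

Lemma nabla_chart r b j i' (g : sections r) : cdom i' s ->
  smooth_sections A g ->
  nabla b i j g s = \sum_(k < n) der b i j (fun t => zcoordb b k (chart i' t)) s
                                 *: nabla b i' k g s.
Proof.
move=> i's gs; under [RHS]eq_bigr do rewrite nablaE.
rewrite nablaE (dmx_chart oAa Aas is_ b j i's (gs a)).
by rewrite mulmx_suml; apply: eq_bigr => k _; rewrite scalemxAl.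
Qed.

End AtPoint.

Lemma nabla0 r b i j s : nabla b i j (fun t => 0 : 'M[C]_(r, brk E t)) s = 0.
Proof.
rewrite !nablaE; have -> : loc (fr_at E s) (fun s => 0 : 'M[C]_(r, brk E s)) = fun=> 0.
  by apply/funext => t; rewrite /loc mul0mx.
by rewrite dmx_cst mul0mx.
Qed.

Lemma smooth_nabla r A b i j (g : sections r) : open A ->
  smooth_sections A g -> smooth_sections (A `&` cdom i) (nabla b i j g).
Proof.
move=> oA gs; apply: smooth_sections_local => s [As is_].
pose a := fr_at E s; pose B := A `&` fdom a `&` cdom i.
have oB : open B by apply: openI; [exact: openIf|exact: open_cdom].
have as_ : fdom a s by exact: fdom_fr_at.
exists B; split; [exact: oB|by []|].
apply: (@smooth_sections_frame _ _ a) => //; first by move=> t [[]].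
apply: smooth_mx_ext (smooth_dmx b i j (openIf a oA) (gs a)) => //.
by move=> t [[At at_] it]; rewrite (loc_nabla oA At it b j gs at_).
Qed.

(** In a flat frame the connection differentiates the coordinates, and partial
    derivatives commute. *)
Lemma nabla_sym r A i s b j b' j' (g : sections r) :
  open A -> A s -> cdom i s -> smooth_sections A g ->
  nabla b i j (nabla b' i j' g) s = nabla b' i j' (nabla b i j g) s.
Proof.
move=> oA As is_ gs; pose a := fr_at E s.
have as_ : fdom a s by exact: fdom_fr_at.
have oAa := openIf a oA.
have E_ b1 j1 b2 j2 : nabla b1 i j1 (nabla b2 i j2 g) s =
    dmx b1 i j1 (dmx b2 i j2 (loc a g)) s *m frame a s.
  rewrite nablaE -/a (dmx_near b1 j1 (N := dmx b2 i j2 (loc a g)) is_)//.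
  have nA : nbhs s (A `&` fdom a `&` cdom i).
    by apply: open_nbhs_nbhs; split => //; apply: openI => //; exact: open_cdom.
  by apply: filterS nA => t [[At at_] it]; exact: (loc_nabla oA At it b2 j2 gs at_).
by rewrite !E_ (dmx_sym oAa (conj As as_) is_ b j b' j' (gs a)).
Qed.

Lemma smooth_sections_hom r A (g : sections r)
    (P : forall s, 'M[C]_(brk E s, brk E s)) : open A ->
  smooth_hom A P -> smooth_sections A g ->
  smooth_sections A (fun t => g t *m P t).
Proof.
move=> oA Ps gs; apply: smooth_sections_local => s As.
pose a := fr_at E s; have as_ : fdom a s by exact: fdom_fr_at.
exists (A `&` fdom a); split; [exact: openIf|by []|].
have oAa := openIf a oA.
apply: (@smooth_sections_frame _ _ a); [exact: oAa|by move=> t []|].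
apply: (@smooth_mx_ext _ _ _ _ _ _
    (fun t => loc a g t *m (frame a t *m P t *m coframe a t))) => //.
- move=> t [At at_]; rewrite /loc -!mulmxA (mulmxA (coframe a t)).
  by rewrite (coframeK at_) mul1mx.
- apply: (smooth_mxM oAa (gs a)).
  by move=> k l; apply: smooth_fun_sub (Ps a a k l) => t [At at_].
Qed.

End FlatConnection.

(** * Smooth families of linear equations *)

Section SmoothLinearAlgebra.
Context {R : realType} {n : nat} {S : complex_manifold R n}.
Local Notation C := R[i].
Implicit Types (A B : set S) (s t : S).

(** If [N0] is a right inverse of [M s], then [M t *m N0] stays invertible for [t]
    near [s]. *)
Lemma smooth_right_inverse p q A (M : S -> 'M[C]_(p, q)) s :
  open A -> A s -> smooth_mx A M -> row_free (M s) ->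
  exists B (N : S -> 'M[C]_(q, p)), [/\ open B, B s, B `<=` A, smooth_mx B N &
    forall t, B t -> M t *m N t = 1%:M].
Proof.
move=> oA As Ms /row_freeP[N0 MN0].
have MNs : smooth_mx A (fun t => M t *m N0).
  by apply: smooth_mxM => //; exact: smooth_mx_cst.
have /near_open[B [oB Bs BU]] : \forall t \near s, M t *m N0 \in unitmx.
  by apply: (near_unitmx oA As MNs); rewrite MN0 unitmx1.
have oAB : open (A `&` B) by exact: openI.
have MNs' : smooth_mx (A `&` B) (fun t => M t *m N0).
  by apply: smooth_mx_sub MNs => t [].
exists (A `&` B), (fun t => N0 *m invmx (M t *m N0)).
split; [exact: oAB|by []|by move=> t []| |].
- apply: (smooth_mxM oAB (smooth_mx_cst _ N0)).
  by apply: smooth_invmx => // t [_ Bt]; exact: BU.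
- by move=> t [_ Bt]; rewrite mulmxA mulmxV//; exact: BU.
Qed.

(** If the rows of [A0 *m N t] span the rows of [N t], then
    [1 - N t *m X t *m A0], with [X t] a right inverse of [A0 *m N t], projects
    onto the kernel of [N t]. The rank being constant, a choice of [A0] for [s] is
    good for all [t] near [s]. *)
Lemma smooth_kernel p q A (N : S -> 'M[C]_(p, q)) s (y0 : 'rV[C]_p) :
  open A -> A s -> smooth_mx A N ->
  (\forall t \near s, \rank (N t) = \rank (N s)) -> y0 *m N s = 0 ->
  exists B (y : S -> 'rV[C]_p), [/\ open B, B s, B `<=` A, smooth_mx B y &
    y s = y0 /\ forall t, B t -> y t *m N t = 0].
Proof.
move=> oA As Ns Nr y0N.
have /submxP[A0 A0E] : (row_base (N s) <= N s)%MS by rewrite eq_row_base.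
have ANs : smooth_mx A (fun t => A0 *m N t).
  by apply: smooth_mxM => //; exact: smooth_mx_cst.
have free0 : row_free (A0 *m N s) by rewrite -A0E row_base_free.
have [B1 [X [oB1 B1s B1A Xs XE]]] := smooth_right_inverse oA As ANs free0.
have [B2 [oB2 B2s B2r]] := near_open Nr.
have B1s' : forall r (M : S -> 'M[C]_(r, q)), smooth_mx A M -> smooth_mx (B1 `&` B2) M.
  by move=> r M; apply: smooth_mx_sub => t [/B1A].
have oB := openI oB1 oB2.
exists (B1 `&` B2), (fun t => y0 + - (y0 *m N t *m X t *m A0)).
split; [exact: oB|by []|by move=> t [/B1A]| |].
  have Xs' : smooth_mx (B1 `&` B2) X by apply: smooth_mx_sub Xs => t [].
  apply: (smooth_mxD oB (smooth_mx_cst _ y0)); apply: (smooth_mxN oB).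
  have NXs := smooth_mxM oB (B1s' _ _ Ns) Xs'.
  have yNXs := smooth_mxM oB (smooth_mxM oB (smooth_mx_cst _ y0) NXs)
                             (smooth_mx_cst _ A0).
  by apply: smooth_mx_ext yNXs => // t _; rewrite !mulmxA.
split; first by rewrite y0N !mul0mx oppr0 addr0.
move=> t [B1t B2t]; have XEt := XE _ B1t.
have free_t : row_free (A0 *m N t) by apply/row_freeP; exists (X t).
have rk : \rank (A0 *m N t) = \rank (N t).
  by rewrite (B2r _ B2t); exact/eqP.
have sup := mxrank_leqif_sup (submxMl A0 (N t)).
have /submxP[Z ZE] : (N t <= A0 *m N t)%MS by rewrite -sup rk.
have NE : N t *m X t *m A0 *m N t = N t.
  have NX : N t *m X t = Z by rewrite {1}ZE -mulmxA XEt mulmx1.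
  by rewrite NX -mulmxA -ZE.
rewrite mulmxDl mulNmx -!(mulmxA y0) NE subrr //.
Qed.

(** The first hypothesis says that the vectors satisfying [Gen] span [H]. This
    selects, at one point, the vectors whose extensions form a local frame. *)
Lemma row_free_select (K : fieldType) m (Gen : 'rV[K]_m -> Prop) (H : 'M[K]_m) r :
  (forall X : 'M[K]_m, (forall v, Gen v -> (v <= X)%MS) -> (H <= X)%MS) ->
  (r <= \rank H)%N ->
  exists G : 'M[K]_(r, m), row_free G /\ forall k, Gen (row k G).
Proof.
move=> lub; elim: r => [|r IH] rH.
  by exists 0; split; [rewrite /row_free mxrank0|case].
have [G [Gfree GG]] := IH (ltnW rH).
have [v [Gv vG]] : exists v, Gen v /\ ~~ (v <= G)%MS.
  apply: contrapT => nv; suff HG : (H <= G)%MS.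
    by have := mxrankS HG; rewrite (eqP Gfree) leqNgt rH.
  rewrite -(genmxE G); apply: lub => v Gv; rewrite genmxE.
  by apply: contrapT => /negP vG; apply: nv; exists v.
exists (col_mx v G); split; last first.
  move=> k; case: (@splitP 1 r k) => j kj.
    have -> : k = lshift r j by apply: val_inj.
    have -> : row (lshift r j) (col_mx v G) = v.
      by apply/rowP => l; rewrite mxE col_mxEu ord1.
    exact: Gv.
  have -> : k = rshift 1 j by apply: val_inj.
  have -> : row (rshift 1 j) (col_mx v G) = row j G.
    by apply/rowP => l; rewrite mxE col_mxEd mxE.
  exact: GG.
have rk : \rank (col_mx v G) = \rank (v + G)%MS by rewrite addsmxE.
apply/eqP; apply: etrans rk _.
have v0 : v != 0 by apply: contra vG => /eqP->; exact: sub0mx.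
have cap0 : (v :&: G)%MS = 0.
  apply: cap0_elim => w wv wG; apply: contrapT => /eqP w0.
  case/negP: vG; apply: submx_trans wG.
  have := mxrank_leqif_sup wv; rewrite !rank_rV w0 v0 => -[_ <-] //.
have := mxrank_sum_cap v G; rewrite cap0 mxrank0 addn0 rank_rV v0 => ->.
by rewrite (eqP Gfree).
Qed.

End SmoothLinearAlgebra.

(** * Sections of the Hodge filtration of bounded weight *)

Section HodgeBundles.
Context {R : realType} {n : nat} {S : complex_manifold R n}.
Variable V : vmhs S.
Local Notation C := R[i].
Local Notation E := (complexify V).
Implicit Types (A B : set S) (s t : S) (a : fr_idx E) (p q k l : int).

Definition Wt s : int -> 'M[rat]_(brk V s) := fun k => vW V k s.
Definition Ft s : int -> 'M[C]_(brk V s) := fun p => vF V p s.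

Local Notation cWt k s := (@cW R _ (Wt s) k : 'M[C]_(brk E s)).
Local Notation FWt p k s := (@FW R _ (Wt s) (Ft s) p k : 'M[C]_(brk E s)).
Local Notation cFWt p k s := (@cFW R _ (Wt s) (Ft s) p k : 'M[C]_(brk E s)).
Local Notation oppFt p k s := (@oppF R _ (Wt s) (Ft s) p k : 'M[C]_(brk E s)).

Let Wf s : increasing_filtration (Wt s) := W_filtration V s.
Let Ff s : decreasing_filtration (Ft s) := F_filtration V s.
Let pure s : forall k, pure_on_gr (Wt s) (Ft s) k := fun k => gr_pure V k s.

Lemma coframe_free a t : fdom a t -> row_free (coframe a t).
Proof. by move=> at_; apply/row_freeP; exists (frame a t); exact: coframeK. Qed.

Lemma frk_brk a t : fdom a t -> frk a = brk E t.
Proof.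
move=> at_; apply/eqP; rewrite eqn_leq; apply/andP; split.
  have ff : row_free (frame a t) by apply/row_freeP; exists (coframe a t); exact: frameK.
  by rewrite -(eqP ff) rank_leq_col.
by rewrite -(eqP (coframe_free at_)) rank_leq_col.
Qed.

Lemma near_brk s : \forall t \near s, brk E t = brk E s.
Proof.
have as_ : fdom (fr_at E s) s by exact: fdom_fr_at.
by apply: filterS (near_fdom as_) => t at_; rewrite -(frk_brk at_) (frk_brk as_).
Qed.

Lemma near_cW a k s : fdom a s ->
  \forall t \near s, (cWt k t *m coframe a t :=: cWt k s *m coframe a s)%MS.
Proof.
move=> as_; apply: filterS (@W_flat _ _ _ V k a s as_) => t WE.
rewrite /cW /cpx_mx /= -!map_mxM; apply/eqmxP; rewrite !map_submx.
exact/eqmxP.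
Qed.

Lemma near_rank_cW k s : \forall t \near s, \rank (cWt k t) = \rank (cWt k s).
Proof.
have as_ : fdom (fr_at E s) s by exact: fdom_fr_at.
apply: filterS2 (near_fdom as_) (near_cW k as_) => t at_ WE.
rewrite -(mxrankMfree _ (coframe_free at_)) WE.
by rewrite (mxrankMfree _ (coframe_free as_)).
Qed.

(** Independent rows stay independent near [s0], so independent vectors of the
    fibre at [s0] that extend to sections with a property [Q] are the values of an
    independent family of such sections. *)
Lemma free_rows_extend r s0 (G : 'M[C]_(r, brk E s0))
    (Q : 'I_r -> set S -> sections V 1 -> Prop) : row_free G ->
  (forall k : 'I_r, exists B h,
    [/\ open B, B s0, smooth_sections B h, h s0 = row k G & Q k B h]) ->
  exists A (g : sections V r), [/\ open A, A s0, smooth_sections A g,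
    forall t, A t -> row_free (g t) &
    forall k : 'I_r, exists B h, [/\ open B, A `<=` B, Q k B h &
      forall t, row k (g t) = h t]].
Proof.
move=> Gfree ext; have ext' (k : 'I_r) : exists Bh : set S * sections V 1,
    [/\ open Bh.1, Bh.1 s0, smooth_sections Bh.1 Bh.2, Bh.2 s0 = row k G &
        Q k Bh.1 Bh.2].
  by have [B [h hP]] := ext k; exists (B, h).
have [c cP] := choice ext'.
pose g : sections V r := fun t => \matrix_k ((c k).2 t : 'rV[C]_(brk E t)).
have row_g (k : 'I_r) t : row k (g t) = (c k).2 t by rewrite rowK.
have nB : \forall t \near s0, forall k : 'I_r, (c k).1 t.
  apply: (@filter_forall _ _ _ (nbhs s0) (nbhs_filter s0)) => k.
  by have [oB Bs0 _ _ _] := cP k; exact: open_nbhs_nbhs.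
have [B [oB Bs0 BP]] := near_open nB.
have gs : smooth_sections B g.
  move=> a k l; have [_ _ gs _ _] := cP k.
  apply: (@smooth_fun_ext _ _ _ _ (fun t => loc a (c k).2 t 0 l)).
  - by apply: openI => //; exact: open_fdom.
  - by move=> t _; rewrite /loc -row_g -row_mul [LHS]mxE.
  - by apply: smooth_fun_sub (gs a 0 l) => t [/BP Bt at_].
have g0 : g s0 = G.
  by apply/row_matrixP => k; rewrite row_g; have [_ _ _ -> _] := cP k.
pose a := fr_at E s0; have as0 : fdom a s0 by exact: fdom_fr_at.
have oBa : open (B `&` fdom a) by apply: openI => //; exact: open_fdom.
have free0 : row_free (loc a g s0).
  by rewrite /loc g0 /row_free (mxrankMfree _ (coframe_free as0)).
have [A [X [oA As0 AB Xs XE]]] :=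
  smooth_right_inverse oBa (conj Bs0 as0) (gs a) free0.
exists A, g; split; [exact: oA|exact: As0| | |].
- by apply: smooth_sections_sub gs => t /AB[].
- move=> t At; have [Bt at_] := AB t At.
  rewrite /row_free -(mxrankMfree _ (coframe_free at_)).
  by apply/row_freeP; exists (X t); exact: XE.
- move=> k; have [oBk _ _ _ Qk] := cP k; exists (c k).1, (c k).2; split.
  + exact: oBk.
  + by move=> t /AB[/BP].
  + exact: Qk.
  + exact: row_g.
Qed.

Definition is_frame r A (g : sections V r) (H : subspaces V) : Prop :=
  forall t, A t -> row_free (g t) /\ (g t :=: H t)%MS.

Lemma holo_subbundle_frame (H : subspaces V) s0 : holo_subbundle V H ->
  exists A r (g : sections V r), [/\ open A, A s0, smooth_sections A g,
    is_frame A g H & forall i j s, A s -> cdom i s -> nabla false i j g s = 0].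
Proof.
move=> /(_ s0)[A [r [g [oA As gh gf]]]]; exists A, r, g; split => //.
  move=> a k l; have [gs _] := gh k.
  by apply: smooth_fun_ext (gs a l); [apply: openI => //; exact: open_fdom|
     move=> t _; rewrite /loc -row_mul mxE].
move=> i j s As' is_; apply/row_matrixP => k; rewrite row0 -nabla_row -nabla01E.
by have [_ g0] := gh k; exact: g0.
Qed.

Lemma near_rank (H : subspaces V) s : holo_subbundle V H ->
  \forall t \near s, \rank (H t) = \rank (H s).
Proof.
move=> /(holo_subbundle_frame s)[A [r [g [oA As _ gf _]]]].
have rk t : A t -> \rank (H t) = r.
  by move=> /gf[/eqP gr gH]; rewrite -gH.
by apply: filterS (open_nbhs_nbhs (conj oA As)) => t At; rewrite !rk.
Qed.

Lemma near_rank_F p s : \forall t \near s, \rank (Ft t p) = \rank (Ft s p).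
Proof. exact: (near_rank s (F_holo V p)). Qed.

(** By induction on [k]: the rank of the intersection of [F^p] and [W_k] is determined
    by the same rank for [k - 1], the rank of [W_(k-1)], and the rank of the
    Hodge filtration on the graded piece, which is locally constant. *)
Lemma near_rank_FW p k s :
  \forall t \near s, \rank (FWt p k t) = \rank (FWt p k s).
Proof.
have [k0 W0] := W_low (R := R) (Wf s).
elim/(@int_up_ind k0): k => [k kk0|k IH].
  have W0s := W0 k kk0; apply: filterS (near_rank_cW k s) => t.
  rewrite W0s mxrank0 => /eqP; rewrite mxrank_eq0 => /eqP Wt0.
  by rewrite /FW Wt0 W0s !capmx0 !mxrank0.
have nW1 := near_rank_cW (k - 1) s.
have ngr := near_rank s (gr_F_holo V p k).
have rk t : (\rank (grF (Wt t) (Ft t) p k) + \rank (FWt p (k - 1) t) =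
             \rank (FWt p k t) + \rank (cWt (k - 1) t))%N.
  rewrite -mxrank_sum_cap; congr addn; apply: eqmx_rank.
  apply/andP; split.
    rewrite sub_capmx capmxSr andbT; apply: (FW_le (Wf t) (Ff t)) => //; lia.
  rewrite sub_capmx capmxSr andbT.
  by apply: submx_trans (capmxSl _ _) (capmxSl _ _).
apply: filterS3 IH nW1 ngr => t e1 e2 e3.
have e3' : \rank (grF (Wt t) (Ft t) p k) = \rank (grF (Wt s) (Ft s) p k) := e3.
have r1 := rk t; have r2 := rk s; lia.
Qed.

(** The relations between a frame of [F^p] and a flat frame of [W_k] form a kernel
    of constant rank, so [smooth_kernel] extends the relation given by [v0]. *)
Lemma FW_extend p k s0 (v0 : 'rV[C]_(brk E s0)) : (v0 <= FWt p k s0)%MS ->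
  exists B (g : sections V 1), [/\ open B, B s0, smooth_sections B g, g s0 = v0 &
    forall t, B t -> (g t <= FWt p k t)%MS].
Proof.
move=> v0F; pose a := fr_at E s0; have as0 : fdom a s0 by exact: fdom_fr_at.
have [A [r [f [oA As0 fs ff _]]]] := holo_subbundle_frame s0 (F_holo V p).
pose M0 := cWt k s0 *m coframe a s0.
pose N t := col_mx (loc a f t) M0.
have oAa : open (A `&` fdom a) by apply: openI => //; exact: open_fdom.
have Ns : smooth_mx (A `&` fdom a) N.
  by apply: smooth_mx_col; [exact: fs|exact: smooth_mx_cst].
have nW := near_cW k as0.
have rN t : (A `&` fdom a) t -> (cWt k t *m coframe a t :=: M0)%MS ->
    (\rank (N t) + \rank (FWt p k t) = \rank (Ft t p) + \rank (cWt k t))%N.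
  move=> [At at_] WE; have [_ fF] := ff t At.
  rewrite /FW -mxrank_sum_cap; congr addn.
  rewrite /N -addsmxE -(mxrankMfree _ (coframe_free at_)) addsmxMr.
  by apply/eqmx_rank/eqmxP; apply: adds_eqmx; [exact: eqmxMr|exact: eqmx_sym].
have NC : \forall t \near s0, \rank (N t) = \rank (N s0).
  have nA : nbhs s0 (A `&` fdom a) by apply: open_nbhs_nbhs.
  have n1 : \forall t \near s0, (A `&` fdom a) t /\ (cWt k t *m coframe a t :=: M0)%MS.
    by apply: filterS2 nA nW.
  have n2 := near_rank_FW p k s0; have n3 := near_rank_F p s0.
  have n4 := near_rank_cW k s0.
  have n34 : \forall t \near s0, \rank (Ft t p) = \rank (Ft s0 p) /\
      \rank (cWt k t) = \rank (cWt k s0) by apply: filterS2 n3 n4.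
  apply: filterS3 n1 n2 n34 => t [At WE] e2 [e3 e4].
  have r1 := rN t At WE.
  have r2 := rN s0 (conj As0 as0) (eqmx_refl _); lia.
move: v0F; rewrite sub_capmx => /andP[v0F v0W].
have [_ fF0] := ff s0 As0.
have /submxP[y1 y1E] : (v0 <= f s0)%MS by rewrite fF0.
have /submxP[y2 y2E] := v0W.
have y0N : row_mx y1 (- y2) *m N s0 = 0.
  rewrite mul_row_col /loc mulmxA -y1E mulNmx mulmxA -y2E.
  by rewrite subrr.
have [B [y [oB Bs0 BA ys [yE yN]]]] :=
  smooth_kernel oAa (conj As0 as0) Ns NC y0N.
have [B' [oB' B's0 B'W]] := near_open nW.
have oBB := openI oB oB'.
have lys : smooth_mx (B `&` B') (fun t => lsubmx (y t)).
  move=> k' l'; apply: (@smooth_fun_ext _ _ _ _ (fun t => y t k' (lshift _ l'))) => //.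
    by move=> t _; rewrite mxE.
  by apply: smooth_fun_sub (ys _ _) => t [].
exists (B `&` B'), (fun t => lsubmx (y t) *m f t).
split; [exact: oBB|by []| | |].
- apply: smooth_sectionsM => //.
  by apply: smooth_sections_sub fs => t [/BA[]].
- by rewrite yE row_mxKl -y1E.
- move=> t [Bt B't]; have [At at_] := BA t Bt; have [_ fF] := ff t At.
  rewrite sub_capmx; apply/andP; split.
    by apply: submx_trans (submxMl _ _) _; rewrite fF.
  have /eqP : lsubmx (y t) *m loc a f t + rsubmx (y t) *m M0 = 0.
    by rewrite -mul_row_col hsubmxK; exact: yN.
  rewrite addr_eq0 /loc mulmxA => /eqP yE'.
  rewrite -(submxMfree _ _ (coframe_free at_)) (B'W t B't) -/M0 yE'.
  by rewrite eqmx_opp submxMl.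
Qed.

End HodgeBundles.

(** * The opposite filtration as a smooth subbundle *)

Section OppositeFiltration.
Context {R : realType} {n : nat} {S : complex_manifold R n}.
Variable V : vmhs S.
Local Notation C := R[i].
Local Notation E := (complexify V).
Implicit Types (A B : set S) (s t : S) (a : fr_idx E) (p q k l : int).

Local Notation Wt := (Wt V).
Local Notation Ft := (Ft V).
Local Notation cWt k s := (@cW R _ (Wt s) k : 'M[C]_(brk E s)).
Local Notation FWt p k s := (@FW R _ (Wt s) (Ft s) p k : 'M[C]_(brk E s)).
Local Notation cFWt p k s := (@cFW R _ (Wt s) (Ft s) p k : 'M[C]_(brk E s)).
Local Notation oppFt p k s := (@oppF R _ (Wt s) (Ft s) p k : 'M[C]_(brk E s)).

Let Wf s : increasing_filtration (Wt s) := W_filtration V s.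
Let Ff s : decreasing_filtration (Ft s) := F_filtration V s.
Let pure s : forall k, pure_on_gr (Wt s) (Ft s) k := fun k => gr_pure V k s.

Definition top_weight k1 t : Prop := forall k, k1 <= k -> (1%:M <= cWt k t)%MS.

(** The weight filtration is locally constant, so a weight at which it is full
    can be fixed near [s]. *)
Lemma near_top_weight s : exists k1, \forall t \near s, top_weight k1 t.
Proof.
have [k1 W1] := W_high (R := R) (Wf s); exists k1.
apply: filterS2 (near_brk V s) (near_rank_cW V k1 s) => t bE WE k kk1.
apply: submx_trans (cW_le (Wf t) kk1); rewrite sub1mx /row_full.
have := W1 _ (lexx k1); rewrite sub1mx /row_full => /eqP W1s.
by apply/eqP; apply: etrans WE _; apply: etrans W1s _; exact: esym bE.
Qed.

Lemma near_F_range s : exists p0 p1, p0 <= p1 /\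
  \forall t \near s, (1%:M <= Ft t p0)%MS /\ Ft t p1 = 0.
Proof.
have [p0 F0] := F_low (Ff s); have [p1 F1] := F_high (Ff s).
exists p0, (Num.max p0 p1); split; first by rewrite le_max lexx.
have F1s : Ft s (Num.max p0 p1) = 0 by apply: F1; rewrite le_max lexx orbT.
have nF0 := near_rank_F V p0 s; have nF1 := near_rank_F V (Num.max p0 p1) s.
apply: filterS3 (near_brk V s) nF0 nF1 => t bE E0 E1; split.
  rewrite sub1mx /row_full; apply/eqP; apply: etrans E0 _.
  have := F0 _ (lexx p0); rewrite sub1mx /row_full => /eqP F0s.
  by apply: etrans F0s _; exact: esym bE.
by apply/eqP; rewrite -mxrank_eq0; apply/eqP; apply: etrans E1 _; rewrite F1s mxrank0.
Qed.

Lemma rank_oppF p k1 t : top_weight k1 t ->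
  (\rank (Ft t (p + 1)) + \rank (oppFt p k1 t))%N = brk E t.
Proof.
move=> W1; have full := F_oppF_full (Wf t) (Ff t) (@pure t) (p + 1) k1.
have cap0 : (Ft t (p + 1) :&: oppF (Wt t) (Ft t) p k1)%MS = 0.
  apply: cap0_elim => v vF vG; apply: (F_oppF_cap (Wf t) (Ff t) (@pure t) vF).
  by rewrite addrK; exact: vG.
rewrite -mxrank_sum_cap cap0 mxrank0 addn0; apply/eqP.
rewrite -[_ == _]/(row_full _) -sub1mx; apply: submx_trans (W1 _ (lexx k1)) _.
by apply: submx_trans full _; rewrite addrK addsmxS// capmxSl.
Qed.

(** Conjugates of the sections of [FW_extend] span. The rows of the frame are
    kept inside single generating subspaces of the filtration, because it is
    only there that the derivatives are known beforehand. *)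
Lemma oppF_frame p k1 s0 : (\forall t \near s0, top_weight k1 t) ->
  exists A r (g : sections V r), [/\ open A, A s0, smooth_sections A g,
    is_frame A g (fun t => oppFt p k1 t) &
    forall k : 'I_r, exists l, forall t, A t -> (row k (g t) <= cFWt (l - p) l t)%MS].
Proof.
move=> nW1; pose H s := oppFt p k1 s; pose r := \rank (H s0).
pose Gen (v : 'rV[C]_(brk E s0)) := exists2 l, l <= k1 & (v <= cFWt (l - p) l s0)%MS.
have [G [Gfree GG]] : exists G : 'M[C]_(r, brk E s0),
    row_free G /\ forall k : 'I_r, Gen (row k G).
  apply: (@row_free_select _ _ Gen (H s0)) => // X GX.
  by apply: oppF_lub => l lk1; apply/rV_subP => v vl; apply: GX; exists l.
pose Q (k : 'I_r) (B : set S) (h : sections V 1) :=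
  exists2 l, l <= k1 & forall t, B t -> (h t <= cFWt (l - p) l t)%MS.
have ext (k : 'I_r) : exists B h,
    [/\ open B, B s0, smooth_sections B h, h s0 = row k G & Q k B h].
  have [l lk1 kG] := GG k.
  have kG' : (conj_mx (row k G) <= FWt (l - p) l s0)%MS.
    by rewrite -(conj_cFW (Wt s0) (Ft s0)) conj_mx_sub.
  have [B [g [oB Bs0 gs gE gF]]] := FW_extend kG'.
  exists B, (fun t => conj_mx (g t)); split; [exact: oB|exact: Bs0| | |].
  - exact: smooth_sectionsJ.
  - by rewrite gE conj_mxK.
  - by exists l => // t Bt; rewrite conj_mx_subl conj_cFW; exact: gF.
have [A1 [g [oA1 A1s0 gs gfree gk]]] := free_rows_extend Gfree ext.
have nr := near_rank_F V (p + 1) s0.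
have near_all : \forall t \near s0, top_weight k1 t /\
    (\rank (Ft t (p + 1)) = \rank (Ft s0 (p + 1)) /\ brk E t = brk E s0).
  by apply: filterS3 nW1 nr (near_brk V s0).
have [A2 [oA2 A2s0 A2P]] := near_open near_all.
have W10 := nbhs_singleton nW1.
exists (A1 `&` A2), r, g; split.
- exact: openI.
- by [].
- by apply: smooth_sections_sub gs => t [].
- move=> t [A1t A2t]; have [W1t [rF bE]] := A2P t A2t; have free_t := gfree t A1t.
  split => //; apply/eqmxP.
  have gH : (g t <= H t)%MS.
    apply/row_subP => k; have [B [h [_ A1B [l lk1 hF] ->]]] := gk k.
    exact: submx_trans (hF t (A1B t A1t)) (oppF_ub _ (Wf t) _ lk1).
  rewrite gH /= -(geq_leqif (mxrank_leqif_sup gH)) (eqP free_t).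
  have r1 := rank_oppF p W1t; have r2 := rank_oppF p W10.
  have rF' : \rank (Ft t (p + 1)) = \rank (Ft s0 (p + 1)) := rF.
  have bE' : brk E t = brk E s0 := bE.
  by rewrite /r /H; lia.
- move=> k; have [B [h [_ A1B [l lk1 hF] rE]]] := gk k.
  by exists l => t [/A1B Bt _]; rewrite rE; exact: hF.
Qed.

Section Horizontality.
Variables (A : set S) (i : chart_idx S) (s : S) (j : 'I_n).
Hypotheses (oA : open A) (As : A s) (is_ : cdom i s).

(** The derivative of a section of [H] can be read off from the derivatives of a
    frame, by the Leibniz rule. *)
Lemma nabla_frame_sub r r' b (B : set S) (f : sections V r) (g : sections V r')
    (H H' : subspaces V) : open B -> B s -> smooth_sections B f ->
  is_frame B f H -> (H s <= H' s)%MS -> (nabla b i j f s <= H' s)%MS ->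
  smooth_sections A g -> (forall t, A t -> (g t <= H t)%MS) ->
  (nabla b i j g s <= H' s)%MS.
Proof.
move=> oB Bs fs ff HH' fH' gs gH.
pose a := fr_at E s; have as_ : fdom a s by exact: fdom_fr_at.
have oBa : open (B `&` fdom a) by apply: openI => //; exact: open_fdom.
have frs : row_free (loc a f s).
  rewrite /loc /row_free (mxrankMfree _ (coframe_free as_)).
  by have [] := ff s Bs.
have [B1 [X [oB1 B1s B1B Xs XE]]] := smooth_right_inverse oBa (conj Bs as_) (fs a) frs.
have oAB : open (A `&` B1) by exact: openI.
pose Y t := loc a g t *m X t.
have Ys : smooth_mx (A `&` B1) Y.
  apply: smooth_mxM => //; last by apply: smooth_mx_sub Xs => t [].
  by apply: smooth_mx_sub (gs a) => t [At /B1B[_ at_]].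
have gE t : (A `&` B1) t -> g t = Y t *m f t.
  move=> [At B1t]; have [Bt at_] := B1B t B1t; have [_ fH] := ff t Bt.
  have /submxP[Z ZE] : (g t <= f t)%MS by rewrite fH; exact: gH.
  suff -> : Y t = Z by [].
  by rewrite /Y /loc ZE -(mulmxA Z) -(mulmxA Z) -/(loc a f t) XE// mulmx1.
rewrite (@nabla_near _ _ _ _ _ _ _ _ _ (fun t => Y t *m f t))//; last first.
  by apply: filterS (open_nbhs_nbhs (conj oAB (conj As B1s))) => t; exact: gE.
have fs' : smooth_sections (A `&` B1) f.
  by apply: smooth_sections_sub fs => t [_ /B1B[]].
rewrite (nablaM oAB (conj As B1s) is_ b j Ys fs').
apply: addmx_sub; last exact: submx_trans (submxMl _ _) fH'.
apply: submx_trans (submxMl _ _) _; have [_ ->] := ff s Bs; exact: HH'.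
Qed.

Lemma nabla_F p r (g : sections V r) : smooth_sections A g ->
  (forall t, A t -> (g t <= Ft t p)%MS) ->
  (nabla false i j g s <= Ft s p)%MS /\ (nabla true i j g s <= Ft s (p - 1))%MS.
Proof.
move=> gs gF.
have [B [q [f [oB Bs fs ff f0]]]] := holo_subbundle_frame s (F_holo V p).
split.
  apply: (@nabla_frame_sub _ _ false B f g (vF V p) (vF V p)) => //.
  by rewrite f0// sub0mx.
apply: (@nabla_frame_sub _ _ true B f g (vF V p) (vF V (p - 1))) => //.
  by apply: (F_le (Ff s)); lia.
apply/row_subP => k; rewrite -nabla_row -nabla10E.
apply: (F_griffiths oB) => //.
  split.
    move=> a l; apply: smooth_fun_ext (fs a k l).
      by apply: openI => //; exact: open_fdom.
    by move=> t _; rewrite /loc -row_mul [RHS]mxE.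
  move=> i' j' t Bt i't; rewrite nabla01E nabla_row f0//.
  by rewrite row0.
by move=> t Bt; have [_ <-] := ff t Bt; exact: row_sub.
Qed.

(** The connection commutes with conjugation, which exchanges the two kinds of
    coordinates. *)
Lemma nabla_cF p r (g : sections V r) : smooth_sections A g ->
  (forall t, A t -> (g t <= conj_mx (Ft t p))%MS) ->
  (nabla true i j g s <= conj_mx (Ft s p))%MS /\
  (nabla false i j g s <= conj_mx (Ft s (p - 1)))%MS.
Proof.
move=> gs gF; have cgs := smooth_sectionsJ oA gs.
have cgF t : A t -> (conj_mx (g t) <= Ft t p)%MS.
  by move=> At; rewrite conj_mx_subl; exact: gF.
have [c1 c2] := nabla_F cgs cgF.
move: c1 c2; rewrite (nablaJ As is_ false j gs) (nablaJ As is_ true j gs).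
by rewrite !conj_mx_subl.
Qed.

(** In a flat frame [W_k] is constant, hence is the kernel of a constant matrix. *)
Lemma nabla_W k b r (g : sections V r) : smooth_sections A g ->
  (forall t, A t -> (g t <= cWt k t)%MS) -> (nabla b i j g s <= cWt k s)%MS.
Proof.
move=> gs gW; pose a := fr_at E s; have as_ : fdom a s by exact: fdom_fr_at.
pose K := cokermx (cWt k s *m coframe a s).
have oAa : open (A `&` fdom a) by apply: openI => //; exact: open_fdom.
rewrite -(submxMfree _ _ (coframe_free as_)).
have -> : nabla b i j g s *m coframe a s = dmx b i j (loc a g) s.
  exact: (loc_nabla oA As is_ b j gs as_).
rewrite submxE -/K -(dmxMr oAa (conj As as_) is_ b j K (gs a)).
rewrite (@dmx_near _ _ _ _ _ _ _ _ _ (fun=> 0))// ?dmx_cst//.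
have nA : \forall t \near s, A t by exact: open_nbhs_nbhs.
have nW := near_cW k as_.
apply: filterS3 nA (near_fdom as_) nW => t At at_ WE.
by apply/eqP; rewrite -submxE /loc -WE submxMfree ?coframe_free//; exact: gW.
Qed.

End Horizontality.

(** By [nabla_frame_sub] it is enough to differentiate the rows of [oppF_frame],
    which lie in a flat [W_l] and in the conjugate of some [F^r]. *)
Lemma nabla_oppF A i s j p k1 r (g : sections V r) : open A -> A s -> cdom i s ->
  (\forall t \near s, top_weight k1 t) ->
  smooth_sections A g -> (forall t, A t -> (g t <= oppFt p k1 t)%MS) ->
  (nabla true i j g s <= oppFt p k1 s)%MS /\
  (nabla false i j g s <= oppFt (p + 1) k1 s)%MS.
Proof.
move=> oA As is_ nW1 gs gG; have W1 := nbhs_singleton nW1.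
have [B [q [f [oB Bs fs ff frow]]]] := oppF_frame p nW1.
have frowP (k : 'I_q) :
    (nabla true i j (fun t => row k (f t) : 'M[C]_(1, brk E t)) s
       <= oppFt p k1 s)%MS /\
    (nabla false i j (fun t => row k (f t) : 'M[C]_(1, brk E t)) s
       <= oppFt (p + 1) k1 s)%MS.
  have [l fl] := frow k.
  pose f1 : sections V 1 := fun t => row k (f t).
  have f1s : smooth_sections B f1.
    move=> a k' l'; apply: smooth_fun_ext (fs a k l').
      by apply: openI => //; exact: open_fdom.
    by move=> t _; rewrite /loc -row_mul [RHS]mxE.
  have f1F t : B t -> (f1 t <= conj_mx (Ft t (l - p)))%MS.
    by move=> /fl /submx_trans; apply; exact: capmxSl.
  have f1W t : B t -> (f1 t <= cWt l t)%MS.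
    by move=> /fl /submx_trans; apply; exact: capmxSr.
  have [c1 c2] := nabla_cF j oB Bs is_ f1s f1F.
  have w b := nabla_W j oB Bs is_ b f1s f1W.
  split.
    apply: submx_trans (oppF_gen (Wf s) (Ff s) p l W1).
    by rewrite sub_capmx; apply/andP; split; [exact: c1|exact: w].
  apply: submx_trans (oppF_gen (Wf s) (Ff s) (p + 1) l W1).
  rewrite sub_capmx; apply/andP; split; last exact: w.
  by rewrite (_ : l - (p + 1) = l - p - 1); [exact: c2|lia].
split.
  apply: (@nabla_frame_sub A i s j oA As is_ _ _ true B f g (fun t => oppFt p k1 t)
    (fun t => oppFt p k1 t)) => //.
  by apply/row_subP => k; rewrite -nabla_row; have [] := frowP k.
apply: (@nabla_frame_sub A i s j oA As is_ _ _ false B f g (fun t => oppFt p k1 t)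
    (fun t => oppFt (p + 1) k1 t)) => //.
  by apply: (oppF_le (Wf s) (Ff s)) => //; lia.
by apply/row_subP => k; rewrite -nabla_row; have [] := frowP k.
Qed.

End OppositeFiltration.

(** * Smoothness of the projections and type of the connection *)

Section Projections.
Context {R : realType} {n : nat} {S : complex_manifold R n}.
Variable V : vmhs S.
Local Notation C := R[i].
Local Notation E := (complexify V).
Implicit Types (A B : set S) (s t : S) (a : fr_idx E) (p q : int).

Local Notation Wt := (Wt V).
Local Notation Ft := (Ft V).
Local Notation oppFt p k s := (@oppF R _ (Wt s) (Ft s) p k : 'M[C]_(brk E s)).
Local Notation P := (Uproj V).

Let Wf s : increasing_filtration (Wt s) := W_filtration V s.
Let Ff s : decreasing_filtration (Ft s) := F_filtration V s.
Let pure s : forall k, pure_on_gr (Wt s) (Ft s) k := fun k => gr_pure V k s.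

Lemma Uproj_F p r s (M : 'M[C]_(r, brk E s)) : (M *m P p s <= Ft s p)%MS.
Proof. exact: (deligne_proj_F (Wf s) (Ff s) (@pure s)). Qed.

Lemma Uproj_F0 p q r s (M : 'M[C]_(r, brk E s)) :
  (M <= Ft s p)%MS -> q < p -> M *m P q s = 0.
Proof.
have [k1 W1] := near_top_weight V s; have W1s := nbhs_singleton W1.
exact: (deligne_proj_F0 (Wf s) (Ff s) (@pure s) W1s).
Qed.

Lemma Uproj_oppF p k1 r s (M : 'M[C]_(r, brk E s)) : top_weight V k1 s ->
  (M *m P p s <= oppFt p k1 s)%MS.
Proof. by move=> W1; exact: (deligne_proj_oppF (Wf s) (Ff s) (@pure s) W1). Qed.

Lemma Uproj_oppF0 p q k1 r s (M : 'M[C]_(r, brk E s)) : top_weight V k1 s ->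
  (M <= oppFt p k1 s)%MS -> p < q -> M *m P q s = 0.
Proof. by move=> W1; exact: (deligne_proj_oppF0 (Wf s) (Ff s) (@pure s) W1). Qed.

Lemma near_Uproj s : exists e : seq int, uniq e /\
  \forall t \near s, (forall p, p \notin e -> P p t = 0) /\
                     \sum_(p <- e) P p t = 1%:M.
Proof.
have [p0 [p1 [p01 nF]]] := near_F_range V s.
have [k1 nW] := near_top_weight V s.
exists (int_range p0 p1); split; first exact: int_range_uniq.
apply: filterS2 nW nF => t W1 [F0 F1]; split.
  by move=> p; exact: (deligne_proj_range (Wf t) (Ff t) (@pure t) W1 p01 F0 F1).
exact: (deligne_proj_sum (Wf t) (Ff t) (@pure t) W1 p01 F0 F1).
Qed.

Lemma UprojM_neq p q s : p != q -> P p s *m P q s = 0.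
Proof.
move=> pq; have [k1 nW] := near_top_weight V s; have W1 := nbhs_singleton nW.
rewrite -[P p s]mul1mx; have [qp|pq'] := ltP q p.
  exact: (Uproj_F0 (Uproj_F p _) qp).
by apply: (Uproj_oppF0 W1 (Uproj_oppF p _ W1)); rewrite lt_neqAle pq.
Qed.

Lemma UprojMM p s : P p s *m P p s = P p s.
Proof.
have [e [ue ne]] := near_Uproj s; have [e0 e1] := nbhs_singleton ne.
have [pe|pe] := boolP (p \in e); last by rewrite (e0 p pe) mul0mx.
rewrite -[RHS]mulmx1 -e1 mulmx_sumr (bigD1_seq p)//= big1 ?addr0// => q qp.
by apply: UprojM_neq; rewrite eq_sym.
Qed.

Lemma UprojM p q s : P p s *m P q s = if p == q then P p s else 0.
Proof. by case: eqVneq => [->|/UprojM_neq]; first exact: UprojMM. Qed.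

Lemma Uproj_ext r s (u v : 'M[C]_(r, brk E s)) :
  (forall q, u *m P q s = v *m P q s) -> u = v.
Proof.
move=> uv; have [e [ue ne]] := near_Uproj s; have [e0 e1] := nbhs_singleton ne.
rewrite -[u]mulmx1 -[v]mulmx1 -e1 !mulmx_sumr.
by apply: eq_bigr => q _; exact: uv.
Qed.

(** With [M] the projection onto [F^p] along the opposite filtration and [M'] the
    one onto [F^(p+1)]: subtracting the part in [F^(p+1)] from [M] leaves the
    projection onto [U^p]. *)
Lemma Uproj_diff p k1 s (M M' : 'M[C]_(brk E s)) : top_weight V k1 s ->
  (M <= Ft s p)%MS -> (1%:M - M <= oppFt (p - 1) k1 s)%MS ->
  (M' <= Ft s (p + 1))%MS -> (1%:M - M' <= oppFt p k1 s)%MS ->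
  P p s = M *m (1%:M - M').
Proof.
move=> W1 MF MG M'F M'G; have F1 : (Ft s (p + 1) <= Ft s p)%MS.
  by apply: (F_le (Ff s)); lia.
set Q := M *m (1%:M - M').
have QE : Q = M - M *m M' by rewrite /Q mulmxBr mulmx1.
have MM'F : (M *m M' <= Ft s (p + 1))%MS by apply: submx_trans (submxMl _ _) M'F.
have QF : (Q <= Ft s p)%MS.
  by rewrite QE; apply: sub_sub => //; exact: submx_trans MM'F F1.
have QG : (Q <= oppFt p k1 s)%MS by apply: submx_trans (submxMl _ _) M'G.
have QP : Q *m P p s = Q.
  apply: Uproj_ext => q; rewrite -mulmxA UprojM; case: eqVneq => [->//|pq].
  rewrite mulmx0; have [qp|pq'] := ltP q p; first by rewrite (Uproj_F0 QF qp).
  by rewrite (Uproj_oppF0 W1 QG)// lt_neqAle pq.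
rewrite -[LHS]mul1mx -QP; apply/eqP; rewrite -subr_eq0 -mulmxBl.
have -> : 1%:M - Q = (1%:M - M) + M *m M' by rewrite QE opprB addrCA addrC.
have z1 : (1%:M - M) *m P p s = 0 by apply: (Uproj_oppF0 W1 MG); lia.
have z2 : M *m M' *m P p s = 0 by apply: (Uproj_F0 MM'F); lia.
by rewrite mulmxDl z1 z2 addr0.
Qed.

(** Stack frames of [F^p] and of the opposite filtration into an invertible
    matrix; the projection is read off from its inverse. *)
Lemma smooth_F_projection p k1 a s0 : (\forall t \near s0, top_weight V k1 t) ->
  fdom a s0 -> exists B (M : S -> 'M[C]_(frk a)), [/\ open B, B s0,
    B `<=` fdom a, smooth_mx B M &
    forall t, B t -> let M' := coframe a t *m M t *m frame a t in
      (M' <= Ft t p)%MS /\ (1%:M - M' <= oppFt (p - 1) k1 t)%MS].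
Proof.
move=> nW as0; have W1s := nbhs_singleton nW.
have [A1 [r [f [oA1 A1s0 fs ff _]]]] := holo_subbundle_frame s0 (F_holo V p).
have [A2 [r' [g [oA2 A2s0 gs gf _]]]] := oppF_frame (p - 1) nW.
pose A := A1 `&` A2 `&` fdom a.
have oA : open A by apply: openI; [exact: openI|exact: open_fdom].
pose N t := col_mx (loc a f t) (loc a g t).
have Ns : smooth_mx A N.
  apply: smooth_mx_col.
    by apply: smooth_mx_sub (fs a) => t [[]].
  by apply: smooth_mx_sub (gs a) => t [[]].
have rkN t : A t -> top_weight V k1 t -> (\rank (N t) = r + r')%N /\ (r + r' = frk a)%N.
  move=> [[A1t A2t] at_] W1; have [ffr fF] := ff t A1t; have [gfr gG] := gf t A2t.
  have cap0 : (f t :&: g t)%MS = 0.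
    apply: cap0_elim => v; rewrite fF gG => vF vG.
    exact: (F_oppF_cap (Wf t) (Ff t) (@pure t) vF vG).
  split.
    rewrite /N -addsmxE /loc -addsmxMr.
    rewrite (mxrankMfree _ (coframe_free at_)).
    by rewrite -[LHS]addn0 -{1}(@mxrank0 C (brk E t) (brk E t)) -cap0 mxrank_sum_cap (eqP ffr) (eqP gfr).
  have := rank_oppF (p - 1) W1; rewrite subrK -fF -gG (eqP ffr) (eqP gfr) => ->.
  exact: esym (frk_brk at_).
have As0 : A s0 by [].
have free0 : row_free (N s0) by rewrite /row_free (rkN s0 As0 W1s).1.
have [B1 [X [oB1 B1s0 B1A Xs XE]]] := smooth_right_inverse oA As0 Ns free0.
have [B2 [oB2 B2s0 B2W]] := near_open nW.
have XNE t : B1 t -> B2 t -> X t *m N t = 1%:M.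
  move=> B1t B2t; have [rN rr] := rkN t (B1A t B1t) (B2W t B2t).
  have /submxP[Z ZE] : (1%:M <= N t)%MS by rewrite sub1mx /row_full rN rr.
  by rewrite -[X t]mul1mx ZE -(mulmxA Z) XE// mulmx1 -ZE.
have oB := openI oB1 oB2.
have lXs : smooth_mx (B1 `&` B2) (fun t => lsubmx (X t)).
  move=> k l; apply: (@smooth_fun_ext _ _ _ _ (fun t => X t k (lshift _ l))) => //.
    by move=> t _; rewrite mxE.
  by apply: smooth_fun_sub (Xs _ _) => t [].
have fs' : smooth_mx (B1 `&` B2) (loc a f).
  by apply: smooth_mx_sub (fs a) => t [/B1A[[]]].
exists (B1 `&` B2), (fun t => lsubmx (X t) *m loc a f t).
split; [exact: oB|by []|by move=> t [/B1A[]]|exact: smooth_mxM|].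
move=> t [B1t B2t] M'; have [[A1t A2t] at_] := B1A t B1t.
have [_ fF] := ff t A1t; have [_ gG] := gf t A2t.
have locfr u v w (Y : 'M[C]_(u, w)) (h : sections V w) (Z : 'M[C]_(v, u)) :
    Z *m Y *m loc a h t *m frame a t = Z *m Y *m h t.
  by rewrite -[LHS]mulmxA (locK _ at_).
have M'E : M' = coframe a t *m lsubmx (X t) *m f t.
  by rewrite /M' mulmxA locfr.
have M''E : 1%:M - M' = coframe a t *m rsubmx (X t) *m g t.
  have XN : lsubmx (X t) *m loc a f t + rsubmx (X t) *m loc a g t = 1%:M.
    by rewrite -mul_row_col hsubmxK XNE.
  rewrite /M' -(coframeK at_) -{1}(mulmx1 (coframe a t)) -XN.
  by rewrite mulmxDr mulmxDl [X in X - _]addrC addrK mulmxA locfr.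
by rewrite M''E M'E -fF -gG !submxMl.
Qed.

Lemma Uproj_smooth p : @smooth_hom _ _ _ E E setT (P p).
Proof.
move=> a b k l; apply: smooth_fun_local => s0 [_ [as0 bs0]].
have [k1 nW] := near_top_weight V s0.
have [B [M [oB Bs0 Ba Ms MP]]] := smooth_F_projection p nW as0.
have [B' [M' [oB' B's0 B'a M's M'P]]] := smooth_F_projection (p + 1) nW as0.
have [B3 [oB3 B3s0 B3P]] := near_open nW.
have [B4 [oB4 B4s0 B4P]] := near_open (near_transition as0 bs0).
pose D := (B `&` B') `&` (B3 `&` B4).
have oD : open D by apply: openI; exact: openI.
have PE t : D t -> frame a t *m P p t *m coframe b t =
    M t *m (1%:M - M' t) *m (frame a s0 *m coframe b s0).
  move=> [[Bt B't] [/B3P W1t /B4P trt]]; have at_ := Ba t Bt.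
  have [MF MG] := MP t Bt; have [M'F] := M'P t B't; rewrite addrK => M'G.
  have e1 : frame a t *m (coframe a t *m M t *m frame a t) = M t *m frame a t.
    by rewrite !mulmxA (frameK at_) mul1mx.
  have e2 : frame a t *m (coframe a t *m M' t *m frame a t) = M' t *m frame a t.
    by rewrite !mulmxA (frameK at_) mul1mx.
  rewrite (Uproj_diff W1t MF MG M'F M'G) -trt mulmxA e1 -(mulmxA (M t) (frame a t)).
  rewrite (mulmxBr (frame a t)) mulmx1 e2 -{1}(mul1mx (frame a t)) -mulmxBl.
  by rewrite !mulmxA.
exists D; split; [exact: oD|by []|].
have Ps : smooth_mx D (fun t => M t *m (1%:M - M' t) *m (frame a s0 *m coframe b s0)).
  apply: (smooth_mxM oD); last exact: smooth_mx_cst.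
  apply: (smooth_mxM oD); first by apply: smooth_mx_sub Ms => t [[]].
  apply: (smooth_mxD oD (smooth_mx_cst _ _)); apply: (smooth_mxN oD).
  by apply: smooth_mx_sub M's => t [[]].
by apply: smooth_fun_ext (Ps k l) => // t Dt; rewrite PE.
Qed.

Lemma smooth_hom_setT A (M : forall s, 'M[C]_(brk E s, brk E s)) :
  @smooth_hom _ _ _ E E setT M -> @smooth_hom _ _ _ E E A M.
Proof.
by move=> Ms a b k l; apply: smooth_fun_sub (Ms a b k l) => t [_ ].
Qed.

Lemma smooth_Uproj r A (g : sections V r) p : open A -> smooth_sections A g ->
  smooth_sections A (fun t => g t *m P p t).
Proof.
by move=> oA gs; apply: smooth_sections_hom => //; apply: smooth_hom_setT; exact: Uproj_smooth.
Qed.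

Definition deg (b : bool) : int := if b then -1 else 1.

(** The type of the connection: since [U^p] is the intersection of [F^p] with the
    opposite filtration, the bounds on the derivatives along both filtrations
    leave two components. *)
Lemma nabla_Uproj r b i j A s (g : sections V r) p q :
  open A -> A s -> cdom i s -> smooth_sections A g -> q != p -> q != p + deg b ->
  nabla b i j (fun t => g t *m P p t) s *m P q s = 0.
Proof.
move=> oA As is_ gs qp qpb; have gPs := smooth_Uproj p oA gs.
have [k1 nW] := near_top_weight V s; have W1 := nbhs_singleton nW.
have [B [oB Bs BW]] := near_open nW.
have oAB : open (A `&` B) by exact: openI.
have [nF1 nF2] := nabla_F j oA As is_ gPs (fun t _ => Uproj_F p (g t)).
have gPs' : smooth_sections (A `&` B) (fun t => g t *m P p t).
  by apply: smooth_sections_sub gPs => t [].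
have [nG1 nG2] := nabla_oppF j oAB (conj As Bs) is_ nW gPs'
  (fun t ABt => Uproj_oppF p (g t) (BW t ABt.2)).
move: qpb; rewrite /deg; case: b => qpb.
  have [qp1|pq1] := ltP q (p - 1); first exact: (Uproj_F0 nF2 qp1).
  by apply: (Uproj_oppF0 W1 nG1); lia.
have [qp1|pq1] := ltP q p; first exact: (Uproj_F0 nF1 qp1).
by apply: (Uproj_oppF0 W1 nG2); lia.
Qed.

End Projections.

(** * The components of the connection *)

Section Components.
Context {R : realType} {n : nat} {S : complex_manifold R n}.
Variable V : vmhs S.
Local Notation C := R[i].
Local Notation E := (complexify V).
Implicit Types (A B : set S) (s t : S) (i : chart_idx S) (j : 'I_n) (p q d : int).

Local Notation P := (Uproj V).

Lemma nabla_eq r b i j (g h : sections V r) s : (forall t, g t = h t) ->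
  nabla b i j g s = nabla b i j h s.
Proof.
move=> gh; rewrite !nablaE.
have -> // : loc (fr_at E s) g = loc (fr_at E s) h.
by apply/funext => t; rewrite /loc gh.
Qed.

Fact gm_comp_key : unit. Proof. exact: tt. Qed.
(** The operator [component d], for both kinds of coordinates at once and on
    matrices of sections, so that it can be applied to frames. *)
Definition gm_comp : forall r, int -> bool -> forall i, 'I_n -> sections V r ->
    forall s, 'M[C]_(r, brk E s) :=
  locked_with gm_comp_key (fun r d b i j g s =>
    \sum_(p \in [set: int]) nabla b i j (fun t => g t *m P p t) s *m P (p + d) s).

Lemma gm_compE r d b i j (g : sections V r) s : gm_comp d b i j g s =
  \sum_(p \in [set: int]) nabla b i j (fun t => g t *m P p t) s *m P (p + d) s.
Proof. by rewrite /gm_comp unlock. Qed.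

Lemma gm_dbarE i j (sigma : section E) s :
  gm_dbar V i j sigma s = gm_comp 0 false i j (sigma : sections V 1) s.
Proof. by rewrite gm_compE; apply: eq_fsbigr => p _; rewrite nabla01E. Qed.

Lemma gm_thetaE i j (sigma : section E) s :
  gm_theta V i j sigma s = gm_comp (- 1) true i j (sigma : sections V 1) s.
Proof. by rewrite gm_compE; apply: eq_fsbigr => p _; rewrite nabla10E. Qed.

Lemma near_gm_comp s : exists e : seq int, \forall t \near s,
  forall i r d b j (g : sections V r), cdom i t ->
  gm_comp d b i j g t =
    \sum_(p <- e) nabla b i j (fun t => g t *m P p t) t *m P (p + d) t.
Proof.
have [e [ue ne]] := near_Uproj V s; exists e.
have [B [oB Bs BP]] := near_open ne.
apply: filterS (open_nbhs_nbhs (conj oB Bs)) => t Bt i r d b j g it.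
rewrite gm_compE (fsum_seq _ ue)// => p pe.
rewrite (@nabla_near _ _ _ _ _ _ _ _ _ (fun t => 0))//; last first.
  apply: filterS (open_nbhs_nbhs (conj oB Bt)) => u /BP[e0 _].
  by rewrite (e0 p pe) mulmx0.
by rewrite nabla0 mul0mx.
Qed.

Lemma gm_comp_local A r d b i j (g h : sections V r) s : open A ->
  (forall t, A t -> g t = h t) -> A s -> cdom i s ->
  gm_comp d b i j g s = gm_comp d b i j h s.
Proof.
move=> oA gh As is_; rewrite !gm_compE; apply: eq_fsbigr => p _.
rewrite (@nabla_near _ _ _ _ _ _ _ _ _ (fun t => h t *m P p t))//.
by apply: filterS (open_nbhs_nbhs (conj oA As)) => t At; rewrite gh.
Qed.

Section AtPoint.
Variables (A : set S) (i : chart_idx S) (s : S).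
Hypotheses (oA : open A) (As : A s) (is_ : cdom i s).

(** This removes the sum over the grading: a component is computed one target
    degree at a time. *)
Lemma gm_comp_Uproj r d b j (g : sections V r) q :
  gm_comp d b i j g s *m P q s = nabla b i j (fun t => g t *m P (q - d) t) s *m P q s.
Proof.
have [e [ue ne]] := near_Uproj V s.
have term p : nabla b i j (fun t => g t *m P p t) s *m P (p + d) s *m P q s =
    if p == q - d then nabla b i j (fun t => g t *m P (q - d) t) s *m P q s else 0.
  rewrite -mulmxA UprojM; have [->|pq] := eqVneq p (q - d).
    by rewrite subrK eqxx.
  by rewrite (negbTE (_ : p + d != q)) ?mulmx0//; apply: contra pq => /eqP <-; rewrite addrK.
have zero p : p \notin e -> nabla b i j (fun t => g t *m P p t) s = 0.
  move=> pe; rewrite (@nabla_near _ _ _ _ _ _ _ _ _ (fun t => 0))//; first exact: nabla0.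
  by apply: filterS ne => u [e0 _]; rewrite (e0 p pe) mulmx0.
have -> : gm_comp d b i j g s =
    \sum_(p <- e) nabla b i j (fun t => g t *m P p t) s *m P (p + d) s.
  by rewrite gm_compE (fsum_seq _ ue)// => p pe; rewrite zero// mul0mx.
rewrite mulmx_suml; under eq_bigr do rewrite term.
rewrite -big_mkcond/=; have [qe|qe] := boolP (q - d \in e).
  by rewrite -big_filter filter_pred1_uniq// big_seq1.
by rewrite big_seq_cond big1 ?zero ?mul0mx// => p /andP[pe /eqP pq].
Qed.

Lemma gm_comp_ext r d b j (g : sections V r) (u : 'M[C]_(r, brk E s)) :
  (forall q, nabla b i j (fun t => g t *m P (q - d) t) s *m P q s = u *m P q s) ->
  gm_comp d b i j g s = u.
Proof. by move=> gu; apply: Uproj_ext => q; rewrite (gm_comp_Uproj d b j g q) gu. Qed.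

Lemma gm_compD r d b j (g h : sections V r) :
  smooth_sections A g -> smooth_sections A h ->
  gm_comp d b i j (fun t => g t + h t) s = gm_comp d b i j g s + gm_comp d b i j h s.
Proof.
move=> gs hs; apply: gm_comp_ext => q.
rewrite mulmxDl (gm_comp_Uproj d b j g q) (gm_comp_Uproj d b j h q).
rewrite (@nabla_eq _ _ _ _ _ (fun t => g t *m P (q - d) t + h t *m P (q - d) t));
  last by move=> t; rewrite mulmxDl.
have gPs := smooth_Uproj (q - d) oA gs; have hPs := smooth_Uproj (q - d) oA hs.
by rewrite (nablaD As is_ b j gPs hPs) mulmxDl.
Qed.

(** The derivative of the coefficients is of degree 0: the components of other
    degrees are linear over functions. *)
Lemma gm_compM r r' d b j (Y : S -> 'M[C]_(r', r)) (g : sections V r) :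
  smooth_mx A Y -> smooth_sections A g ->
  gm_comp d b i j (fun t => Y t *m g t) s =
  (if d == 0 then dmx b i j Y s *m g s else 0) + Y s *m gm_comp d b i j g s.
Proof.
move=> Ys gs; apply: gm_comp_ext => q; rewrite mulmxDl -[in RHS]mulmxA (gm_comp_Uproj d b j g q).
rewrite (@nabla_eq _ _ _ _ _ (fun t => Y t *m (g t *m P (q - d) t)));
  last by move=> t; rewrite mulmxA.
rewrite (nablaM oA As is_ b j Ys (smooth_Uproj (q - d) oA gs)) mulmxDl.
suff -> : dmx b i j Y s *m (g s *m P (q - d) s) *m P q s =
    (if d == 0 then dmx b i j Y s *m g s else 0) *m P q s.
  by rewrite -!(mulmxA (Y s)).
rewrite -(mulmxA (dmx b i j Y s)) -(mulmxA (g s)) UprojM.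
have [->|d0] := eqVneq d 0; first by rewrite subr0 eqxx mulmxA.
rewrite (negbTE (_ : q - d != q)) ?mulmx0 ?mul0mx//.
by rewrite -subr_eq0 addrC addKr oppr_eq0.
Qed.

End AtPoint.

Lemma gm_comp_chart A i s r d b j i' (g : sections V r) : open A -> A s ->
  cdom i s -> cdom i' s -> smooth_sections A g ->
  gm_comp d b i j g s = \sum_(k < n) der b i j (fun t => zcoordb b k (chart i' t)) s
                                  *: gm_comp d b i' k g s.
Proof.
move=> oA As is_ i's gs; apply: (gm_comp_ext is_) => q.
rewrite (nabla_chart oA As is_ b j i's (smooth_Uproj (q - d) oA gs)) !mulmx_suml.
by apply: eq_bigr => k _; rewrite -!scalemxAl (gm_comp_Uproj i's d b k g q).
Qed.

Lemma smooth_gm_comp A r d b i j (g : sections V r) : open A -> smooth_sections A g ->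
  smooth_sections (A `&` cdom i) (gm_comp d b i j g).
Proof.
move=> oA gs; apply: smooth_sections_local => s [As is_].
have [e ne] := near_gm_comp s; have [B [oB Bs BP]] := near_open ne.
have oAi : open (A `&` cdom i) by apply: openI => //; exact: open_cdom.
have oD : open ((A `&` cdom i) `&` B) by exact: openI.
exists ((A `&` cdom i) `&` B); split; [exact: oD|by []|].
pose h t : 'M[C]_(r, brk E t) :=
  \sum_(p <- e) nabla b i j (fun t => g t *m P p t) t *m P (p + d) t.
apply: (@smooth_sections_ext _ _ _ _ _ _ h) => //.
  by move=> t [[At it] Bt]; rewrite (BP t Bt).
apply: smooth_sections_sub (_ : smooth_sections (A `&` cdom i) h) => [t []//|].
apply: smooth_sections_sum => // p; apply: smooth_Uproj => //.
by apply: smooth_nabla => //; exact: smooth_Uproj.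
Qed.

End Components.

(** * The Dolbeault operator and the Higgs field *)

Section HiggsBundle.
Context {R : realType} {n : nat} {S : complex_manifold R n}.
Variable V : vmhs S.
Local Notation C := R[i].
Local Notation E := (complexify V).
Implicit Types (A B : set S) (s t : S) (i : chart_idx S) (j k : 'I_n) (p q d : int).

Local Notation P := (Uproj V).

Let open_cd A i : open A -> open (A `&` cdom i).
Proof. by move=> oA; apply: openI => //; exact: open_cdom. Qed.

Lemma gm_comp_scale A i s r d b j (f : S -> C) (g : sections V r) :
  open A -> A s -> cdom i s -> smooth_fun A f -> smooth_sections A g ->
  gm_comp d b i j (fun t => f t *: g t) s =
  (if d == 0 then der b i j f s *: g s else 0) + f s *: gm_comp d b i j g s.
Proof.
move=> oA As is_ fs gs.
have Ys : smooth_mx A (fun t => (f t)%:M : 'M[C]_r).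
  move=> k l; have [->|kl] := eqVneq k l.
    by apply: smooth_fun_ext fs => // t _; rewrite mxE eqxx.
  by apply: smooth_fun_ext (smooth_fun_cst A 0) => // t _; rewrite mxE (negbTE kl).
have dY : dmx b i j (fun t => (f t)%:M : 'M[C]_r) s = (der b i j f s)%:M.
  apply/matrixP => k l; rewrite dmxE mxE; have [->|kl] := eqVneq k l.
    by have -> // : (fun t => ((f t)%:M : 'M[C]_r) l l) = f by apply/funext => t; rewrite mxE eqxx.
  have -> : (fun t => ((f t)%:M : 'M[C]_r) k l) = (fun=> 0).
    by apply/funext => t; rewrite mxE (negbTE kl).
  exact: der_cst.
rewrite (@gm_comp_local _ _ _ _ A _ _ _ _ _ _ (fun t => (f t)%:M *m g t))//; last first.
  by move=> t _; rewrite mul_scalar_mx.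
rewrite (gm_compM oA As is_ d b j Ys gs) mul_scalar_mx; congr (_ + _).
by rewrite dY mul_scalar_mx.
Qed.

Lemma smooth_sectionE A (sigma : section E) : smooth_section A sigma ->
  smooth_sections (L := V) (r := 1) A sigma.
Proof. by move/smooth_sections1. Qed.

Lemma gm_dbar_dolbeault : dolbeault_operator (gm_dbar V).
Proof.
split.
- move=> A sigma tau oA st i j s As is_; rewrite !gm_dbarE.
  exact: (@gm_comp_local _ _ _ _ A 1).
- move=> A sigma oA ss i j; apply/smooth_sections1.
  apply: (@smooth_sections_ext _ _ _ _ _ _ (gm_comp 0 false i j (sigma : sections V 1))).
  + exact: open_cd.
  + by move=> s _; rewrite gm_dbarE.
  + by apply: smooth_gm_comp => //; exact: smooth_sectionE.
- move=> A sigma tau oA ss ts i j s As is_; rewrite !gm_dbarE.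
  by apply: (@gm_compD _ _ _ _ A _ _ oA As is_); exact: smooth_sectionE.
- move=> A f sigma oA fs ss i j s As is_; rewrite !gm_dbarE mdzbar_der.
  by rewrite (gm_comp_scale _ _ _ oA As is_ fs (smooth_sectionE ss)).
- move=> A sigma oA ss i i' j s As is_ i's; rewrite gm_dbarE.
  rewrite (gm_comp_chart _ _ _ oA As is_ i's (smooth_sectionE ss)).
  by apply: eq_bigr => k _; rewrite gm_dbarE mdzbar_der.
Qed.

Lemma gm_smooth_bundle : smooth_bundle E.
Proof.
move=> a b k l; apply: smooth_fun_local => s [as_ bs].
have [B [oB Bs BP]] := near_open (near_transition as_ bs).
exists B; split => //.
apply: smooth_fun_ext (smooth_fun_cst B ((frame a s *m coframe b s) k l)) => //.
by move=> t Bt; rewrite /transition (BP t Bt).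
Qed.

Definition Theta i j s : 'M[C]_(brk E s) :=
  coframe (fr_at E s) s *m
  gm_comp (- 1) true i j (fun t => frame (fr_at E s) t : 'M[C]_(frk (fr_at E s), brk E t)) s.

(** A section is a combination of the frame with smooth coefficients, and
    components of degree [-1] are linear over functions. *)
Lemma gm_comp_Theta A i s r j (g : sections V r) :
  open A -> A s -> cdom i s -> smooth_sections A g ->
  gm_comp (- 1) true i j g s = g s *m Theta i j s.
Proof.
move=> oA As is_ gs; rewrite /Theta; set a := fr_at E s.
have as_ : fdom a s by exact: fdom_fr_at.
have oAa : open (A `&` fdom a) by apply: openI => //; exact: open_fdom.
have fs : smooth_sections (A `&` fdom a) (fun t => frame a t : 'M[C]_(frk a, brk E t)).
  by apply: smooth_sections_sub (@smooth_frame _ _ _ V a) => t [].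
rewrite (@gm_comp_local _ _ _ _ (A `&` fdom a) _ _ _ _ _ _ (fun t => loc a g t *m frame a t))//.
  rewrite (gm_compM oAa (conj As as_) is_ _ true j (gs a) fs) add0r.
  by rewrite /loc mulmxA.
by move=> t [_ at_]; rewrite locK.
Qed.

Lemma gm_theta_form : end_form10 (gm_theta V).
Proof.
exists Theta; split.
- move=> i j a b k l.
  have fs := @smooth_frame _ _ _ V a.
  have Fs := smooth_gm_comp (- 1) true i j (open_fdom a) fs.
  apply: smooth_fun_ext (smooth_fun_sub _ (Fs b k l)).
  + by do ?apply: openI; try exact: open_fdom; exact: open_cdom.
  + move=> t [it [at_ bt]]; rewrite /loc.
    by rewrite (gm_comp_Theta j (open_fdom a) at_ it fs).
  + by move=> t [it [at_ bt]].
- move=> i i' j s is_ i's; rewrite /Theta; set a := fr_at E s.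
  have as_ : fdom a s by exact: fdom_fr_at.
  rewrite (gm_comp_chart _ _ _ (open_fdom a) as_ is_ i's (@smooth_frame _ _ _ V a)).
  rewrite mulmx_sumr; apply: eq_bigr => k _.
  by rewrite mdz_der scalemxAr.
- move=> A sigma oA ss i j s As is_; rewrite gm_thetaE.
  exact: (gm_comp_Theta j oA As is_ (smooth_sectionE ss)).
Qed.

End HiggsBundle.

(** * The Higgs equations and holomorphic frames *)

Section HiggsEquations.
Context {R : realType} {n : nat} {S : complex_manifold R n}.
Variable V : vmhs S.
Local Notation C := R[i].
Local Notation E := (complexify V).
Implicit Types (A B : set S) (s t : S) (i : chart_idx S) (j k : 'I_n) (p q d : int).

Local Notation P := (Uproj V).

Section AtPoint.
Variables (A : set S) (i : chart_idx S) (s : S).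
Hypotheses (oA : open A) (As : A s) (is_ : cdom i s).

Let oAi : open (A `&` cdom i).
Proof. by apply: openI => //; exact: open_cdom. Qed.

Lemma Uproj_split r t (N : 'M[C]_(r, brk E t)) u u' : u' != u ->
  (forall v, v != u -> v != u' -> N *m P v t = 0) ->
  N = N *m P u t + N *m P u' t.
Proof.
move=> u'u N0; apply: Uproj_ext => v; apply: esym.
have QP (Q : int -> 'M[C]_(brk E t)) :
    (forall p q, Q p *m Q q = if p == q then Q p else 0) ->
    (forall v, v != u -> v != u' -> N *m Q v = 0) ->
    (N *m Q u + N *m Q u') *m Q v = N *m Q v.
  move=> QM Q0; rewrite mulmxDl -2!mulmxA !QM.
  have [<-|vu] := eqVneq u v; first by rewrite (negbTE u'u) mulmx0 addr0.
  have [<-|vu'] := eqVneq u' v; first by rewrite mulmx0 add0r.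
  by rewrite mulmx0 addr0 Q0// eq_sym.
exact: (QP (fun q => P q t) (fun p q => UprojM V p q t) N0).
Qed.

(** A derivative of a section of [U^p] has two components, in [U^u] and [U^u']. If
    a second derivative of the latter has no component in [U^q], the former can
    be replaced by the whole derivative. *)
Lemma nabla_nabla_Uproj r b b' j k (g : sections V r) p u u' q :
  smooth_sections A g -> u' != u ->
  (forall v, v != u -> v != u' -> v != p /\ v != p + deg b) ->
  q != u' -> q != u' + deg b' ->
  nabla b' i j (fun t => nabla b i k (fun t => g t *m P p t) t *m P u t) s *m P q s =
  nabla b' i j (nabla b i k (fun t => g t *m P p t)) s *m P q s.
Proof.
move=> gs u'u uu' qu' qu'b.
have gPs := smooth_Uproj p oA gs; have ns := smooth_nabla b i k oA gPs.
have nuE t : (A `&` cdom i) t -> nabla b i k (fun t => g t *m P p t) t =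
    nabla b i k (fun t => g t *m P p t) t *m P u t +
    nabla b i k (fun t => g t *m P p t) t *m P u' t.
  move=> [At it]; apply: Uproj_split => // v vu vu'; have [vp vpb] := uu' v vu vu'.
  exact: (nabla_Uproj k oA At it gs vp vpb).
rewrite [in RHS](@nabla_near _ _ _ _ _ _ _ _ _ (fun t =>
    nabla b i k (fun t => g t *m P p t) t *m P u t +
    nabla b i k (fun t => g t *m P p t) t *m P u' t))//; last first.
  by apply: filterS (open_nbhs_nbhs (conj oAi (conj As is_))) => t; exact: nuE.
have us := smooth_Uproj u oAi ns; have u's := smooth_Uproj u' oAi ns.
rewrite (nablaD (conj As is_) is_ b' j us u's).
have z := nabla_Uproj j oAi (conj As is_) is_ ns qu' qu'b.
by apply: esym; apply: etrans (mulmxDl _ _ _) _; apply: etrans (congr1 _ z) (addr0 _).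
Qed.

Lemma gm_comp_comp r d d' b b' j k (g : sections V r) q : smooth_sections A g ->
  gm_comp d' b' i j (gm_comp d b i k g) s *m P q s =
  nabla b' i j (fun t => nabla b i k (fun t => g t *m P (q - d' - d) t) t
                         *m P (q - d') t) s *m P q s.
Proof.
move=> gs; rewrite (gm_comp_Uproj is_ d' b' j _ q); congr (_ *m _).
apply: nabla_near => //.
apply: filterS (open_nbhs_nbhs (conj oAi (conj As is_))) => t [_ it].
exact: (gm_comp_Uproj it).
Qed.

(** Both sides are the component from [U^(q+1)] to [U^q] of a second derivative,
    and second derivatives commute. *)
Lemma gm_dbar_theta_comm r j k (g : sections V r) : smooth_sections A g ->
  gm_comp 0 false i j (gm_comp (- 1) true i k g) s =
  gm_comp (- 1) true i k (gm_comp 0 false i j g) s.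
Proof.
move=> gs; apply: Uproj_ext => q.
rewrite (gm_comp_comp _ _ _ _ _ _ q gs) (gm_comp_comp _ _ _ _ _ _ q gs).
have -> : q - 0 - -1 = q + 1 :> int by lia.
have -> : q - -1 - 0 = q + 1 :> int by lia.
have -> : q - 0 = q :> int by lia.
have -> : q - -1 = q + 1 :> int by lia.
have gPs := smooth_Uproj (q + 1) oA gs.
have L1 := @nabla_nabla_Uproj _ true false j k g (q + 1) q (q + 1) q gs.
have L2 := @nabla_nabla_Uproj _ false true k j g (q + 1) (q + 1) (q + 1 + 1) q gs.
apply: etrans (L1 _ _ _ _) _; try by rewrite /deg; lia.
apply: etrans (esym (L2 _ _ _ _)); try by rewrite /deg; lia.
by rewrite (nabla_sym false j true k oA As is_ gPs).
Qed.

(** The same argument for the component from [U^(q+2)] to [U^q]. *)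
Lemma gm_theta_comm r j k (g : sections V r) : smooth_sections A g ->
  gm_comp (- 1) true i j (gm_comp (- 1) true i k g) s =
  gm_comp (- 1) true i k (gm_comp (- 1) true i j g) s.
Proof.
move=> gs; apply: Uproj_ext => q.
rewrite (gm_comp_comp _ _ _ _ _ _ q gs) (gm_comp_comp _ _ _ _ _ _ q gs).
have -> : q - -1 - -1 = q + 1 + 1 :> int by lia.
have -> : q - -1 = q + 1 :> int by lia.
have gPs := smooth_Uproj (q + 1 + 1) oA gs.
have L j' k' := @nabla_nabla_Uproj _ true true j' k' g (q + 1 + 1) (q + 1) (q + 1 + 1) q gs.
apply: etrans (L j k _ _ _ _) _; try by rewrite /deg; lia.
apply: etrans (esym (L k j _ _ _ _)); try by rewrite /deg; lia.
by rewrite (nabla_sym true j true k oA As is_ gPs).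
Qed.

End AtPoint.

(** Write [f] minus its projection to [U^p] as a section [h] of [F^(p+1)]. The
    derivative of [h] is again in [F^(p+1)] and that of [f] is zero, so the
    derivative of the projection has no component in [U^p]. *)
Lemma gm_dbar_Uproj_holo A i s r j (f : sections V r) p :
  open A -> A s -> cdom i s -> smooth_sections A f ->
  (forall t, A t -> (f t <= Ft V t p)%MS) ->
  nabla false i j f s = 0 ->
  gm_comp 0 false i j (fun t => f t *m P p t) s = 0.
Proof.
move=> oA As is_ fs fF f0; apply: (gm_comp_ext is_) => q; rewrite mul0mx subr0.
have fPs := smooth_Uproj p oA fs.
have [<-|pq] := eqVneq p q; last first.
  rewrite (@nabla_eq _ _ _ _ _ _ _ _ _ (fun t => 0)) ?nabla0 ?mul0mx// => t.
  by rewrite -mulmxA UprojM (negbTE pq) mulmx0.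
rewrite (@nabla_eq _ _ _ _ _ _ _ _ _ (fun t => f t *m P p t)); last first.
  by move=> t; rewrite -mulmxA UprojMM.
pose h : sections V r := fun t => f t + (- 1)%:M *m (f t *m P p t).
have Nfs : smooth_sections A (fun t => (- 1)%:M *m (f t *m P p t) : 'M[C]_(r, brk E t)).
  exact: (smooth_sectionsM oA (smooth_mx_cst A ((- 1)%:M : 'M[C]_r)) fPs).
have hs : smooth_sections A h := smooth_sectionsD oA fs Nfs.
have hF t : A t -> (h t <= Ft V t (p + 1))%MS.
  move=> At; rewrite /h mul_scalar_mx scaleN1r.
  have hFp : (f t - f t *m P p t <= Ft V t p)%MS.
    by apply: sub_sub (fF t At) _; exact: Uproj_F.
  have [e [ue ne]] := near_Uproj V t; have [e0 e1] := nbhs_singleton ne.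
  have hP q' : (f t - f t *m P p t) *m P q' t = if q' <= p then 0 else f t *m P q' t.
    rewrite mulmxBl -mulmxA UprojM; have [->|pq'] := eqVneq p q'.
      by rewrite lexx subrr.
    rewrite mulmx0 subr0; case: leP => // q'p.
    by apply: (Uproj_F0 (fF t At)); rewrite lt_neqAle eq_sym pq'.
  rewrite -[X in (X <= _)%MS]mulmx1 -e1 mulmx_sumr.
  apply: summx_sub => q' _; rewrite hP; case: leP => // [_|pq']; first exact: sub0mx.
  by apply: submx_trans (Uproj_F q' _) (F_le (F_filtration V t) _); lia.
have [nh _] := nabla_F j oA As is_ hs hF.
have hz : nabla false i j h s *m P p s = 0 by apply: (Uproj_F0 nh); lia.
have hE : nabla false i j h s = (- 1)%:M *m nabla false i j (fun t => f t *m P p t) s.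
  rewrite (nablaD As is_ false j fs Nfs) f0 add0r.
  by rewrite (nablaM oA As is_ false j (smooth_mx_cst A _) fPs) dmx_cst mul0mx add0r.
move: hz; rewrite hE mul_scalar_mx scaleN1r mulNmx => /eqP.
by rewrite oppr_eq0 => /eqP.
Qed.

(** A vector of [U^p] is a combination of the values of a holomorphic frame of
    [F^p]; extend it with constant coefficients and project to [U^p]. *)
Lemma gm_dbar_extend s0 p (w : 'rV[C]_(brk E s0)) :
  exists B (g : sections V 1), [/\ open B, B s0, smooth_sections B g,
    g s0 = w *m P p s0 &
    forall i j s, B s -> cdom i s -> gm_comp 0 false i j g s = 0].
Proof.
have [B [r [f [oB Bs0 fs ff f0]]]] := holo_subbundle_frame s0 (F_holo V p).
have [_ fF0] := ff s0 Bs0.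
have /submxP[c cE] : (w *m P p s0 <= f s0)%MS by rewrite fF0; exact: Uproj_F.
pose g : sections V 1 := fun t => c *m (f t *m P p t).
have fPs := smooth_Uproj p oB fs.
exists B, g; split; [exact: oB|by []| | |].
- exact: (smooth_sectionsM oB (smooth_mx_cst B c) fPs).
- by rewrite /g mulmxA -cE -mulmxA UprojMM.
- move=> i j s Bs is_; rewrite /g (gm_compM oB Bs is_ 0 false j (smooth_mx_cst B c) fPs).
  rewrite eqxx dmx_cst mul0mx add0r.
  rewrite (gm_dbar_Uproj_holo oB Bs is_ fs _ (f0 i j s Bs is_)) ?mulmx0//.
  by move=> t Bt; have [_ <-] := ff t Bt.
Qed.

(** The spaces [U^p] span the fibre, so the sections of [gm_dbar_extend] contain a
    local frame. *)
Lemma gm_dbar_integrable : Defs.integrable (gm_dbar V).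
Proof.
move=> s0; pose m := brk E s0.
pose Gen (v : 'rV[C]_m) := exists p (w : 'rV[C]_(brk E s0)), v = w *m P p s0.
have [G [Gfree GG]] : exists G : 'M[C]_m, row_free G /\ forall k : 'I_m, Gen (row k G).
  apply: (@row_free_select _ _ Gen 1%:M); last by rewrite mxrank1.
  move=> X GX; have [e [ue ne]] := near_Uproj V s0; have [_ <-] := nbhs_singleton ne.
  apply: summx_sub => p _; apply/row_subP => k; apply: GX.
  by exists p, (delta_mx 0 k); rewrite -rowE.
pose Q (k : 'I_m) (B : set S) (h : sections V 1) :=
  forall i j s, B s -> cdom i s -> gm_comp 0 false i j h s = 0.
have ext (k : 'I_m) : exists B h,
    [/\ open B, B s0, smooth_sections B h, h s0 = row k G & Q k B h].
  by have [p [w ->]] := GG k; exact: gm_dbar_extend.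
have [A [g [oA As0 gs gfree gk]]] := free_rows_extend Gfree ext.
have [B [oB Bs0 BP]] := near_open (near_brk V s0).
exists (A `&` B), m, g; split.
- exact: openI.
- by [].
- move=> t [At Bt]; split; first exact: gfree.
  rewrite /row_full (eqP (gfree t At)); apply/eqP; exact: esym (BP t Bt).
- move=> k a l.
  have oABa : open (A `&` B `&` fdom a).
    by apply: openI; [exact: openI|exact: open_fdom].
  apply: smooth_fun_ext (smooth_fun_sub _ (gs a k l)) => //.
    by move=> t _; rewrite /loc -row_mul [RHS]mxE.
  by move=> t [[]].
- move=> k i j s [As _] is_; rewrite gm_dbarE.
  have [D [h [oD AD hz rE]]] := gk k.
  have rE' t : D t -> (row k (g t) : 'rV_(brk E t)) = h t by move=> _; exact: rE.
  apply: etrans (@gm_comp_local _ _ _ V D _ 0 false i j _ _ s oD rE' (AD s As) is_) _.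
  exact: hz (AD s As) is_.
Qed.

Lemma gm_higgs : higgs_bundle (gm_dbar V) (gm_theta V).
Proof.
split.
- exact: gm_smooth_bundle.
- exact: gm_dbar_dolbeault.
- exact: gm_dbar_integrable.
- exact: gm_theta_form.
- move=> A sigma oA ss i j k s As is_; apply/eqP; rewrite subr_eq0; apply/eqP.
  rewrite gm_dbarE gm_thetaE.
  rewrite (@gm_comp_local _ _ _ _ setT _ _ _ _ _ _
    (gm_comp (- 1) true i k (sigma : sections V 1)) _ openT)//; last first.
    by move=> t _; rewrite gm_thetaE.
  rewrite [RHS](@gm_comp_local _ _ _ _ setT _ _ _ _ _ _
    (gm_comp 0 false i j (sigma : sections V 1)) _ openT)//; last first.
    by move=> t _; rewrite gm_dbarE.
  exact: (gm_dbar_theta_comm oA As is_ j k (smooth_sectionE ss)).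
- move=> A sigma oA ss i j k s As is_; apply/eqP; rewrite subr_eq0; apply/eqP.
  rewrite !gm_thetaE.
  rewrite (@gm_comp_local _ _ _ _ setT _ _ _ _ _ _
    (gm_comp (- 1) true i k (sigma : sections V 1)) _ openT)//; last first.
    by move=> t _; rewrite gm_thetaE.
  rewrite [RHS](@gm_comp_local _ _ _ _ setT _ _ _ _ _ _
    (gm_comp (- 1) true i j (sigma : sections V 1)) _ openT)//; last first.
    by move=> t _; rewrite gm_thetaE.
  exact: (gm_theta_comm oA As is_ j k (smooth_sectionE ss)).
Qed.

End HiggsEquations.

(** * The action of scalars *)

Section ScalarAction.
Context {R : realType} {n : nat} {S : complex_manifold R n}.
Variable V : vmhs S.
Local Notation C := R[i].
Local Notation E := (complexify V).
Implicit Types (A B : set S) (s t : S) (i : chart_idx S) (j k : 'I_n) (p q d : int).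

Local Notation P := (Uproj V).

Let openAi A i : open A -> open (A `&` cdom i).
Proof. by move=> oA; apply: openI => //; exact: open_cdom. Qed.

Lemma gm_comp_scale_cst A i s r d b j (c : C) (g : sections V r) :
  open A -> A s -> cdom i s -> smooth_sections A g ->
  gm_comp d b i j (fun t => c *: g t) s = c *: gm_comp d b i j g s.
Proof.
move=> oA As is_ gs.
rewrite (gm_comp_scale d b j oA As is_ (smooth_fun_cst A c) gs) der_cst scale0r.
by rewrite if_same add0r.
Qed.

Lemma scale_form10 c (theta : form_operator E) :
  end_form10 theta -> end_form10 (scale_operator c theta).
Proof.
move=> [T [Ts Tc TE]]; exists (fun i j s => c *: T i j s); split.
- move=> i j a b k l.
  have oD : open (cdom i `&` (fdom a `&` fdom b)).
    by apply: openI; [exact: open_cdom|apply: openI; exact: open_fdom].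
  apply: smooth_fun_ext (smooth_funM oD (smooth_fun_cst _ c) (Ts i j a b k l)) => //.
  by move=> s _; rewrite -scalemxAr -scalemxAl [RHS]mxE.
- move=> i i' j s is_ i's; rewrite (Tc i i' j s is_ i's) scaler_sumr.
  by apply: eq_bigr => k _; rewrite !scalerA mulrC.
- move=> A sigma oA ss i j s As is_.
  by rewrite /scale_operator (TE A sigma oA ss i j s As is_) scalemxAr.
Qed.

Lemma gm_theta_scale_comp A d b i j k s (c : C) (sigma : section E) : open A ->
  smooth_section A sigma -> A s -> cdom i s ->
  gm_comp d b i j (scale_operator c (gm_theta V) i k sigma : sections V 1) s =
  c *: gm_comp d b i j (gm_comp (- 1) true i k (sigma : sections V 1)) s.
Proof.
move=> oA ss As is_.
have ts := smooth_gm_comp (- 1) true i k oA (smooth_sectionE ss).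
apply: etrans (gm_comp_scale_cst d b j c (openAi i oA) (conj As is_) is_ ts).
have gh t : (A `&` cdom i) t -> (scale_operator c (gm_theta V) i k sigma t : 'rV_(brk E t)) =
    c *: gm_comp (- 1) true i k (sigma : sections V 1) t.
  by move=> _; rewrite /scale_operator gm_thetaE.
exact: (@gm_comp_local _ _ _ V _ _ d b i j _ _ s (openAi i oA) gh (conj As is_) is_).
Qed.

Lemma gm_higgs_scale (c : C) :
  higgs_bundle (gm_dbar V) (scale_operator c (gm_theta V)).
Proof.
split.
- exact: gm_smooth_bundle.
- exact: gm_dbar_dolbeault.
- exact: gm_dbar_integrable.
- exact: scale_form10 (gm_theta_form V).
- move=> A sigma oA ss i j k s As is_.
  rewrite gm_dbarE (gm_theta_scale_comp 0 false j k c oA ss As is_).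
  rewrite /scale_operator gm_thetaE (gm_dbar_theta_comm oA As is_ j k (smooth_sectionE ss)).
  have gh t : setT t -> gm_dbar V i j sigma t = gm_comp 0 false i j (sigma : sections V 1) t.
    by move=> _; exact: gm_dbarE.
  have -> := @gm_comp_local _ _ _ V _ _ (- 1) true i k _ _ s openT gh I is_.
  exact: subrr.
- move=> A sigma oA ss i j k s As is_.
  have cE j' k' : scale_operator c (gm_theta V) i j'
      (scale_operator c (gm_theta V) i k' sigma) s =
      c *: (c *: gm_comp (- 1) true i j' (gm_comp (- 1) true i k' (sigma : sections V 1)) s).
    rewrite [LHS]/scale_operator gm_thetaE.
    by rewrite (gm_theta_scale_comp (- 1) true j' k' c oA ss As is_).
  rewrite (cE j k) (cE k j) (gm_theta_comm oA As is_ j k (smooth_sectionE ss)).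
  exact: subrr.
Qed.

Definition grading_aut (c : C) s : 'M[C]_(brk E s) :=
  \sum_(p \in [set: int]) c ^ p *: P p s.

Lemma grading_autP c q s : grading_aut c s *m P q s = c ^ q *: P q s.
Proof.
have [e [ue ne]] := near_Uproj V s; have [e0 _] := nbhs_singleton ne.
rewrite /grading_aut (fsum_seq _ ue) => [|p pe]; last by rewrite (e0 p pe) scaler0.
have QP (Q : int -> 'M[C]_(brk E s)) :
    (forall p q, Q p *m Q q = if p == q then Q p else 0) ->
    (forall p, p \notin e -> Q p = 0) ->
    (\sum_(p <- e) c ^ p *: Q p) *m Q q = c ^ q *: Q q.
  move=> QM Q0; rewrite mulmx_suml; have [qe|qe] := boolP (q \in e).
    rewrite (bigD1_seq q)//= big1 => [|p pq]; last first.
      by rewrite -scalemxAl QM (negbTE pq) scaler0.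
    by rewrite -scalemxAl QM eqxx addr0.
  by rewrite (Q0 q qe) scaler0 big1// => p _; rewrite mulmx0.
exact: (QP (fun p => P p s) (fun p q => UprojM V p q s) e0).
Qed.

Lemma grading_autV c s : c != 0 -> grading_aut c s *m grading_aut c^-1 s = 1%:M.
Proof.
move=> c0; apply: (@Uproj_ext _ _ _ V) => q.
rewrite -(mulmxA (grading_aut c s)) grading_autP -scalemxAr grading_autP scalerA.
by rewrite -exprzMl ?unitfE ?invr_eq0// mulVf// exp1rz scale1r mul1mx.
Qed.

Lemma smooth_grading_aut c : @smooth_hom _ _ _ E E setT (grading_aut c).
Proof.
move=> a b k l; apply: smooth_fun_local => s [_ [as_ bs]].
have [e [ue ne]] := near_Uproj V s; have [B [oB Bs BP]] := near_open ne.
pose D := B `&` (fdom a `&` fdom b).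
have oD : open D by apply: openI => //; apply: openI; exact: open_fdom.
exists D; split; [exact: oD|by []|].
have Ps : smooth_mx D (fun t => \sum_(p <- e) c ^ p *: (frame a t *m P p t *m coframe b t)).
  apply: smooth_mx_sum => // p; apply: smooth_mxZ => //; first exact: smooth_fun_cst.
  by move=> k' l'; apply: smooth_fun_sub (@Uproj_smooth _ _ _ V p a b k' l') => t [].
apply: smooth_fun_ext (Ps k l) => // t [/BP[e0 _] _].
rewrite /grading_aut (fsum_seq _ ue) => [|p pe]; last by rewrite (e0 p pe) scaler0.
rewrite mulmx_sumr mulmx_suml; apply: (congr1 (fun M : 'M[C]__ => M k l)).
by apply: eq_bigr => p _; rewrite -scalemxAr -scalemxAl.
Qed.

(** The automorphism is [c ^ (q - d)] on [U^(q-d)] and [c ^ q] on [U^q], and a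
    component of degree [d] maps the former to the latter. *)
Lemma gm_comp_grading A i s r d b j c (g : sections V r) : c != 0 ->
  open A -> A s -> cdom i s -> smooth_sections A g ->
  gm_comp d b i j (fun t => g t *m grading_aut c t) s =
  c ^ (- d) *: (gm_comp d b i j g s *m grading_aut c s).
Proof.
move=> c0 oA As is_ gs; apply: (gm_comp_ext is_) => q.
have gPs := smooth_Uproj (q - d) oA gs.
have -> : nabla b i j (fun t => g t *m grading_aut c t *m P (q - d) t) s =
    c ^ (q - d) *: nabla b i j (fun t => g t *m P (q - d) t) s.
  have gE t : g t *m grading_aut c t *m P (q - d) t = (c ^ (q - d))%:M *m (g t *m P (q - d) t).
    by rewrite -(mulmxA (g t)) grading_autP mul_scalar_mx -scalemxAr.
  apply: etrans (nabla_eq b i j s gE) _.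
  rewrite (nablaM oA As is_ b j (smooth_mx_cst A ((c ^ (q - d))%:M)) gPs).
  by rewrite dmx_cst mul0mx add0r mul_scalar_mx.
rewrite -scalemxAl -(gm_comp_Uproj is_ d b j g q) -[in RHS]scalemxAl.
rewrite -(mulmxA (gm_comp d b i j g s)) grading_autP -scalemxAr scalerA.
by rewrite -expfzDr// addrC.
Qed.

Lemma gm_higgs_iso c : c != 0 ->
  higgs_iso (gm_dbar V) (scale_operator c (gm_theta V)) (gm_dbar V) (gm_theta V).
Proof.
move=> c0; exists (grading_aut c); split; first exact: smooth_grading_aut.
  move=> s; have V1 := grading_autV s c0.
  have free : row_free (grading_aut c s) by apply/row_freeP; exists (grading_aut c^-1 s).
  by split => //; rewrite -row_free_unit in free *; rewrite row_full_unit.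
move=> A sigma oA ss i j s As is_; have ss' := smooth_sectionE ss.
split.
  rewrite gm_dbarE (gm_comp_grading 0 false j c0 oA As is_ ss') oppr0 expr0z scale1r.
  by rewrite gm_dbarE.
rewrite gm_thetaE (gm_comp_grading (- 1) true j c0 oA As is_ ss') opprK expr1z.
by rewrite /scale_operator gm_thetaE scalemxAl.
Qed.

End ScalarAction.

Theorem corollary5p3 (R : realType) (n : nat) (S : complex_manifold R n)
    (V : vmhs S) :
  higgs_bundle (gm_dbar V) (gm_theta V) /\
  forall lambda : R[i], lambda != 0 ->
    higgs_bundle (gm_dbar V) (scale_operator lambda (gm_theta V)) /\
    higgs_iso (gm_dbar V) (scale_operator lambda (gm_theta V))
              (gm_dbar V) (gm_theta V).
Proof.
split; first exact: gm_higgs.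
by move=> c c0; split; [exact: gm_higgs_scale|exact: gm_higgs_iso].
Qed.
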